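(* Let $\{y_k\}$ be the stationary GARCH$(p,q)$ sequence with parameter $\boldsymbol\theta$ and innovations $\{\varepsilon_k\}$ described in the context, and let $h:\mathbb{R}\to(0,\infty)$, $g$, $g_1$, $\hat L_n$ and $\hat{\boldsymbol\theta}_n$ be as there. Assume: (a) $E\log\|A_0\|<\infty$ and $\gamma_L<0$; (b) $\boldsymbol\theta$ is in the interior of $U$; (c) the polynomials $\alpha_1x+\alpha_2x^2+\cdots+\alpha_px^p$ and $1-\beta_1x-\beta_2x^2-\cdots-\beta_qx^q$ are coprime in the set of polynomials with real coefficients; (d) $\varepsilon_0^2$ is a nondegenerate random variable; (e) $\lim_{t\to0}t^{-\mu}P\{\varepsilon_0^2\le t\}=0$ for some $\mu>0$; (f) $E|\varepsilon_0^2|^{\kappa}<\infty$ for some $\kappa>0$; (g) there are $0<C_0<\infty$ and $0\le\nu_0<2\kappa$ such that $E|\log h(\varepsilon_0t)|\le C_0(t^{\nu_0}+1)$ for all $t>0$; (h) there are a function $C_1$ and $0\le\nu_1<2\kappa$ such that $|g_1(y,t)|\le C_1(y)(t^{\nu_1}+1)/t$ for all $0<t<\infty$ and $y\in\mathbb{R}$, and $EC_1(\varepsilon_0)<\infty$; (i) $Eg(\varepsilon_0,t)<Eg(\varepsilon_0,1)$ for all $0<t<\infty$, $t\ne1$. Then $\hat{\boldsymbol\theta}_n\to\boldsymbol\theta$ almost surely as $n\to\infty$.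
   Context: Model. Let $p,q\ge1$ be integers, $\{\varepsilon_i,-\infty<i<\infty\}$ independent, identically distributed real random variables, and $\boldsymbol\theta=(\omega,\alpha_1,\dots,\alpha_p,\beta_1,\dots,\beta_q)$ constants with $\omega>0$, $\alpha_i\ge0$, $\beta_j\ge0$. $\{y_k,\sigma_k\}$, $\sigma_k\ge0$, is the stationary solution (unique when $E\log\|A_0\|<\infty$ and $\gamma_L<0$) of $$y_k=\sigma_k\varepsilon_k,\qquad \sigma_k^2=\omega+\sum_{1\le i\le p}\alpha_iy_{k-i}^2+\sum_{1\le j\le q}\beta_j\sigma_{k-j}^2,\qquad k\in\mathbb{Z}.$$ Top Liapounov exponent. If $p=1$ or $q=1$, replace in this paragraph only $p$ by $\max(p,2)$ and $q$ by $\max(q,2)$, with the additional coefficients equal to $0$. Let $\boldsymbol\tau_n=(\beta_1+\alpha_1\varepsilon_n^2,\beta_2,\dots,\beta_{q-1})\in\mathbb{R}^{q-1}$, $\boldsymbol\xi_n=(\varepsilon_n^2,0,\dots,0)\in\mathbb{R}^{q-1}$, $\boldsymbol\alpha=(\alpha_2,\dots,\alpha_{p-1})\in\mathbb{R}^{p-2}$ and let $A_n$ be the $(p+q-1)\times(p+q-1)$ block matrix $$A_n=\begin{bmatrix}\boldsymbol\tau_n&\beta_q&\boldsymbol\alpha&\alpha_p\\ \mathbf I_{q-1}&0&0&0\\ \boldsymbol\xi_n&0&0&0\\ 0&0&\mathbf I_{p-2}&0\end{bmatrix}.$$ With $\|\cdot\|$ the operator norm induced by the Euclidean norm, $\gamma_L=\inf_{1\le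 n<\infty}\frac1{n+1}E\log\|A_0A_1\cdots A_n\|$. Parameter set. Write $\mathbf u=(x,\mathbf s,\mathbf t)=(x,s_1,\dots,s_p,t_1,\dots,t_q)\in\mathbb{R}^{p+q+1}$. Fix $0<\underline u<\overline u$, $0<\rho_0<1$ with $q\underline u<\rho_0$. $U$ is the set of $\mathbf u$ with $t_1+\cdots+t_q\le\rho_0$ and all coordinates $x,s_1,\dots,s_p,t_1,\dots,t_q$ in $[\underline u,\overline u]$. Coefficients. $c_0(\mathbf u)=x/(1-(t_1+\cdots+t_q))$ and, for $i\ge1$, $c_i(\mathbf u)=s_i\mathbf 1\{i\le p\}+\sum_{1\le j\le\min(q,i-1)}t_jc_{i-j}(\mathbf u)$. Estimator. Let $h:\mathbb{R}\to(0,\infty)$ be a (measurable) function, $\hat w_k(\mathbf u)=c_0(\mathbf u)+\sum_{1\le i<k}c_i(\mathbf u)y_{k-i}^2$, $$\hat L_n(\mathbf u)=\frac1n\sum_{1<k\le n}\log\Big\{\frac1{\hat w_k^{1/2}(\mathbf u)}h\big(y_k/\hat w_k^{1/2}(\mathbf u)\big)\Big\},\qquad \hat{\boldsymbol\theta}_n=\arg\max_{\mathbf u\in U}\hat L_n(\mathbf u).$$ Let $g(y,t)=\log\{th(yt)\}$ and $g_1(y,t)=\frac{\partial}{\partial t}g(y,t)$ for $y\in\mathbb{R}$, $t>0$ (the derivative being assumed to exist). *)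

(* Defs.v *)
From HB Require Import structures.
From mathcomp Require Import all_boot all_order all_algebra.
From mathcomp Require Import all_classical all_reals all_analysis.

Set Implicit Arguments.
Unset Strict Implicit.
Unset Printing Implicit Defensive.

Import Order.TTheory GRing.Theory Num.Theory.
Import numFieldNormedType.Exports.

Local Open Scope classical_set_scope.
Local Open Scope ring_scope.

(* 1-based coordinates: entry v i is v_i for 1 <= i <= n, and 0 for every
   other i (this supplies the zero coefficients used to pad p and q). *)
Definition entry (R : realType) (n : nat) (v : 'rV[R]_n) (i : nat) : R :=
  if i is k.+1 then oapp (fun o : 'I_n => v ord0 o) 0 (insub k) else 0.

(* A parameter u = (x, s_1, ..., s_p, t_1, ..., t_q) is a row vector of length
   1 + p + q; the true parameter is (omega, alpha_1, ..., beta_q). *)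
Section GarchParam.
Variables (R : realType) (p q : nat).
Implicit Type u : 'rV[R]_(1 + p + q).

Definition par_x u : R := lsubmx (lsubmx u) ord0 ord0.
Definition par_s u (i : nat) : R := entry (rsubmx (lsubmx u)) i.
Definition par_t u (j : nat) : R := entry (rsubmx u) j.

Definition param_set (ulo uhi rho0 : R) : set 'rV[R]_(1 + p + q) :=
  [set u | \sum_(1 <= j < q.+1) par_t u j <= rho0 /\
           forall i, ulo <= u ord0 i <= uhi].

(* Course-of-values recursion with fuel n; the value at i does not depend on
   n as soon as i <= n (see ccoefE). *)
Fixpoint ccoef_rec u (n i : nat) : R :=
  if n is n'.+1 then
    par_s u i *+ (i <= p)%N
    + \sum_(1 <= j < (minn q i.-1).+1) par_t u j * ccoef_rec u n' (i - j)
  else 0.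

Definition ccoef u (i : nat) : R :=
  if i is 0 then par_x u / (1 - \sum_(1 <= j < q.+1) par_t u j)
  else ccoef_rec u i i.

Lemma ccoef_rec_fuel u n m i :
  (0 < i)%N -> (i <= n)%N -> (i <= m)%N -> ccoef_rec u n i = ccoef_rec u m i.
Proof.
elim: n m i => [|n IHn] [|m] [|i] //= _ lein leim.
congr (_ + _); apply: eq_big_nat => j /andP[j1]; rewrite ltnS leq_min => /andP[_ ji].
have ltji : (j < i.+1)%N by rewrite ltnS.
have le1 : (i.+1 - j <= i)%N by rewrite leq_subLR -add1n leq_add2r.
by rewrite (IHn m) ?subn_gt0 //; apply: leq_trans le1 _.
Qed.

Lemma ccoefE u i : (0 < i)%N ->
  ccoef u i = par_s u i *+ (i <= p)%N
    + \sum_(1 <= j < (minn q i.-1).+1) par_t u j * ccoef u (i - j).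
Proof.
case: i => // i _ /=; congr (_ + _).
apply: eq_big_nat => j /andP[j1]; rewrite ltnS leq_min => /andP[_ ji].
have ltji : (0 < i.+1 - j)%N by rewrite subn_gt0 ltnS.
have le1 : (i.+1 - j <= i)%N by rewrite leq_subLR -add1n leq_add2r.
congr (_ * _); have := ccoef_rec_fuel u ltji le1 (leqnn _).
by move=> ->; case: (i.+1 - j)%N ltji.
Qed.

Definition alpha_poly u : {poly R} := \sum_(1 <= i < p.+1) par_s u i *: 'X^i.
Definition beta_poly u : {poly R} :=
  1 - \sum_(1 <= j < q.+1) par_t u j *: 'X^j.

End GarchParam.

Section OperatorNorm.
Variable R : realType.

Definition euclid_norm (m : nat) (v : 'cV[R]_m) : R :=
  Num.sqrt (\sum_(i < m) v i ord0 ^+ 2).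

Definition opnorm (m : nat) (A : 'M[R]_m) : R :=
  sup [set euclid_norm (A *m v) | v in [set v : 'cV[R]_m | euclid_norm v = 1]].

End OperatorNorm.

Section Lyapunov.
Variables (R : realType) (p q : nat).

(* The matrix A_n at e = epsilon_n, with p and q replaced by P = max(p,2) and
   Q = max(q,2).  Rows and columns are numbered from 0.  The column blocks
   start at 0, Q-1, Q and P+Q-2; the row blocks start at 0, 1, Q and Q+1; both
   identity blocks lie on the first subdiagonal j = i-1. *)
Definition garch_mx (theta : 'rV[R]_(1 + p + q)) (e : R) :
    'M[R]_((maxn p 2 + maxn q 2).-1) :=
  let Q := maxn q 2 in
  \matrix_(i, j)
    if (i == 0 :> nat) then
      if (j < Q)%N then
        par_t theta j.+1 + (par_s theta 1 * e ^+ 2) *+ (j == 0 :> nat)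
      else par_s theta (j - Q).+2
    else if (i == Q :> nat) then (e ^+ 2) *+ (j == 0 :> nat)
    else (i == j.+1 :> nat)%:R.

Context (d : measure_display) (T : measurableType d) (P : probability T R).
Variables (theta : 'rV[R]_(1 + p + q)) (eps : int -> {RV P >-> R}).

(* E log ||A_0 A_1 ... A_n||, with log 0 = -oo *)
Definition Elog_norm (n : nat) : \bar R :=
  (\int[P]_w lne (opnorm (\big[mulmx/1%:M]_(0 <= i < n.+1)
                            garch_mx theta (eps i%:Z w)))%:E)%E.

Definition lyapunov : \bar R :=
  ereal_inf [set ((n.+1%:R)^-1%:E * Elog_norm n)%E | n in [set n | (1 <= n)%N]].

End Lyapunov.

Section Processes.
Context (R : realType) (d : measure_display) (T : measurableType d).
Variable P : probability T R.

Definition mutually_independent (X : int -> {RV P >-> R}) : Prop :=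
  forall (s : seq int) (B : int -> set R), uniq s ->
    (forall k, measurable (B k)) ->
    P (\bigcap_(k in [set` s]) (X k @^-1` B k)) =
    (\prod_(k <- s) P (X k @^-1` B k))%E.

Definition identically_distributed (X : int -> {RV P >-> R}) : Prop :=
  forall k l (B : set R), measurable B -> P (X k @^-1` B) = P (X l @^-1` B).

Definition iid (X : int -> {RV P >-> R}) : Prop :=
  mutually_independent X /\ identically_distributed X.

Definition strictly_stationary (d' : measure_display) (E : measurableType d')
    (X : int -> T -> E) : Prop :=
  forall (s : seq int) (l : int) (B : int -> set E),
    (forall k, measurable (B k)) ->
    P (\bigcap_(k in [set` s]) (X (k + l) @^-1` B k)) =
    P (\bigcap_(k in [set` s]) (X k @^-1` B k)).

Definition nondegenerate_rv (X : T -> R) : Prop :=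
  ~ exists c : R, {ae P, forall w, X w = c}.

Definition garch_solution (p q : nat) (theta : 'rV[R]_(1 + p + q))
    (eps y sigma : int -> {RV P >-> R}) : Prop :=
  {ae P, forall w, forall k : int,
    [/\ 0 <= sigma k w,
        y k w = sigma k w * eps k w
      & sigma k w ^+ 2 = par_x theta
          + \sum_(1 <= i < p.+1) par_s theta i * y (k - i%:Z) w ^+ 2
          + \sum_(1 <= j < q.+1) par_t theta j * sigma (k - j%:Z) w ^+ 2]}.

Definition garch_stationary (p q : nat) (theta : 'rV[R]_(1 + p + q))
    (eps y sigma : int -> {RV P >-> R}) : Prop :=
  garch_solution theta eps y sigma /\
  strictly_stationary (fun k w => (y k w, sigma k w)).

End Processes.

Section Estimator.
Variables (R : realType) (p q : nat) (h : R -> R).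

Definition g (y t : R) : R := ln (t * h (y * t)).

Definition g1 (y t : R) : R := derive1 (g y) t.

Variable y : int -> R.
Implicit Type u : 'rV[R]_(1 + p + q).

Definition w_hat (k : nat) u : R :=
  ccoef u 0 + \sum_(1 <= i < k) ccoef u i * y (k%:Z - i%:Z) ^+ 2.

Definition L_hat (n : nat) u : R :=
  n%:R^-1 * \sum_(2 <= k < n.+1)
    ln ((Num.sqrt (w_hat k u))^-1 * h (y k%:Z / Num.sqrt (w_hat k u))).

End Estimator.

Definition is_argmax (S : Type) (R : realType) (U : set S) (f : S -> R)
    (u : S) : Prop :=
  U u /\ forall v, U v -> f v <= f u.

(* Main.v *)
Require Import Defs.
From HB Require Import structures.
From mathcomp Require Import all_boot all_order all_algebra.
From mathcomp Require Import all_classical all_reals all_analysis measurable_realfun.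
From mathcomp Require Import lra ring zify.
Set Implicit Arguments.
Unset Strict Implicit.
Unset Printing Implicit Defensive.
Import Order.TTheory GRing.Theory Num.Theory.
Import numFieldNormedType.Exports.
Local Open Scope classical_set_scope.
Local Open Scope ring_scope.

(** For a parameter [u], the observations determine a conditional variance
    [w_k(u) = c_0(u) + \sum_i c_i(u) y_(k-i)^2], and the squared volatility is
    [sigma_k^2 = w_k(theta)]. Writing [y_k = sigma_k eps_k], the likelihood at
    [u] minus that at [theta] is the mean over [k <= n] of the gains
    [g(eps_k, sigma_k / sqrt(w_k(u))) - g(eps_k, sigma_k / sqrt(w_k(theta)))],
    up to the truncation of [w_k] to the observed past ([L_hat_gain]). The
    ratio [sigma_k / sqrt(w_k(u))] depends on the innovations before time [k],
    so that it is independent of [eps_k]: given the past, assumption (i) makes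
    the mean gain negative unless the ratio is [1], and the ratio is almost
    surely [1] only for [u = theta] ([vinf_identifiable], [contrast_neg]). It
    remains to sum over time, uniformly in [u].

    Summation over time uses half of the ergodic theorem: the Birkhoff sums of
    an integrable functional with negative mean are almost surely bounded
    above ([birkhoff_bounded]). It applies to functionals of the i.i.d.
    sequence of innovations, on which the shift is ergodic ([iid_birkhoff]).
    The volatilities have to be such functionals. A negative Lyapunov exponent
    makes the moments of some small order [s] of the matrix products along the
    past summable ([past_moment_small]); a stationary volatility therefore
    forgets its remote past and equals an explicit series ([volatility_sig2]),
    and has a finite moment of order [s].

    Uniformity in [u] comes from an integrable bound of the increments of the
    gains ([good_increment], [envelope_moment]). With respect to the logarithm
    of [sigma_k^2 / w_k(u)], the derivative of [g] grows at most like a power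
    of this ratio by assumption (h). The ratio is large only if several
    successive innovations are small ([garch_path_ratio]), hence it has moments
    of all orders: the inverses of the squared innovations have a small moment
    by assumption (e), and the number of innovations involved is free. Since
    [w_k(u)] is bounded below, [ln w_k(u)] is Hoelder continuous of small order
    in the variance, and only a small moment of the past volatilities is
    needed. The coefficients [c_i(u)] and their increments in [u] decay
    geometrically ([ccoef_le], [ccoef_close]), so that the truncation costs a
    geometrically small term.

    Near every [u0 <> theta] the gains thus have bounded Birkhoff sums even
    after a small drift is added, and the likelihood is eventually smaller
    than at [theta], uniformly ([local_gain_neg]). Compactness covers the
    complement of a neighbourhood of [theta] by finitely many such sets
    ([uniform_comparison]), which traps the maximizers ([argmax_close]). *)

(** * Bounded Birkhoff sums *)

Section Ergodic.
Context d (X : measurableType d) (R : realType) (mu : probability X R).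
Variable tau : X -> X.
Hypothesis mtau : measurable_fun setT tau.
Hypothesis tauP : forall A, measurable A -> mu (tau @^-1` A) = mu A.

Lemma ge0_integral_preserved (f : X -> \bar R) : measurable_fun setT f ->
  (forall x, 0 <= f x)%E -> (\int[mu]_x f (tau x) = \int[mu]_x f x)%E.
Proof.
move=> mf f0.
rewrite -[LHS](@ge0_integral_pushforward _ _ X X R tau mtau mu setT f)//.
by apply: eq_measure_integral => A mA _; exact: tauP.
Qed.

Lemma integrable_preserved (f : X -> R) : mu.-integrable setT (EFin \o f) ->
  mu.-integrable setT (EFin \o (f \o tau)).
Proof.
move=> /integrableP[mf fi]; apply/integrableP; split.
  by apply: (measurableT_comp mf).
rewrite (ge0_integral_preserved (f := fun x => `|(f x)%:E|%E))//.
by apply: measurableT_comp => //.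
Qed.

Lemma integral_preserved (f : X -> R) : mu.-integrable setT (EFin \o f) ->
  (\int[mu]_x (f (tau x))%:E = \int[mu]_x (f x)%:E)%E.
Proof.
move=> fi.
have mf : measurable_fun setT (EFin \o f) by move/integrableP: fi => [].
have fi' := integrable_preserved fi.
have := @integral_pushforward _ _ X X R tau mtau mu setT (EFin \o f) mf.
rewrite preimage_setT => /(_ fi' measurableT) /= <-.
by apply: eq_measure_integral => A mA _; exact: tauP.
Qed.

Hypothesis tau_ergodic : forall A, measurable A -> tau @^-1` A = A ->
  mu A = 0%E \/ mu A = 1%E.

Variable F : X -> R.
Hypothesis iF : mu.-integrable setT (EFin \o F).

(** Running maximum of the Birkhoff sums, cut at 0, in the recursive form
    that makes its composition with [tau] visible. *)
Fixpoint birkhoff_max (n : nat) (x : X) : R :=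
  if n is n'.+1 then Num.max 0 (F x + birkhoff_max n' (tau x)) else 0.

Lemma birkhoff_max_ge0 n x : 0 <= birkhoff_max n x.
Proof. by case: n => //= n; rewrite le_max lexx. Qed.

Lemma birkhoff_max_homo n x : birkhoff_max n x <= birkhoff_max n.+1 x.
Proof.
elim: n x => [|n ih] x /=; first by rewrite le_max lexx.
rewrite ge_max le_max lexx /= le_max; apply/orP; right.
by rewrite lerD2l; exact: ih.
Qed.

Lemma birkhoff_max_mono m n x : (m <= n)%N ->
  birkhoff_max m x <= birkhoff_max n x.
Proof.
elim: n => [|n ih]; first by rewrite leqn0 => /eqP ->.
rewrite leq_eqVlt => /predU1P[->//|]; rewrite ltnS => /ih /le_trans; apply.
exact: birkhoff_max_homo.
Qed.

Lemma birkhoff_sum_le_max n x :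
  \sum_(k < n) F (iter k tau x) <= birkhoff_max n x.
Proof.
elim: n x => [|n ih] x; first by rewrite big_ord0.
rewrite big_ord_recl /= le_max; apply/orP; right; rewrite lerD2l.
apply: le_trans (ih (tau x)); apply: ler_sum => i _.
by rewrite -iterSr /=.
Qed.

Lemma integrable_birkhoff_max n :
  mu.-integrable setT (EFin \o birkhoff_max n).
Proof.
elim: n => [|n ih]; first by exact: integrable0.
have i1 : mu.-integrable setT (EFin \o (fun x => F x + birkhoff_max n (tau x))).
  rewrite (_ : _ \o _ = (EFin \o F) \+ (EFin \o (birkhoff_max n \o tau)))%E.
    by apply: integrableD => //; exact: integrable_preserved.
  by apply/funext.
apply: (le_integrable _ _ _ i1) => //.
  apply/measurable_EFinP; apply: measurable_maxr => //.
  by move/integrableP: i1 => [] /measurable_EFinP.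
move=> x _ /=; rewrite lee_fin.
by rewrite ger0_norm ?le_max ?lexx// ge_max normr_ge0 ler_norm.
Qed.

Let diverges := \bigcap_k \bigcup_n [set x | k%:R < birkhoff_max n x].

Let measurable_diverges : measurable diverges.
Proof.
apply: bigcapT_measurable => k; apply: bigcupT_measurable => n.
have /integrableP[/measurable_EFinP mM _] := integrable_birkhoff_max n.
by rewrite -[X in measurable X]setTI; exact: measurable_fun_ltr.
Qed.

Let divergesP x : diverges x <-> forall B : R, exists n, B < birkhoff_max n x.
Proof.
split=> [dx B|dx k _]; last by have [n ?] := dx k%:R; exists n.
have [k Bk] : exists k : nat, B < k%:R.
  exists (Num.truncn `|B|).+1; apply: le_lt_trans (ler_norm B) _.
  exact: truncnS_gt.
by have [n _ /= kn] := dx k I; exists n; exact: lt_trans kn.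
Qed.

(** [birkhoff_max n.+1 x] and [birkhoff_max n (tau x)] differ by at most [`|F
    x|], so that they diverge together. *)
Let diverges_inv : tau @^-1` diverges = diverges.
Proof.
apply/seteqP; split=> x /= /divergesP dx; apply/divergesP => B.
  have [n Bn] := dx (B - F x); exists n.+1 => /=.
  by rewrite lt_max -ltrBlDl Bn orbT.
have [n Bn] := dx (`|F x| + `|B|).
case: n Bn => [|n] /=.
  by rewrite ltNge => /negP[]; rewrite addr_ge0.
rewrite lt_max ltNge addr_ge0//= => Bn; exists n.
have := ler_norm (F x); have := ler_norm B; lra.
Qed.

(** If the maxima diverged almost surely, then [M_(n+1) - M_n \o tau = max (-
    M_n \o tau) F] would converge to [F], dominated by [`|F|], although its
    integral [\int M_(n+1) - \int M_n] is nonnegative. By ergodicity the maxima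
    are therefore almost surely bounded. *)
Theorem birkhoff_bounded : (\int[mu]_x (F x)%:E < 0)%E ->
  {ae mu, forall x, exists B : R,
    forall n, \sum_(k < n) F (iter k tau x) <= B}.
Proof.
move=> F0.
have [d0|d1] := tau_ergodic measurable_diverges diverges_inv.
  exists diverges; split => // x /= nx; apply: contrapT => /divergesP.
  move=> H; apply: nx; apply: contrapT => nd; apply: H => B.
  apply: contrapT => nB; apply: nd; exists B => n.
  rewrite leNgt; apply/negP => Bn; apply: nB; exists n.
  exact: lt_le_trans (birkhoff_sum_le_max n x).
exfalso.
have aed : {ae mu, forall x, diverges x}.
  exists (~` diverges); split; [exact: measurableC| |by []].
  by rewrite probability_setC// d1 subee.
pose h n x := birkhoff_max n.+1 x - birkhoff_max n (tau x).
have hE n x : h n x = Num.max (- birkhoff_max n (tau x)) (F x).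
  rewrite /h /= /Num.max.
  by have [|] := ltP 0 (F x + _); have [|] := ltP (- _) (F x) => *; lra.
have ih n : mu.-integrable setT (EFin \o h n).
  rewrite (_ : _ \o _ = (EFin \o birkhoff_max n.+1) \-
                        (EFin \o (birkhoff_max n \o tau)))%E; last exact/funext.
  apply: integrableB => //; first exact: integrable_birkhoff_max.
  by apply: integrable_preserved; exact: integrable_birkhoff_max.
have h0 n : (0 <= \int[mu]_x (h n x)%:E)%E.
  rewrite (integralB_EFin (f1 := birkhoff_max n.+1) (f2 := birkhoff_max n \o tau))//; last 2 first.
  - exact: integrable_birkhoff_max.
  - by apply: integrable_preserved; exact: integrable_birkhoff_max.
  rewrite (integral_preserved (integrable_birkhoff_max n)).
  rewrite sube_ge0; last first.
    by rewrite (integrable_fin_num _ (integrable_birkhoff_max n))// orbT.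
  apply: le_integral => //; try exact: integrable_birkhoff_max.
  by move=> x _; rewrite /= lee_fin birkhoff_max_homo.
have mF : measurable_fun setT (EFin \o F) by move/integrableP: iF => [].
have cvgh : {ae mu, forall x, [set: X] x ->
    (fun n => (EFin \o h n) x) @ \oo --> (EFin \o F) x}.
  apply: filterS aed => x dx _; apply: cvg_near_cst.
  have dtx : diverges (tau x) by rewrite -[diverges _]/((tau @^-1` diverges) x) diverges_inv.
  have /divergesP /(_ (- F x)) [m Fm] := dtx.
  near=> n; congr EFin; rewrite hE max_r// lerNl.
  apply: le_trans (ltW Fm) _; apply: birkhoff_max_mono.
  by near: n; exact: nbhs_infty_ge.
have domh : {ae mu, forall x n, [set: X] x ->
    (`|(EFin \o h n) x| <= `|(F x)%:E|)%E}.
  apply: aeW => x n _ /=; rewrite lee_fin hE.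
  have := birkhoff_max_ge0 n (tau x); move: (birkhoff_max n (tau x)) => m m0.
  have [//|Fm] := leP (- m) (F x).
  by have := ler_norm (- F x); rewrite !normrN (ger0_norm m0); lra.
have [_ _ cvgF] := dominated_convergence measurableT
  (fun n => measurable_int _ (ih n)) mF cvgh
  (integrable_abse iF) domh.
have : (0 <= \int[mu]_x (EFin \o F) x)%E.
  rewrite -(cvg_lim _ cvgF)//; apply: lime_ge; last by apply: nearW => n; exact: h0.
  by apply/cvg_ex; eexists; exact: cvgF.
by rewrite leNgt F0.
Unshelve. all: by end_near. Qed.

End Ergodic.

(** * Independent identically distributed sequences *)

Section SequenceSpace.
Variable R : realType.

Definition cylinder (s : seq int) (B : int -> set R) : set (int -> R) :=
  [set om | forall k, k \in s -> B k (om k)].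

Definition cylinders : set (set (int -> R)) :=
  [set C | exists s B, (forall k, measurable (B k)) /\ C = cylinder s B].

Definition seqspace : Type := g_sigma_algebraType cylinders.
HB.instance Definition _ := Measurable.copy seqspace (g_sigma_algebraType cylinders).

Lemma measurable_cylinder s B : (forall k, measurable (B k)) ->
  measurable (cylinder s B : set seqspace).
Proof. by move=> mB; apply: sub_sigma_algebra; exists s, B. Qed.

Lemma measurable_coord k : measurable_fun setT (fun om : seqspace => om k).
Proof.
move=> _ B mB; rewrite setTI.
rewrite (_ : _ @^-1` _ = cylinder [:: k] (fun=> B)); first exact: measurable_cylinder.
apply/seteqP; split=> om /=; first by move=> Bk j; rewrite inE => /eqP ->.
by apply; rewrite inE.
Qed.

Lemma measurable_seqspaceP d (T : measurableType d) (f : T -> seqspace) :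
  (forall k, measurable_fun setT (fun t => f t k)) -> measurable_fun setT f.
Proof.
move=> mf; apply: (measurability (cylinders : set (set seqspace))) => //.
move=> _ [_ [s [B [mB ->]]] <-].
rewrite setTI (_ : _ @^-1` _ = \bigcap_(k in [set` s]) ((fun t => f t k) @^-1` B k)).
  by apply: fin_bigcap_measurable => // k _; rewrite -[X in measurable X]setTI; exact: mf.
by apply/seteqP; split=> t /= H k; apply: H.
Qed.

Lemma cylinders_setI : setI_closed cylinders.
Proof.
move=> _ _ [s [B [mB ->]]] [s' [B' [mB' ->]]].
pose D (s : seq int) (B : int -> set R) k := if k \in s then B k else setT.
exists (s ++ s'), (fun k => D s B k `&` D s' B' k); split.
  by move=> k; apply: measurableI; rewrite /D; case: ifP.
apply/seteqP; split=> om /=.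
  move=> [H H'] k _; split; rewrite /D; case: ifPn => // ks; [exact: H|exact: H'].
move=> H; split=> k ks.
  by have [] := H k; rewrite ?mem_cat ?ks// /D ks.
by have [] := H k; rewrite ?mem_cat ?ks ?orbT// /D ks.
Qed.

Lemma cylinder_setT : cylinders setT.
Proof. by exists [::], (fun=> setT); split=> //; apply/seteqP; split. Qed.

(** Cylinders are closed under intersection, so that they determine finite
    measures. *)
Lemma seqspace_measure_unique (m1 m2 : {measure set seqspace -> \bar R}) :
  (m1 setT < +oo)%E -> (forall C, cylinders C -> m1 C = m2 C) ->
  forall A, measurable A -> m1 A = m2 A.
Proof.
move=> m1T m12; apply: (measure_unique (cylinders : set (set seqspace)) (fun=> setT)) => //.
- exact: cylinders_setI.
- by move=> _; exact: cylinder_setT.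
- by apply/seteqP; split=> // x _; exists 0%N.
Qed.

End SequenceSpace.

Section Laws.
Context (R : realType) d (T : measurableType d) (P : probability T R).

Lemma law_eq (X Y : T -> seqspace R) :
  measurable_fun setT X -> measurable_fun setT Y ->
  (forall C, cylinders C -> P (X @^-1` C) = P (Y @^-1` C)) ->
  forall A, measurable A -> P (X @^-1` A) = P (Y @^-1` A).
Proof.
move=> mX mY XY A mA.
pose X' : {mfun T >-> seqspace R} := HB.pack X (isMeasurableFun.Build _ _ _ _ _ mX).
pose Y' : {mfun T >-> seqspace R} := HB.pack Y (isMeasurableFun.Build _ _ _ _ _ mY).
rewrite -[LHS]/(distribution P X' A) -[RHS]/(distribution P Y' A).
apply: seqspace_measure_unique => //.
by rewrite -ge0_fin_numE// fin_num_measure.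
Qed.

(** Both sides are finite measures in [A]. *)
Lemma law_indep_event (X : T -> seqspace R) (E : set T) :
  measurable_fun setT X -> measurable E ->
  (forall C, cylinders C -> P (X @^-1` C `&` E) = P (X @^-1` C) * P E)%E ->
  forall A, measurable A -> (P (X @^-1` A `&` E) = P (X @^-1` A) * P E)%E.
Proof.
move=> mX mE XE A mA.
pose m1 : {measure set seqspace R -> \bar R} :=
  measure_function_pushforward__canonical__measure_function_Measure
    (mrestr P mE) mX.
pose m2 : {measure set seqspace R -> \bar R} :=
  measure_function_pushforward__canonical__measure_function_Measure P mX.
have PE0 : 0 <= fine (P E) by exact: fine_ge0.
have PEE : ((fine (P E))%:E = P E)%E by rewrite fineK// fin_num_measure.
have := @seqspace_measure_unique R m1 (mscale (NngNum PE0) m2) _ _ A mA.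
rewrite /m1 /m2 /= /mscale /= /pushforward /mrestr /= PEE muleC; apply.
  rewrite preimage_setT setTI; exact: le_lt_trans (probability_le1 _ mE) (ltry _).
by move=> C CC; rewrite XE// muleC.
Qed.

(** The two events are freed from cylinders one after the other, each time by
    the uniqueness of finite measures. *)
Lemma law_indep (X Y : T -> seqspace R) :
  measurable_fun setT X -> measurable_fun setT Y ->
  (forall C D, cylinders C -> cylinders D ->
    P (X @^-1` C `&` Y @^-1` D) = P (X @^-1` C) * P (Y @^-1` D))%E ->
  forall A B, measurable A -> measurable B ->
    (P (X @^-1` A `&` Y @^-1` B) = P (X @^-1` A) * P (Y @^-1` B))%E.
Proof.
move=> mX mY XY A B mA mB.
have mC : forall C, cylinders C -> measurable (C : set (seqspace R)).
  by move=> _ [s [D [mD ->]]]; exact: measurable_cylinder.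
have mXp C : measurable C -> measurable (X @^-1` C).
  by move=> ?; rewrite -[X in measurable X]setTI; exact: mX.
have mYp C : measurable C -> measurable (Y @^-1` C).
  by move=> ?; rewrite -[X in measurable X]setTI; exact: mY.
apply: law_indep_event => //; first exact: mYp.
move=> C CC; rewrite setIC muleC; apply: law_indep_event => //.
  exact: (mXp _ (mC _ CC)).
by move=> D DD; rewrite setIC muleC; exact: XY.
Qed.

(** Independence makes the joint law a product law, to which Tonelli's theorem
    applies. *)
Lemma joint_law_fubini d1 d2 (T1 : measurableType d1) (T2 : measurableType d2)
    (f : T -> T1) (z : T -> T2) (G : T1 * T2 -> \bar R) :
  measurable_fun setT f -> measurable_fun setT z ->
  (forall A B, measurable A -> measurable B ->
    P (f @^-1` A `&` z @^-1` B) = P (f @^-1` A) * P (z @^-1` B))%E ->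
  measurable_fun setT G -> (forall x, 0 <= G x)%E ->
  measurable_fun setT (fun v => \int[P]_w G (f w, z v))%E /\
  (\int[P]_w G (f w, z w) = \int[P]_v \int[P]_w G (f w, z v))%E.
Proof.
move=> mf mz fz mG G0.
pose f' : {mfun T >-> T1} := HB.pack f (isMeasurableFun.Build _ _ _ _ _ mf).
pose z' : {mfun T >-> T2} := HB.pack z (isMeasurableFun.Build _ _ _ _ _ mz).
have mfz : measurable_fun setT (fun w => (f w, z w)) by exact: measurable_fun_pair.
pose fz' : {mfun T >-> (T1 * T2)%type} :=
  HB.pack (fun w => (f w, z w)) (isMeasurableFun.Build _ _ _ _ _ mfz).
have innerE v : (\int[P]_w G (f w, z v) = \int[distribution P f']_x G (x, z v))%E.
  rewrite (@ge0_integral_pushforward _ _ _ _ _ f mf)//.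
  exact: measurableT_comp.
split.
  under eq_fun do rewrite innerE.
  apply: (measurableT_comp (f := fun y => \int[distribution P f']_x G (x, y))%E) => //.
  exact: measurable_fun_fubini_tonelli_G.
transitivity (\int[distribution P fz']_x G x)%E.
  by rewrite ge0_integral_distribution.
transitivity (\int[distribution P f' \x distribution P z']_x G x)%E.
  apply: eq_measure_integral => A mA _; apply/esym.
  exact: product_measure_unique.
rewrite fubini_tonelli2//.
rewrite (@ge0_integral_pushforward _ _ _ _ _ z mz)//.
- by apply: eq_integral => v _; rewrite /= innerE.
- exact: measurable_fun_fubini_tonelli_G.
- by move=> y _; exact: integral_ge0.
Qed.

Lemma indep_integralM (f z : T -> \bar R) :
  measurable_fun setT f -> measurable_fun setT z ->
  (forall x, 0 <= f x)%E -> (forall x, 0 <= z x)%E ->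
  (forall A B, measurable A -> measurable B ->
    P (f @^-1` A `&` z @^-1` B) = P (f @^-1` A) * P (z @^-1` B))%E ->
  (\int[P]_w (f w * z w) = \int[P]_w f w * \int[P]_w z w)%E.
Proof.
move=> mf mz f0 z0 fz.
(* absolute values make the integrand nonnegative on the whole product *)
pose G (x : \bar R * \bar R) := (`|x.1| * `|x.2|)%E.
have mG : measurable_fun setT G.
  by apply: emeasurable_funM; apply: measurableT_comp.
have G0 x : (0 <= G x)%E by exact: mule_ge0.
have [_] := joint_law_fubini mf mz fz mG G0.
under eq_integral do rewrite /G/= !gee0_abs//.
move=> ->.
under eq_integral => v _.
  under eq_integral do rewrite /G/= !gee0_abs//.
  rewrite ge0_integralZr//; over.
by rewrite ge0_integralZl//; exact: integral_ge0.
Qed.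

End Laws.

Section IID.
Context (R : realType) d (T : measurableType d) (P : probability T R).
Variable eps : int -> {RV P >-> R}.
Hypothesis eps_iid : iid eps.

Definition seqpath (w : T) : seqspace R := fun k => eps k w.

Lemma measurable_seqpath : measurable_fun setT seqpath.
Proof. by apply: measurable_seqspaceP => k. Qed.

Definition relabel (phi : int -> int) (om : seqspace R) : seqspace R :=
  fun k => om (phi k).

Lemma measurable_relabel phi : measurable_fun setT (relabel phi).
Proof. by apply: measurable_seqspaceP => k; exact: measurable_coord. Qed.

Lemma preimage_cylinder s (B : int -> set R) :
  seqpath @^-1` cylinder s B = \bigcap_(k in [set` undup s]) (eps k @^-1` B k).
Proof.
apply/seteqP; split=> w /= H k.
  by move=> /=; rewrite mem_undup => ks; exact: H.
by move=> ks; apply: H; rewrite /= mem_undup.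
Qed.

Lemma cylinder_prob s (B : int -> set R) : uniq s -> (forall k, measurable (B k)) ->
  P (seqpath @^-1` cylinder s B) = (\prod_(k <- s) P (eps k @^-1` B k))%E.
Proof.
move=> us mB; rewrite preimage_cylinder undup_id//.
by case: eps_iid => + _; apply.
Qed.

Lemma cylinder_undup s (B : int -> set R) : cylinder (undup s) B = cylinder s B.
Proof. by apply/seteqP; split=> om H k ks; apply: H; move: ks; rewrite mem_undup. Qed.

(** [psi] carries the constraints of a cylinder to its new times. The cases of
    interest are the shift, and the time reversal that turns the products of the
    Lyapunov exponent into products along the past. *)
Lemma relabel_law phi psi : cancel phi psi -> forall A, measurable A ->
  P ((relabel phi \o seqpath) @^-1` A) = P (seqpath @^-1` A).
Proof.
move=> phiK; apply: law_eq; last first.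
- move=> _ [s [B [mB ->]]]; rewrite -(cylinder_undup s).
  have uphi : uniq (map phi (undup s)).
    by rewrite map_inj_uniq ?undup_uniq//; exact: can_inj phiK.
  rewrite cylinder_prob ?undup_uniq//.
  transitivity (P (seqpath @^-1` cylinder (map phi (undup s)) (B \o psi))).
    congr (P _); apply/seteqP; split=> w /= H k.
      by move=> /mapP[j js ->] /=; rewrite phiK; exact: H.
    move=> ks; have := H (phi k); rewrite /= phiK; apply.
    exact: map_f.
  rewrite cylinder_prob//; last by move=> k; exact: mB.
  rewrite big_map; apply: eq_bigr => k _ /=; rewrite phiK.
  by case: eps_iid => _ /(_ (phi k) k); apply.
- exact: measurable_seqpath.
- by apply: measurableT_comp; [exact: measurable_relabel|exact: measurable_seqpath].
Qed.

(** Masking by [0] represents the sigma-algebra of the coordinates in [I] by a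
    map, so that the independence of blocks of coordinates becomes that of two
    random sequences. *)
Definition keep (I : pred int) (om : seqspace R) : seqspace R :=
  fun k => if I k then om k else 0.

Lemma measurable_keep I : measurable_fun setT (keep I).
Proof.
apply: measurable_seqspaceP => k; rewrite /keep; case: (I k) => //.
exact: measurable_coord.
Qed.

Lemma keep_indep (I J : pred int) : (forall k, I k -> J k -> False) ->
  forall A B, measurable A -> measurable B ->
    (P ((keep I \o seqpath) @^-1` A `&` (keep J \o seqpath) @^-1` B) =
     P ((keep I \o seqpath) @^-1` A) * P ((keep J \o seqpath) @^-1` B))%E.
Proof.
move=> IJ; apply: law_indep.
- by apply: measurableT_comp; [exact: measurable_keep|exact: measurable_seqpath].
- by apply: measurableT_comp; [exact: measurable_keep|exact: measurable_seqpath].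
move=> _ _ [s [B [mB ->]]] [s' [B' [mB' ->]]].
set L := undup (s ++ s').
(* the constraint that the masked coordinate k satisfies the cylinder; it is
   trivial (full or empty) unless k belongs to the window *)
pose D (K : pred int) (s : seq int) (B : int -> set R) k : set R :=
  if k \in s then [set r | B k (if K k then r else 0)] else setT.
have mD K (r : seq int) (C : int -> set R) k : (forall k, measurable (C k)) ->
    measurable (D K r C k).
  move=> mC; rewrite /D; case: ifP => // _; case: (K k); first exact: mC.
  have [C0|nC0] := pselect (C k 0).
    by rewrite (_ : mkset _ = setT)//; apply/seteqP; split.
  by rewrite (_ : mkset _ = set0)//; apply/seteqP; split.
have trivD (K : pred int) (r : seq int) (C : int -> set R) k : ~~ K k ->
    D K r C k = setT \/ D K r C k = set0.
  move=> /negbTE nK; rewrite /D nK; case: ifP => _; last by left.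
  have [C0|nC0] := pselect (C k 0); [left|right]; by apply/seteqP; split.
have cylE K (r : seq int) (C : int -> set R) : {subset r <= L} ->
    (keep K \o seqpath) @^-1` cylinder r C = seqpath @^-1` cylinder L (D K r C).
  move=> rL; apply/seteqP; split=> w /= H k.
    by move=> _; rewrite /D; case: ifP => // kr; exact: H.
  by move=> kr; have := H k (rL _ kr); rewrite /D kr.
have uL : uniq L by exact: undup_uniq.
rewrite !cylE; [|by move=> k ks; rewrite mem_undup mem_cat ks ?orbT..].
rewrite -preimage_setI.
rewrite (_ : cylinder L _ `&` _ = cylinder L (fun k => D I s B k `&` D J s' B' k)); last first.
  apply/seteqP; split=> om /=.
    by move=> [H1 H2] k kL; split; [exact: H1|exact: H2].
  by move=> H; split=> k kL; have [] := H k kL.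
rewrite !cylinder_prob//; [|by move=> k; try apply: measurableI; exact: mD..].
rewrite -big_split /=; apply: eq_bigr => k _.
have PT : P (eps k @^-1` setT) = 1%E by rewrite preimage_setT probability_setT.
have P0 : P (eps k @^-1` set0) = 0%E by rewrite preimage_set0 measure0.
have [Ik|nIk] := boolP (I k).
  have nJk : ~~ J k by apply/negP; exact: IJ.
  by have [->|->] := trivD J s' B' k nJk; rewrite ?setIT ?setI0 ?PT ?P0 ?mule1 ?mule0.
by have [->|->] := trivD I s B k nIk; rewrite ?setTI ?set0I ?PT ?P0 ?mul1e ?mul0e.
Qed.

Definition depends_on (I : pred int) (U : Type) (f : seqspace R -> U) :=
  forall om om', (forall k, I k -> om k = om' k) -> f om = f om'.

Lemma depends_on_keep I (U : Type) (f : seqspace R -> U) om :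
  depends_on I f -> f (keep I om) = f om.
Proof. by apply => k; rewrite /keep => ->. Qed.

(** A function is unchanged when the coordinates that it does not depend on are
    masked, and sequences masked to disjoint sets of times are independent. *)
Lemma depends_on_indep (I J : pred int) d1 d2 (U1 : measurableType d1) (U2 : measurableType d2)
    (f : seqspace R -> U1) (z : seqspace R -> U2) :
  (forall k, I k -> J k -> False) -> depends_on I f -> depends_on J z ->
  measurable_fun setT f -> measurable_fun setT z ->
  forall A B, measurable A -> measurable B ->
    (P ((f \o seqpath) @^-1` A `&` (z \o seqpath) @^-1` B) =
     P ((f \o seqpath) @^-1` A) * P ((z \o seqpath) @^-1` B))%E.
Proof.
move=> IJ fI zJ mf mz A B mA mB.
have fE : f \o seqpath = f \o (keep I \o seqpath).
  by apply/funext => w /=; rewrite depends_on_keep.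
have zE : z \o seqpath = z \o (keep J \o seqpath).
  by apply/funext => w /=; rewrite depends_on_keep.
rewrite fE zE; apply: (keep_indep IJ (A := f @^-1` A) (B := z @^-1` B)).
  by rewrite -[X in measurable X]setTI; exact: mf.
by rewrite -[X in measurable X]setTI; exact: mz.
Qed.

Lemma depends_on_integralM (I J : pred int) (F Z : seqspace R -> \bar R) :
  (forall k, I k -> J k -> False) -> depends_on I F -> depends_on J Z ->
  measurable_fun setT F -> measurable_fun setT Z ->
  (forall om, 0 <= F om)%E -> (forall om, 0 <= Z om)%E ->
  (\int[P]_w (F (seqpath w) * Z (seqpath w)) =
   \int[P]_w F (seqpath w) * \int[P]_w Z (seqpath w))%E.
Proof.
move=> IJ FI ZJ mF mZ F0 Z0.
have mp := measurable_seqpath.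
apply: (indep_integralM (f := F \o seqpath) (z := Z \o seqpath)).
- exact: measurableT_comp mF mp.
- exact: measurableT_comp mZ mp.
- by move=> w; exact: F0.
- by move=> w; exact: Z0.
- exact: (depends_on_indep IJ FI ZJ mF mZ).
Qed.

Lemma expect_relabel phi psi (F : seqspace R -> \bar R) : cancel phi psi ->
  measurable_fun setT F -> (forall om, 0 <= F om)%E ->
  (\int[P]_w F (relabel phi (seqpath w)) = \int[P]_w F (seqpath w))%E.
Proof.
move=> phiK mF F0.
have mp := measurable_seqpath.
have mrp : measurable_fun setT (relabel phi \o seqpath).
  by apply: measurableT_comp mp; exact: measurable_relabel.
transitivity (\int[pushforward P (relabel phi \o seqpath)]_om F om)%E.
  by rewrite (@ge0_integral_pushforward _ _ _ _ _ _ mrp).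
rewrite -[RHS](@ge0_integral_pushforward _ _ _ _ _ _ mp P setT)//.
apply: eq_measure_integral => A mA _.
exact: (relabel_law phiK).
Qed.

Lemma expect_relabel_signed phi psi (F : seqspace R -> \bar R) :
  cancel phi psi -> measurable_fun setT F ->
  (\int[P]_w F (relabel phi (seqpath w)) = \int[P]_w F (seqpath w))%E.
Proof.
move=> phiK mF; rewrite [LHS]integralE [RHS]integralE; congr (_ - _)%E.
- have := expect_relabel phiK (measurable_funepos mF) (@funepos_ge0 _ _ F).
  by rewrite funepos.unlock.
- have := expect_relabel phiK (measurable_funeneg mF) (@funeneg_ge0 _ _ F).
  by rewrite funeneg.unlock.
Qed.

HB.instance Definition _ :=
  isMeasurableFun.Build _ _ _ _ seqpath measurable_seqpath.

Definition path_law : probability (seqspace R) R := distribution P seqpath.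

Definition tshift (l : int) : seqspace R -> seqspace R := relabel (fun k => k + l).

Lemma measurable_tshift l : measurable_fun setT (tshift l).
Proof. exact: measurable_relabel. Qed.

Lemma expect_tshift l (F : seqspace R -> \bar R) :
  measurable_fun setT F -> (forall om, 0 <= F om)%E ->
  (\int[P]_w F (tshift l (seqpath w)) = \int[P]_w F (seqpath w))%E.
Proof.
by apply: (@expect_relabel _ (fun k => k - l)) => k; rewrite addrK.
Qed.

Lemma tshift0 om : tshift 0 om = om.
Proof. by apply/funext => k; rewrite /tshift /relabel addr0. Qed.

Lemma tshiftD l m om : tshift l (tshift m om) = tshift (l + m) om.
Proof. by apply/funext => k; rewrite /tshift /relabel addrA. Qed.

Lemma iter_tshift n om : iter n (tshift 1) om = tshift n%:Z om.
Proof.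
elim: n om => [|n ih] om; first by rewrite tshift0.
by rewrite iterS ih tshiftD -intS.
Qed.

Lemma path_law_tshift l A : measurable A -> path_law (tshift l @^-1` A) = path_law A.
Proof.
have lK : cancel (fun k => k + l) (fun k => k - l) by move=> k; rewrite addrK.
exact: relabel_law lK A.
Qed.

Definition window (n : nat) : pred int := fun k => (absz k <= n)%N.

(** Events that windows of finite length determine up to small probability. *)
Definition approximable (A : set (seqspace R)) := forall e : R, 0 < e ->
  exists n (C : set (seqspace R)), [/\ measurable C, depends_on (window n) C,
    (path_law (A `\` C) <= e%:E)%E & (path_law (C `\` A) <= e%:E)%E].

Lemma approximable_cylinder s B : (forall k, measurable (B k)) ->
  approximable (cylinder s B).
Proof.
move=> mB e e0; exists (\max_(k <- s) absz k)%N, (cylinder s B).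
split; first exact: measurable_cylinder.
- move=> om om' H.
  have {}H k : k \in s -> om k = om' k.
    by move=> ks; apply: H; exact: (leq_bigmax_seq k).
  by apply/propext; split=> Bs k ks; have := Bs k ks; rewrite H.
- by rewrite setDv measure0 lee_fin ltW.
- by rewrite setDv measure0 lee_fin ltW.
Qed.

Lemma approximableC A : measurable A -> approximable A -> approximable (~` A).
Proof.
move=> mA aA e e0; have [n [C [mC wC AC CA]]] := aA e e0.
exists n, (~` C); split; first exact: measurableC.
- by move=> om om' /wC H; rewrite /setC /mkset H.
- by rewrite setDE setCK setIC -setDE.
- by rewrite setDE setCK setIC -setDE.
Qed.

Lemma approximableU A B : measurable A -> measurable B ->
  approximable A -> approximable B -> approximable (A `|` B).
Proof.
move=> mA mB aA aB e e0.
have e20 : 0 < e / 2 by rewrite divr_gt0.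
have [n [C [mC wC AC CA]]] := aA _ e20.
have [m [D [mD wD BD DB]]] := aB _ e20.
exists (maxn n m), (C `|` D); split; first exact: measurableU.
- move=> om om' H.
  have HC : C om = C om' by apply: wC => k kn; apply: H; rewrite /window leq_max [X in X || _]kn.
  have HD : D om = D om' by apply: wD => k kn; apply: H; rewrite /window leq_max [X in _ || X]kn orbT.
  by rewrite /setU /mkset HC HD.
- apply: (@le_trans _ _ (path_law ((A `\` C) `|` (B `\` D)))).
    apply: le_measure; rewrite ?inE.
    + by apply: measurableD; exact: measurableU.
    + by apply: measurableU; exact: measurableD.
    + by move=> x [[Ax|Bx] /not_orP[nC nD]]; [left|right].
  apply: le_trans (measureU2 _ _ _) _; rewrite ?inE//; try exact: measurableD.
  by rewrite [e]splitr EFinD leeD.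
- apply: (@le_trans _ _ (path_law ((C `\` A) `|` (D `\` B)))).
    apply: le_measure; rewrite ?inE.
    + by apply: measurableD; exact: measurableU.
    + by apply: measurableU; exact: measurableD.
    + by move=> x [[Ax|Bx] /not_orP[nC nD]]; [left|right].
  apply: le_trans (measureU2 _ _ _) _; rewrite ?inE//; try exact: measurableD.
  by rewrite [e]splitr EFinD leeD.
Qed.

(** The finite unions exhaust the union, so that one of them is close to it in
    measure. *)
Lemma approximable_bigcup (F : (set (seqspace R))^nat) :
  (forall n, measurable (F n)) -> (forall n, approximable (F n)) ->
  approximable (\bigcup_n F n).
Proof.
move=> mF aF e e0.
pose G n := \big[setU/set0]_(i < n) F i.
have mG n : measurable (G n) by exact: bigsetU_measurable.
have aG n : approximable (G n).
  elim: n => [|n ih].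
    rewrite /G big_ord0 (_ : set0 = cylinder [:: 0] (fun=> set0)); last first.
      by apply/seteqP; split=> // om /(_ 0); rewrite inE eqxx => /(_ isT).
    by apply: approximable_cylinder.
  by rewrite /G big_ord_recr /=; apply: approximableU => //; exact: mG.
set A := \bigcup_n F n.
have mA : measurable A by exact: bigcupT_measurable.
have AE : A = \bigcup_n G n.
  apply/seteqP; split=> x [n _ Fx].
    by exists n.+1 => //; rewrite /G -bigcup_mkord; exists n => /=.
  by move: Fx; rewrite /G -bigcup_mkord => -[i _ Fx]; exists i.
have cvgG : path_law (A `\` G n) @[n --> \oo] --> 0%E.
  have -> : 0%E = path_law (\bigcap_n (A `\` G n)).
    rewrite (_ : \bigcap_n _ = set0) ?measure0//; apply/seteqP; split=> // x H.
    have [Ax _] := H 0%N I; move: (Ax); rewrite AE => -[n _ Gx].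
    by have [_] := H n I.
  apply: nonincreasing_cvg_mu.
  - by rewrite -ge0_fin_numE// fin_num_measure//; exact: measurableD.
  - by move=> n; exact: measurableD.
  - by apply: bigcapT_measurable => n; exact: measurableD.
  - move=> m n mn; apply/subsetPset; apply: setDS.
    exact: subset_bigsetU.
have e20 : 0 < e / 2 by rewrite divr_gt0.
have [n An] : exists n, (path_law (A `\` G n) <= (e / 2)%:E)%E.
  have /fine_cvgP[_ /cvgrPdist_le /(_ _ e20) [n _ /(_ n (leqnn _))]] := cvgG.
  rewrite sub0r normrN => H; exists n.
  rewrite -[leLHS]fineK ?fin_num_measure//; last exact: measurableD.
  by rewrite lee_fin; apply: le_trans (ler_norm _) H.
have [m [C [mC wC GC CG]]] := aG n _ e20.
exists m, C; split => //.
- apply: (@le_trans _ _ (path_law ((A `\` G n) `|` (G n `\` C)))).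
    apply: le_measure; rewrite ?inE.
    + exact: measurableD.
    + by apply: measurableU; exact: measurableD.
    + by move=> x [Ax nC]; have [Gx|nG] := pselect (G n x); [right|left].
  apply: le_trans (measureU2 _ _ _) _; rewrite ?inE//; try exact: measurableD.
  by rewrite [e]splitr EFinD leeD.
- apply: (@le_trans _ _ (path_law (C `\` G n))).
    apply: le_measure; rewrite ?inE; try exact: measurableD.
    by rewrite AE; apply: setDS => x Gx; exists n.
  by apply: le_trans CG _; rewrite lee_fin ler_pdivrMr// ler_pMr// ler1n.
Qed.

Lemma measurable_approximable A : measurable A -> approximable A.
Proof.
move=> mA; apply: (@dynkin_induction _ (seqspace R) (@cylinders R)) => //.
- exact: cylinders_setI.
- have [s [B [mB ->]]] := @cylinder_setT R; exact: approximable_cylinder.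
- by move=> _ [s [B [mB ->]]]; exact: approximable_cylinder.
- by move=> S mS aS; exact: approximableC.
- by move=> F mF _ aF; exact: approximable_bigcup.
Qed.

(** An invariant event [A] is close to a window event [C], and the shift by
    more than the length of the window makes [C] independent of its copy:
    [path_law A] and [(path_law A)^2] are arbitrarily close. *)
Lemma tshift_ergodic A : measurable A -> tshift 1 @^-1` A = A ->
  path_law A = 0%E \/ path_law A = 1%E.
Proof.
move=> mA invA.
have invAn n : tshift n%:Z @^-1` A = A.
  elim: n => [|n ih]; first by apply/seteqP; split=> om; rewrite /= tshift0.
  apply/seteqP; split=> om.
    rewrite /preimage /= intS -tshiftD => H.
    by rewrite -ih /=; have : (tshift 1 @^-1` A) (tshift n om) := H; rewrite invA.
  rewrite -{1}ih /= => H; rewrite /preimage /= intS -tshiftD.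
  by have : (tshift 1 @^-1` A) (tshift n om) by rewrite invA.
set a := fine (path_law A).
have lawE B : measurable B -> path_law B = (fine (path_law B))%:E.
  by move=> mB; rewrite fineK// fin_num_measure.
have a01 : 0 <= a <= 1.
  by rewrite -!lee_fin -lawE// probability_le1// measure_ge0.
suff aa : a = a ^+ 2.
  have /eqP : a * (1 - a) = 0 by rewrite mulrBr mulr1 -expr2 -aa subrr.
  rewrite mulf_eq0 subr_eq0 => /orP[/eqP a0|/eqP a1]; [left|right]; rewrite lawE//.
    by rewrite -/a a0.
  by rewrite -/a -a1.
have aa' : a ^+ 2 <= a by rewrite expr2 ler_piMr//; lra.
apply/eqP; rewrite eq_le aa' andbT; apply/ler_addgt0Pr => e e0.
(* five errors: [a <= (a + e')^2 + 2 e' <= a^2 + 5 e'] *)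
pose e' := Num.min 1 (e / 5).
have e'0 : 0 < e' by rewrite lt_min ltr01 divr_gt0.
have e'1 : e' <= 1 by rewrite ge_min lexx.
have e'e : 5 * e' <= e.
  have : e' <= e / 5 by rewrite ge_min lexx orbT.
  lra.
have [n [C [mC wC AC CA]]] := measurable_approximable mA e'0.
set c := fine (path_law C).
have c0 : 0 <= c by exact: fine_ge0.
(* the first shift that separates the window from its translate *)
pose N := n.*2.+1.
have mshift B : measurable B -> measurable (tshift N%:Z @^-1` B).
  by move=> mB; rewrite -[X in measurable X]setTI; exact: measurable_tshift.
have indepC : (path_law (C `&` tshift N%:Z @^-1` C) = path_law C * path_law (tshift N%:Z @^-1` C))%E.
  pose J : pred int := fun k => window n (k - N%:Z).
  have CE : seqpath @^-1` C = (keep (window n) \o seqpath) @^-1` C.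
    by apply/seteqP; split=> w /=; rewrite depends_on_keep.
  have SE : seqpath @^-1` (tshift N%:Z @^-1` C) =
            (keep J \o seqpath) @^-1` (tshift N%:Z @^-1` C).
    apply/funext => w; apply: wC => k kn.
    by rewrite /tshift /relabel /keep /J /= addrK kn.
  have lawP B : path_law B = P (seqpath @^-1` B) by [].
  rewrite !lawP preimage_setI CE SE.
  apply: keep_indep => //; last exact: mshift.
  by rewrite /J /window /N; clear; move=> k; lia.
have cE : fine (path_law (C `&` tshift N%:Z @^-1` C)) = c ^+ 2.
  by rewrite indepC path_law_tshift// (lawE _ mC) -/c -EFinM expr2.
have ac : a <= c ^+ 2 + 2 * e'.
  have mCC : measurable (C `&` tshift N%:Z @^-1` C) by apply: measurableI => //; exact: mshift.
  rewrite -lee_fin -cE EFinD -(lawE _ mCC) -(lawE _ mA).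
  apply: (@le_trans _ _ (path_law ((C `&` tshift N%:Z @^-1` C) `|`
      ((A `\` C) `|` (tshift N%:Z @^-1` (A `\` C)))))).
    apply: le_measure; rewrite ?inE//.
      apply: measurableU; first exact: mCC.
      by apply: measurableU; [|apply: mshift]; exact: measurableD.
    move=> x Ax; have [Cx|nC] := pselect (C x); last by right; left.
    have [Cy|nC] := pselect (C (tshift N%:Z x)); first by left.
    right; right; split => //; first by rewrite -[A _]/((tshift N%:Z @^-1` A) x) invAn.
  have mAC : measurable (A `\` C) by exact: measurableD.
  apply: le_trans (measureU2 _ _ _) _; rewrite ?inE//.
    by apply: measurableU => //; exact: mshift.
  apply: leeD => //; apply: le_trans (measureU2 _ _ _) _; rewrite ?inE//.
    exact: mshift.
  have -> : (2 * e')%:E = (e'%:E + e'%:E)%E by rewrite -EFinD; congr EFin; lra.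
  apply: leeD => //; apply: le_trans AC.
  by have /eqP := path_law_tshift N%:Z mAC; rewrite eq_le => /andP[].
have ca : c <= a + e'.
  rewrite -lee_fin EFinD -!lawE//.
  apply: (@le_trans _ _ (path_law (A `|` (C `\` A)))).
    apply: le_measure; rewrite ?inE//; last first.
      by move=> x Cx; have [|] := pselect (A x); [left|right].
    by apply: measurableU => //; exact: measurableD.
  apply: le_trans (measureU2 _ _ _) _; rewrite ?inE//; first exact: measurableD.
  exact: leeD.
have c2 : c ^+ 2 <= (a + e') ^+ 2 by rewrite lerXn2r// nnegrE; lra.
apply: le_trans ac _; apply: le_trans (lerD c2 (lexx _)) _.
have : e' ^+ 2 <= e' by rewrite expr2 ler_piMr// ltW.
have : a * e' <= e' by rewrite ler_piMl ?(ltW e'0)//; lra.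
by rewrite sqrrD; lra.
Qed.

(** Ergodicity holds for the law of the path, and the exceptional set is pulled
    back to the probability space. *)
Theorem iid_birkhoff (F : seqspace R -> R) : measurable_fun setT F ->
  P.-integrable setT (EFin \o (F \o seqpath)) ->
  (\int[P]_w (F (seqpath w))%:E < 0)%E ->
  {ae P, forall w, exists B : R, forall n,
    \sum_(k < n) F (tshift k%:Z (seqpath w)) <= B}.
Proof.
move=> mF iF F0.
have mEF : measurable_fun setT (EFin \o F) by exact/measurable_EFinP.
have mp := measurable_seqpath.
have iF' : path_law.-integrable setT (EFin \o F).
  by apply: (@integrable_pushforward _ _ _ _ _ _ mp P).
have F0' : (\int[path_law]_om (F om)%:E < 0)%E.
  by rewrite (@integral_pushforward _ _ _ _ _ _ mp P setT (EFin \o F)).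
have [N [mN N0 sub]] := birkhoff_bounded (measurable_tshift 1) (path_law_tshift 1)
  tshift_ergodic iF' F0'.
exists (seqpath @^-1` N); split.
- by rewrite -[X in measurable X]setTI; exact: mp.
- exact: N0.
- move=> w /= nB; apply: sub => /= -[B HB]; apply: nB; exists B => n.
  by under eq_bigr do rewrite -iter_tshift.
Qed.

End IID.

(** * The coefficients of the conditional variance *)

Section Coefficients.
Variables (R : realType) (p q : nat).
Hypothesis q_gt0 : (0 < q)%N.
Hypothesis p_gt0 : (0 < p)%N.
Implicit Types u v : 'rV[R]_(1 + p + q).

Lemma par_x_coord : exists o, forall u, par_x u = u ord0 o.
Proof. by exists (lshift q (lshift p ord0)) => u; rewrite /par_x !mxE. Qed.

Lemma par_s_coord i : (0 < i <= p)%N -> exists o, forall u, par_s u i = u ord0 o.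
Proof.
case: i => // i /= ip; exists (lshift q (rshift 1 (Ordinal ip))) => u.
by rewrite /par_s /entry insubT /= !mxE.
Qed.

Lemma par_t_coord j : (0 < j <= q)%N -> exists o, forall u, par_t u j = u ord0 o.
Proof.
case: j => // j /= jq; exists (rshift (1 + p) (Ordinal jq)) => u.
by rewrite /par_t /entry insubT /= !mxE.
Qed.

Lemma par_s_out i u : ~~ (0 < i <= p)%N -> par_s u i = 0.
Proof. by case: i => // i /= ip; rewrite /par_s /entry insubN. Qed.

Lemma par_t_out i u : ~~ (0 < i <= q)%N -> par_t u i = 0.
Proof. by case: i => // i /= ip; rewrite /par_t /entry insubN. Qed.

Lemma par_inj u v : par_x u = par_x v ->
  (forall i, (0 < i <= p)%N -> par_s u i = par_s v i) ->
  (forall j, (0 < j <= q)%N -> par_t u j = par_t v j) -> u = v.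
Proof.
move=> ex es et; apply/rowP => o.
case: (split_ordP o) => [k1 ->|k2 ->].
  case: (split_ordP k1) => [k3 ->|k4 ->].
    by move: ex; rewrite /par_x !mxE (ord1 k3).
  have := es k4.+1 (ltn_ord k4).
  by rewrite /par_s /entry insubT ?ltn_ord// => ?; rewrite /= !mxE; congr (u _ _ = v _ _); do 2 f_equal; apply: val_inj.
have := et k2.+1 (ltn_ord k2).
by rewrite /par_t /entry insubT ?ltn_ord// => ?; rewrite /= !mxE; congr (u _ _ = v _ _); do 2 f_equal; apply: val_inj.
Qed.

Variables ulo uhi rho0 : R.
Hypothesis ulo_gt0 : 0 < ulo.
Hypothesis ulohi : ulo < uhi.
Let U : set 'rV[R]_(1 + p + q) := param_set ulo uhi rho0.

Lemma par_xU u : U u -> ulo <= par_x u <= uhi.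
Proof. by have [k kE] := par_x_coord; rewrite kE => -[_]. Qed.

Lemma par_sU u i : U u -> (0 < i <= p)%N -> ulo <= par_s u i <= uhi.
Proof. by move=> [_ Uu] /par_s_coord[k ->]. Qed.

Lemma par_tU u j : U u -> (0 < j <= q)%N -> ulo <= par_t u j <= uhi.
Proof. by move=> [_ Uu] /par_t_coord[k ->]. Qed.

Lemma par_sU_ge0 u i : U u -> 0 <= par_s u i.
Proof.
move=> Uu; have [ip|ip] := boolP (0 < i <= p)%N; last by rewrite par_s_out.
by have /andP[+ _] := par_sU Uu ip; apply: le_trans; exact: ltW.
Qed.

Lemma par_tU_ge0 u i : U u -> 0 <= par_t u i.
Proof.
move=> Uu; have [ip|ip] := boolP (0 < i <= q)%N; last by rewrite par_t_out.
by have /andP[+ _] := par_tU Uu ip; apply: le_trans; exact: ltW.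
Qed.

(** The rate [rho] is chosen so that [\sum_j t_j rho^-j <= rho0 / kap < 1]
    uniformly on the parameter set. *)
Variables rho kap : R.
Hypothesis rho_gt0 : 0 < rho.
Hypothesis rho_lt1 : rho < 1.
Hypothesis rho0_ge0 : 0 <= rho0.
Hypothesis rho0_lt1 : rho0 < 1.
Hypothesis kap_gt : rho0 < kap.
Hypothesis kap_rho : kap <= rho ^+ q.

Let kap_gt0 : 0 < kap. Proof. exact: le_lt_trans kap_gt. Qed.

Let rho_ge0 : 0 <= rho. Proof. exact: ltW. Qed.
Let kap_ge0 : 0 <= kap. Proof. exact: ltW. Qed.
Let ulo_ge0 : 0 <= ulo. Proof. exact: ltW. Qed.
Let uhi_gt0 : 0 < uhi. Proof. exact: lt_trans ulohi. Qed.
Let uhi_ge0 : 0 <= uhi. Proof. exact: ltW. Qed.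
Let r0_gt0 : 0 < 1 - rho0. Proof. by rewrite subr_gt0. Qed.
Let r0_ge0 : 0 <= 1 - rho0. Proof. exact: ltW. Qed.

Lemma rho_shift i j : (j <= i)%N -> (j <= q)%N -> rho ^+ (i - j) <= rho ^+ i / kap.
Proof.
move=> ji jq; rewrite ler_pdivlMr// -{2}(subnK ji) exprD.
rewrite ler_pM2l ?exprn_gt0//; apply: le_trans kap_rho _.
by rewrite ler_wiXn2l// ?ltW.
Qed.

Definition geom_gain : R := (1 - rho0 / kap)^-1.

Let gap_gt0 : 0 < 1 - rho0 / kap.
Proof. by rewrite subr_gt0 ltr_pdivrMr// mul1r. Qed.

Let gap_ge0 : 0 <= 1 - rho0 / kap. Proof. exact: ltW. Qed.

Lemma geom_gain_gt0 : 0 < geom_gain. Proof. by rewrite invr_gt0. Qed.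
Let geom_gain_ge0 : 0 <= geom_gain. Proof. exact/ltW/geom_gain_gt0. Qed.

(** The homogeneous recursion contracts the geometric sequence [rho ^+ i] by the
    factor [rho0 / kap], so that a source of size [a * rho ^+ i] produces a
    solution of size [a * rho ^+ i / (1 - rho0 / kap)]. *)
Lemma geom_recursion (t e : nat -> R) (a : R) :
  (forall j, (0 < j <= q)%N -> 0 <= t j) -> \sum_(1 <= j < q.+1) t j <= rho0 ->
  0 <= a ->
  (forall i, (0 < i)%N ->
    e i <= a * rho ^+ i + \sum_(1 <= j < (minn q i.-1).+1) t j * e (i - j)%N) ->
  forall i, (0 < i)%N -> e i <= a * geom_gain * rho ^+ i.
Proof.
move=> t0 st a0 erec; elim/ltn_ind => i ih i0.
apply: le_trans (erec i i0) _.
set D := a * geom_gain.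
have D0 : 0 <= D by rewrite mulr_ge0.
have -> : D * rho ^+ i = a * rho ^+ i + rho0 * (D * (rho ^+ i / kap)).
  rewrite (_ : rho0 * _ = D * (rho0 / kap) * rho ^+ i); last by ring.
  rewrite -mulrDl; congr (_ * _).
  have : D * (1 - rho0 / kap) = a by rewrite /D -mulrA mulVf ?mulr1 ?gt_eqF.
  by rewrite mulrBr mulr1 => <-; rewrite subrK.
rewrite lerD2l.
apply: (@le_trans _ _ (\sum_(1 <= j < (minn q i.-1).+1) t j * (D * (rho ^+ i / kap)))).
  rewrite big_seq [leRHS]big_seq; apply: ler_sum => j.
  rewrite mem_index_iota ltnS leq_min => /and3P[j1 jq ji].
  have ji' : (j <= i)%N by apply: leq_trans ji (leq_pred _).
  rewrite ler_wpM2l ?t0 ?j1//; apply: le_trans (ih _ _ _) _.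
  - by rewrite ltn_subrL j1.
  - by rewrite subn_gt0 -(ltn_predK i0) ltnS.
  - by rewrite ler_wpM2l// rho_shift.
rewrite -mulr_suml ler_wpM2r ?mulr_ge0 ?exprn_ge0 ?invr_ge0//.
apply: le_trans st; rewrite [leRHS](@big_cat_nat _ _ _ (minn q i.-1).+1)//=.
  rewrite lerDl big_seq; apply: sumr_ge0 => j.
  rewrite mem_index_iota => /andP[j1 jq]; apply: t0.
  by rewrite (leq_trans _ j1)//= -ltnS.
by rewrite ltnS geq_minl.
Qed.

(** Only [s_1] and the term [t_1 c_(i-1)] of the recursion are kept. *)
Lemma ccoef_ge u i : U u -> (0 < i)%N -> ulo ^+ i <= ccoef u i.
Proof.
move=> Uu; elim/ltn_ind: i => i ih i0; rewrite ccoefE//.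
have term0 j : (1 <= j < (minn q i.-1).+1)%N -> 0 <= par_t u j * ccoef u (i - j).
  rewrite ltnS leq_min => /and3P[j1 jq ji].
  apply: mulr_ge0; first exact: par_tU_ge0.
  apply: le_trans (ih _ _ _); first by rewrite exprn_ge0// ltW.
    by rewrite ltn_subrL j1.
  by rewrite subn_gt0 -(ltn_predK i0) ltnS.
have s0 : 0 <= par_s u i *+ (i <= p)%N by apply: mulrn_wge0; exact: par_sU_ge0.
have [i1|i1] := leqP i 1.
  have {i0 i1} -> : i = 1%N by apply/eqP; rewrite eqn_leq i1.
  rewrite expr1 p_gt0 mulr1n big_geq ?addr0; last by rewrite minn0.
  by have /andP[] := par_sU Uu (i := 1) p_gt0.
have m1 : (1 < (minn q i.-1).+1)%N by rewrite ltnS leq_min q_gt0 -ltnS (ltn_predK i0).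
rewrite big_ltn//; apply: (@le_trans _ _ (par_t u 1 * ccoef u (i - 1))).
  rewrite -[in leLHS](ltn_predK i0) exprS subn1 ler_pM ?exprn_ge0//.
    by have /andP[] := par_tU Uu (j := 1) q_gt0.
  by apply: ih; rewrite ?ltn_predL// -ltnS (ltn_predK i0).
rewrite addrCA lerDl addr_ge0// big_seq; apply: sumr_ge0 => j.
by rewrite mem_index_iota => /andP[j2 jq]; apply: term0; rewrite (ltnW j2).
Qed.

Lemma ccoef_gt0 u i : U u -> (0 < i)%N -> 0 < ccoef u i.
Proof. by move=> Uu i0; apply: lt_le_trans (ccoef_ge Uu i0); rewrite exprn_gt0. Qed.

Let rho_p i : (i <= p)%N -> 1 <= rho ^- p * rho ^+ i.
Proof.
move=> ip; rewrite mulrC ler_pdivlMr ?exprn_gt0// mul1r.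
by rewrite ler_wiXn2l// ltW.
Qed.

Definition ccoef_bound : R := uhi / rho ^+ p * geom_gain.

Lemma ccoef_bound_ge0 : 0 <= ccoef_bound.
Proof.
by rewrite !mulr_ge0 ?invr_ge0 ?exprn_ge0//.
Qed.

Lemma ccoef_le u i : U u -> (0 < i)%N -> ccoef u i <= ccoef_bound * rho ^+ i.
Proof.
move=> Uu; apply: (@geom_recursion (par_t u) (ccoef u)).
- by move=> j _; exact: par_tU_ge0.
- by case: Uu.
- by rewrite mulr_ge0 ?invr_ge0 ?exprn_ge0.
move=> {}i i0; rewrite ccoefE// lerD2r.
have [ip|ip] := leqP i p; last first.
  by rewrite mulr0n !mulr_ge0 ?invr_ge0 ?exprn_ge0.
have /andP[_ si] : ulo <= par_s u i <= uhi by apply: par_sU => //; rewrite i0.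
by rewrite mulr1n -mulrA; apply: le_trans si _; rewrite ler_peMr ?rho_p.
Qed.

Lemma c0_gap u : U u -> 1 - rho0 <= 1 - \sum_(1 <= j < q.+1) par_t u j.
Proof. by case=> ? _; rewrite lerD2l lerN2. Qed.

Lemma sum_par_t_ge0 u : U u -> 0 <= \sum_(1 <= j < q.+1) par_t u j.
Proof. by move=> Uu; apply: sumr_ge0 => j _; exact: par_tU_ge0. Qed.

Lemma c0_ge u : U u -> ulo <= ccoef u 0.
Proof.
move=> Uu; have := c0_gap Uu; have := sum_par_t_ge0 Uu; rewrite /ccoef.
have /andP[xl _] := par_xU Uu.
move: (\sum_(_ <= _ < _) _) => t t0 tr; rewrite ler_pdivlMr; last exact: lt_le_trans tr.
by apply: le_trans xl; rewrite ler_piMr// lerBlDr lerDl.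
Qed.

Lemma c0_le u : U u -> ccoef u 0 <= uhi / (1 - rho0).
Proof.
move=> Uu; have := c0_gap Uu; have := sum_par_t_ge0 Uu; rewrite /ccoef.
have /andP[xl xh] := par_xU Uu.
move: (\sum_(_ <= _ < _) _) => t t0 tr.
have t1 : 0 < 1 - t by exact: lt_le_trans tr.
by rewrite ler_pM ?invr_ge0 ?lef_pV2 ?posrE// ?(ltW t1)// (le_trans _ xl).
Qed.

Lemma ccoef_ge0 u i : U u -> 0 <= ccoef u i.
Proof.
move=> Uu; case: i => [|i]; last exact/ltW/ccoef_gt0.
by apply: le_trans (c0_ge Uu); exact: ltW.
Qed.

Definition par_close (delta : R) u v := forall k, `|u ord0 k - v ord0 k| <= delta.

Definition ccoef_lip : R := ((rho ^- p) + q%:R * (ccoef_bound / kap)) * geom_gain.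

Lemma ccoef_lip_ge0 : 0 <= ccoef_lip.
Proof.
have := ccoef_bound_ge0; rewrite /ccoef_lip; move: ccoef_bound => c c0.
by rewrite mulr_ge0// addr_ge0 ?mulr_ge0 ?invr_ge0 ?exprn_ge0 ?ler0n.
Qed.

(** Differentiating the recursion in the parameter adds a source term of the
    order of the distance between the parameters, so that the differences of
    the coefficients decay at the rate of the coefficients themselves. *)
Lemma ccoef_close u v delta i : U u -> U v -> par_close delta u v -> (0 < i)%N ->
  `|ccoef u i - ccoef v i| <= ccoef_lip * delta * rho ^+ i.
Proof.
move=> Uu Uv uv.
have d0 : 0 <= delta by apply: le_trans (uv ord0).
have cb0 := ccoef_bound_ge0.
rewrite (_ : ccoef_lip * delta =
    delta * (rho ^- p + q%:R * (ccoef_bound / kap)) * geom_gain); last first.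
  by rewrite /ccoef_lip; ring.
apply: (@geom_recursion (par_t u) (fun i => `|ccoef u i - ccoef v i|)).
- by move=> j _; exact: par_tU_ge0.
- by case: Uu.
- by rewrite mulr_ge0// addr_ge0// ?mulr_ge0 ?invr_ge0 ?exprn_ge0 ?ler0n.
move=> {}i i0; rewrite !ccoefE//.
have sE : `|par_s u i *+ (i <= p) - par_s v i *+ (i <= p)| <= delta * (rho ^- p * rho ^+ i).
  have [ip|ip] := leqP i p; last first.
    by rewrite !mulr0n subrr normr0 !mulr_ge0 ?invr_ge0 ?exprn_ge0.
  rewrite !mulr1n; have ii : (0 < i <= p)%N by rewrite i0.
  have [k kE] := par_s_coord ii; rewrite !kE.
  by apply: le_trans (uv k) _; rewrite ler_peMr ?rho_p.
have -> : par_s u i *+ (i <= p) + \sum_(1 <= j < (minn q i.-1).+1) par_t u j * ccoef u (i - j)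
  - (par_s v i *+ (i <= p) + \sum_(1 <= j < (minn q i.-1).+1) par_t v j * ccoef v (i - j))
  = (par_s u i *+ (i <= p) - par_s v i *+ (i <= p))
    + \sum_(1 <= j < (minn q i.-1).+1) par_t u j * (ccoef u (i - j) - ccoef v (i - j))
    + \sum_(1 <= j < (minn q i.-1).+1) (par_t u j - par_t v j) * ccoef v (i - j).
  rewrite -[RHS]addrA -big_split /= [in RHS](eq_bigr (fun j =>
    par_t u j * ccoef u (i - j) - par_t v j * ccoef v (i - j))); last first.
    by move=> j _; ring.
  by rewrite sumrB; ring.
apply: le_trans (ler_normD _ _) _; apply: le_trans (lerD (ler_normD _ _) (lexx _)) _.
rewrite mulrDr mulrDl -addrA addrAC addrA -!addrA.
apply: lerD; first by rewrite -mulrA.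
apply: lerD; last first.
  apply: le_trans (ler_norm_sum _ _ _) _.
  apply: (@le_trans _ _ (\sum_(1 <= j < (minn q i.-1).+1) delta * (ccoef_bound * (rho ^+ i / kap)))).
    rewrite big_seq [leRHS]big_seq; apply: ler_sum => j.
    rewrite mem_index_iota ltnS leq_min => /and3P[j1 jq ji].
    have jj : (0 < j <= q)%N by rewrite j1.
    have [k kE] := par_t_coord jj; rewrite normrM !kE ler_pM//.
    have ij : (0 < i - j)%N by rewrite subn_gt0 -(ltn_predK i0) ltnS.
    rewrite ger0_norm ?ccoef_ge0//; apply: le_trans (ccoef_le Uv ij) _.
    by rewrite ler_wpM2l// rho_shift// (leq_trans ji)// leq_pred.
  rewrite sumr_const_nat subSS subn0 -[leLHS]mulr_natl.
  rewrite (_ : delta * _ * _ = q%:R * (delta * (ccoef_bound * (rho ^+ i / kap)))); last by ring.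
  by rewrite ler_wpM2r ?ler_nat ?geq_minl// !mulr_ge0 ?invr_ge0 ?exprn_ge0.
apply: le_trans (ler_norm_sum _ _ _) _; apply: ler_sum => j _.
by rewrite normrM ger0_norm// par_tU_ge0.
Qed.

Definition c0_lip : R := (1 - rho0)^-1 + uhi / (1 - rho0) ^+ 2 * q%:R.

Lemma c0_lip_ge0 : 0 <= c0_lip.
Proof.
by rewrite addr_ge0 ?mulr_ge0 ?invr_ge0 ?exprn_ge0 ?ler0n.
Qed.

Lemma c0_close u v delta : U u -> U v -> par_close delta u v ->
  `|ccoef u 0 - ccoef v 0| <= c0_lip * delta.
Proof.
move=> Uu Uv uv.
have gu := c0_gap Uu; have gv := c0_gap Uv.
have dt : `|\sum_(1 <= j < q.+1) par_t u j - \sum_(1 <= j < q.+1) par_t v j| <= q%:R * delta.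
  rewrite -sumrB; apply: le_trans (ler_norm_sum _ _ _) _.
  apply: (@le_trans _ _ (\sum_(1 <= j < q.+1) delta)); last first.
    by rewrite sumr_const_nat subSS subn0 mulr_natl.
  rewrite big_seq [leRHS]big_seq; apply: ler_sum => j.
  by rewrite mem_index_iota ltnS => /par_t_coord[k kE]; rewrite !kE.
have dx : `|par_x u - par_x v| <= delta by have [k kE] := par_x_coord; rewrite !kE.
have /andP[xl xh] := par_xU Uv.
rewrite /=; move: gu gv dt dx xl xh.
move: (\sum_(_ <= _ < _) par_t u _) (\sum_(_ <= _ < _) par_t v _) => tu tv.
move: (par_x u) (par_x v) => xu xv gu gv dt dx xl xh.
set r := 1 - rho0; have r0 : 0 < r by [].
have gu0 : 0 < 1 - tu by exact: lt_le_trans gu.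
have gv0 : 0 < 1 - tv by exact: lt_le_trans gv.
have -> : xu / (1 - tu) - xv / (1 - tv) =
  (xu - xv) / (1 - tu) + xv * (tu - tv) / ((1 - tu) * (1 - tv)).
  by field; rewrite !gt_eqF.
apply: le_trans (ler_normD _ _) _; rewrite /c0_lip -/r [leRHS]mulrDl.
have iu : (1 - tu)^-1 <= r^-1 by rewrite lef_pV2 ?posrE.
have iv : (1 - tv)^-1 <= r^-1 by rewrite lef_pV2 ?posrE.
apply: lerD.
  rewrite normrM mulrC [`|_^-1|]ger0_norm ?invr_ge0 ?(ltW gu0)//.
  by rewrite ler_pM ?invr_ge0 ?(ltW gu0).
rewrite !normrM normfV normrM (ger0_norm (ltW gu0)) (ger0_norm (ltW gv0)).
rewrite (ger0_norm (le_trans (ltW ulo_gt0) xl)).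
rewrite invfM -mulrA (_ : uhi / r ^+ 2 * q%:R * delta = uhi * ((q%:R * delta) * (r^-1 * r^-1))); last first.
  by field; rewrite gt_eqF.
have xv0 : 0 <= xv by exact: le_trans xl.
by rewrite !ler_pM ?mulr_ge0 ?invr_ge0 ?(ltW gu0) ?(ltW gv0).
Qed.

Lemma size_alpha_poly u : (size (alpha_poly u) <= p.+1)%N.
Proof.
rewrite /alpha_poly; apply: leq_trans (size_sum _ _ _) _.
rewrite big_seq; apply/bigmax_leqP_seq => i.
rewrite mem_index_iota => /andP[_ ip] _; apply: leq_trans (size_scale_leq _ _) _.
by rewrite size_polyXn.
Qed.

Lemma coef_sum_scaleXn (c : nat -> R) n i :
  (\sum_(1 <= j < n.+1) c j *: 'X^j)`_i = if (0 < i <= n)%N then c i else 0.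
Proof.
rewrite coef_sum; under eq_bigr do rewrite coefZ coefXn.
case: ifPn => [/andP[i0 iN]|iN].
  rewrite (big_cat_nat (n := i)) ?(leqW iN)//= [X in X + _]big1_seq; last first.
    move=> j /andP[_]; rewrite mem_index_iota => /andP[_ ji].
    by rewrite gtn_eqF// mulr0.
  rewrite add0r big_ltn ?ltnS// eqxx mulr1 big1_seq ?addr0//.
  move=> j /andP[_]; rewrite mem_index_iota => /andP[ij _].
  by rewrite ltn_eqF// mulr0.
rewrite big1_seq// => j /andP[_]; rewrite mem_index_iota ltnS => jn.
case: eqP => [ij|_]; last by rewrite mulr0.
by move: iN; rewrite ij jn.
Qed.

Lemma coef_alpha_poly u i : (alpha_poly u)`_i = par_s u i.
Proof.
by rewrite coef_sum_scaleXn; case: ifPn => // ip; rewrite par_s_out.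
Qed.

Lemma coef_beta_poly u i : (beta_poly u)`_i = (i == 0%N)%:R - par_t u i.
Proof.
rewrite coefB coef1 coef_sum_scaleXn; congr (_ - _).
by case: ifPn => // iq; rewrite par_t_out.
Qed.

Definition ccoef_poly u n : {poly R} := \poly_(i < n) (ccoef u i *+ (0 < i)%N).

(** [\sum_(i >= 1) c_i X^i] is the power series of the rational fraction
    [alpha_poly / beta_poly]. *)
Lemma ccoef_polyE u n i : (i < n)%N ->
  (alpha_poly u - beta_poly u * ccoef_poly u n)`_i = 0.
Proof.
move=> iN; rewrite coefB coef_alpha_poly /beta_poly mulrBl mul1r coefB.
have cE k : (k <= i)%N -> (ccoef_poly u n)`_k = ccoef u k *+ (0 < k)%N.
  by move=> ki; rewrite coef_poly (leq_ltn_trans ki iN).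
rewrite cE// mulr_suml coef_sum.
have [->|i0] := posnP i.
  rewrite mulr0n par_s_out// big1_seq ?subrr ?subr0// => j /andP[_].
  by rewrite mem_index_iota => /andP[j1 _]; rewrite -scalerAl coefZ coefXnM j1 mulr0.
rewrite mulr1n (ccoefE u i0).
have -> : par_s u i *+ (i <= p) = par_s u i.
  by have [//|ip] := leqP i p; rewrite par_s_out// negb_and (leqNgt i p) ip orbT.
suff -> : \sum_(1 <= j < q.+1) (par_t u j *: 'X^j * ccoef_poly u n)`_i =
    \sum_(1 <= j < (minn q i.-1).+1) par_t u j * ccoef u (i - j) by ring.
rewrite (big_cat_nat (n := (minn q i.-1).+1)) ?ltnS ?geq_minl//=.
rewrite [X in _ + X]big1_seq ?addr0.
  apply: eq_big_nat => j; rewrite ltnS leq_min => /and3P[j1 jq ji].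
  have ij : (0 < i - j)%N by rewrite subn_gt0 -(ltn_predK i0) ltnS.
  have ji' : (j <= i)%N by rewrite ltnW// -subn_gt0.
  by rewrite -scalerAl coefZ coefXnM ltnNge ji' /= cE ?leq_subr// ij.
move=> j /andP[_]; rewrite mem_index_iota => /andP[jm jq].
rewrite -scalerAl coefZ coefXnM; case: ltnP => [|ji]; first by rewrite mulr0.
have -> : (i - j = 0)%N.
  move: jm; rewrite gtn_min ltnNge -ltnS jq /= => ij; apply/eqP; rewrite subn_eq0.
  by rewrite -(ltn_predK i0).
by rewrite cE// mulr0n mulr0.
Qed.

(** The coefficients identify the parameter: equal coefficients give
    [alpha_u * beta_v = alpha_v * beta_u], and the fraction [alpha_v / beta_v]
    is irreducible, of exact degree [p] in the numerator. *)
Lemma ccoef_inj u v : U u -> U v -> coprimep (alpha_poly v) (beta_poly v) ->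
  (forall i, ccoef u i = ccoef v i) -> u = v.
Proof.
move=> Uu Uv cop cE.
have cpE n : ccoef_poly u n = ccoef_poly v n.
  by apply/polyP => i; rewrite !coef_poly cE.
set Au := alpha_poly u; set Av := alpha_poly v.
set Bu := beta_poly u; set Bv := beta_poly v.
have XnP n (E : {poly R}) : (forall i, (i < n)%N -> E`_i = 0) ->
    exists F, E = F * 'X^n.
  move=> En; exists (drop_poly n E); rewrite -{1}(poly_take_drop n E) (_ : take_poly n E = 0) ?add0r//.
  by apply/polyP => i; rewrite coef_take_poly coef0; case: ifP => // /En.
have cross : Au * Bv = Av * Bu.
  apply/eqP; rewrite -subr_eq0; set D := _ - _.
  pose n := (size D).
  have /XnP[F1 E1] : forall i, (i < n)%N -> (Au - Bu * ccoef_poly u n)`_i = 0.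
    by move=> i iN; exact: ccoef_polyE.
  have /XnP[F2 E2] : forall i, (i < n)%N -> (Av - Bv * ccoef_poly v n)`_i = 0.
    by move=> i iN; exact: ccoef_polyE.
  have DE : D = (F1 * Bv - F2 * Bu) * 'X^n.
    have ringE (a b a' b' c : {poly R}) :
        a * b' - a' * b = (a - b * c) * b' - (a' - b' * c) * b by ring.
    have -> : D = (Au - Bu * ccoef_poly u n) * Bv - (Av - Bv * ccoef_poly v n) * Bu.
      by rewrite cpE; exact: ringE.
    by rewrite E1 E2 mulrBl -!mulrA ![_ * 'X^n]mulrC.
  apply/eqP/polyP => i; rewrite coef0.
  have [iN|iN] := ltnP i (size D); last by rewrite nth_default.
  by rewrite DE coefMXn iN.
have sAv : size Av = p.+1.
  apply/eqP; rewrite eqn_leq size_alpha_poly ltnNge; apply/negP => sp.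
  have := coef_alpha_poly v p; rewrite -/Av nth_default// => /esym sp0.
  have pp : (0 < p <= p)%N by rewrite p_gt0 leqnn.
  by have /andP[] := par_sU Uv pp; rewrite sp0 leNgt ulo_gt0.
have Av0 : Av != 0 by rewrite -size_poly_gt0 sAv.
have Au0 : Au != 0.
  have := coef_alpha_poly u p; rewrite -/Au; apply: contra_eq_neq => ->.
  have pp : (0 < p <= p)%N by rewrite p_gt0 leqnn.
  rewrite coef0 eq_sym gt_eqF//.
  by have /andP[+ _] := par_sU Uu pp; apply: lt_le_trans.
have dv : Av %| Au.
  by rewrite -(Gauss_dvdpl Au cop) -/Bv cross dvdp_mulr.
have sAu : size Au = p.+1.
  by apply/eqP; rewrite eqn_leq size_alpha_poly -sAv dvdp_leq.
have /eqpf_eq[c c0 AE] : Au %= Av.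
  by rewrite eqp_sym -(dvdp_size_eqp dv) sAv sAu.
have BE : Bu = c *: Bv.
  apply: (mulfI Av0); rewrite -cross AE.
  by rewrite -scalerAl -scalerAr.
have c1 : c = 1.
  have := congr1 (fun f : {poly R} => f`_0) BE.
  by rewrite coefZ !coef_beta_poly eqxx !par_t_out// subr0 mulr1.
rewrite c1 !scale1r in AE BE.
have es i : par_s u i = par_s v i by rewrite -!coef_alpha_poly -/Au AE.
have et j : par_t u j = par_t v j.
  have := congr1 (fun f : {poly R} => f`_j) BE.
  by rewrite !coef_beta_poly => /addrI /oppr_inj.
apply: par_inj => //; have := cE 0%N => /=.
under eq_bigr do rewrite et.
have g0 : 1 - \sum_(1 <= j < q.+1) par_t v j != 0.
  by rewrite gt_eqF// (lt_le_trans r0_gt0) ?c0_gap.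
by move=> /divIf; apply.
Qed.

End Coefficients.

(** * The operator norm *)

Section OperatorNorm.
(* [i0] makes the dimension positive, so that the unit sphere is not empty *)
Variables (R : realType) (m : nat) (i0 : 'I_m).
Implicit Types (A B : 'M[R]_m) (v : 'cV[R]_m).

Lemma euclid_norm_ge0 v : 0 <= euclid_norm v.
Proof. exact: sqrtr_ge0. Qed.

Lemma sum_sqr_ge0 v : 0 <= \sum_(i < m) v i ord0 ^+ 2.
Proof. by apply: sumr_ge0 => i _; rewrite sqr_ge0. Qed.

Lemma euclid_normZ a v : euclid_norm (a *: v) = `|a| * euclid_norm v.
Proof.
rewrite /euclid_norm; under eq_bigr do rewrite mxE exprMn.
by rewrite -mulr_sumr sqrtrM ?sqr_ge0// sqrtr_sqr.
Qed.

Lemma entry_le_euclid_norm v i : `|v i ord0| <= euclid_norm v.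
Proof.
rewrite -sqrtr_sqr ler_wsqrtr// (bigD1 i)//= lerDl.
by apply: sumr_ge0 => j _; rewrite sqr_ge0.
Qed.

Lemma euclid_norm_le_sum v : euclid_norm v <= \sum_(i < m) `|v i ord0|.
Proof.
have s0 : 0 <= \sum_(i < m) `|v i ord0| by apply: sumr_ge0.
rewrite -[leRHS]ger0_norm// -sqrtr_sqr ler_wsqrtr//.
rewrite expr2 mulr_suml; apply: ler_sum => i _.
rewrite -[leLHS]ger0_norm ?sqr_ge0// normrX expr2.
by rewrite ler_wpM2l// (bigD1 i)//= lerDl sumr_ge0.
Qed.

Lemma euclid_norm_eq0 v : euclid_norm v = 0 -> v = 0.
Proof.
move=> v0; apply/colP => i; rewrite mxE; apply/eqP.
by rewrite -normr_eq0 eq_le normr_ge0 -v0 (le_trans (entry_le_euclid_norm v i)).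
Qed.

Let e0 (j : 'I_m) : 'cV[R]_m := delta_mx j ord0.

Let norm_e0 j : euclid_norm (e0 j) = 1.
Proof.
rewrite /euclid_norm (bigD1 j)//= mxE !eqxx expr1n big1 ?addr0 ?sqrtr1//.
by move=> i ij; rewrite mxE (negbTE ij) expr0n.
Qed.

Let mul_e0 A i j : (A *m e0 j) i ord0 = A i j.
Proof.
rewrite mxE (bigD1 j)//= mxE !eqxx mulr1 big1 ?addr0// => k kj.
by rewrite mxE (negbTE kj) mulr0.
Qed.

Let image_bound A v : euclid_norm v = 1 ->
  euclid_norm (A *m v) <= \sum_(i < m) \sum_(j < m) `|A i j|.
Proof.
move=> v1; apply: le_trans (euclid_norm_le_sum _) _; apply: ler_sum => i _.
rewrite mxE; apply: le_trans (ler_norm_sum _ _ _) _; apply: ler_sum => j _.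
by rewrite normrM ler_piMr// -v1 entry_le_euclid_norm.
Qed.

Let has_sup_opnorm A : has_sup
  [set euclid_norm (A *m v) | v in [set v : 'cV[R]_m | euclid_norm v = 1]].
Proof.
split; first by exists (euclid_norm (A *m e0 i0)), (e0 i0) => //=.
by exists (\sum_(i < m) \sum_(j < m) `|A i j|) => _ [v v1 <-]; exact: image_bound.
Qed.

Lemma opnorm_le_sum A : opnorm A <= \sum_(i < m) \sum_(j < m) `|A i j|.
Proof.
apply: ge_sup => [|_ [v v1 <-]]; last exact: image_bound.
by case: (has_sup_opnorm A).
Qed.

Lemma opnorm_ge_image A v : euclid_norm v = 1 -> euclid_norm (A *m v) <= opnorm A.
Proof. by move=> v1; apply: (sup_upper_bound (has_sup_opnorm A)); exists v. Qed.

Lemma entry_le_opnorm A i j : `|A i j| <= opnorm A.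
Proof.
rewrite -mul_e0; apply: le_trans (entry_le_euclid_norm _ _) _.
exact: opnorm_ge_image.
Qed.

Lemma opnorm_ge0 A : 0 <= opnorm A.
Proof. exact: le_trans (entry_le_opnorm A i0 i0). Qed.

Lemma euclid_norm_mul A v : euclid_norm (A *m v) <= opnorm A * euclid_norm v.
Proof.
have [v0|v0] := eqVneq (euclid_norm v) 0.
  by rewrite v0 (euclid_norm_eq0 v0) mulmx0 -(scale0r 0) euclid_normZ normr0 !(mul0r, mulr0).
have vp : 0 < euclid_norm v by rewrite lt0r v0 euclid_norm_ge0.
rewrite -ler_pdivrMr// mulrC -[(_)^-1]ger0_norm ?invr_ge0 ?euclid_norm_ge0//.
rewrite -euclid_normZ scalemxAr; apply: opnorm_ge_image.
by rewrite euclid_normZ ger0_norm ?invr_ge0 ?euclid_norm_ge0// mulVf.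
Qed.

Lemma opnorm_le A c : 0 <= c ->
  (forall v, euclid_norm (A *m v) <= c * euclid_norm v) -> opnorm A <= c.
Proof.
move=> c0 Ac; apply: ge_sup => [|_ [v v1 <-]]; first by case: (has_sup_opnorm A).
by rewrite -[c]mulr1 -[in leRHS]v1.
Qed.

Lemma opnorm_mul A B : opnorm (A *m B) <= opnorm A * opnorm B.
Proof.
apply: opnorm_le => [|v]; first by rewrite mulr_ge0 ?opnorm_ge0.
rewrite -mulmxA -mulrA; apply: le_trans (euclid_norm_mul _ _) _.
by rewrite ler_wpM2l ?opnorm_ge0// euclid_norm_mul.
Qed.

(** The quadratic form [c^2 |v|^2 - |A v|^2] is continuous in [v], so its sign
    is decided on the countable set of rational vectors. *)
Lemma opnorm_le_ratP A c : 0 <= c -> opnorm A <= c <->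
  forall v : 'cV[rat]_m,
    \sum_(i < m) (\sum_(j < m) A i j * ratr (v j ord0)) ^+ 2 <=
    c ^+ 2 * \sum_(j < m) ratr (v j ord0) ^+ 2.
Proof.
move=> c0; split=> [Ac v|Ac].
  pose v' : 'cV[R]_m := map_mx ratr v.
  have := euclid_norm_mul A v'; move/le_trans => /(_ (c * euclid_norm v')).
  rewrite ler_wpM2r ?euclid_norm_ge0// => /(_ isT).
  rewrite -(ler_pXn2r (n := 2))// ?nnegrE ?mulr_ge0 ?euclid_norm_ge0//.
  rewrite exprMn /euclid_norm !sqr_sqrtr ?sum_sqr_ge0//.
  rewrite (eq_bigr (fun i => (\sum_(j < m) A i j * ratr (v j ord0)) ^+ 2)).
    by rewrite [in leRHS](eq_bigr (fun j => ratr (v j ord0) ^+ 2))// => j _; rewrite mxE.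
  by move=> i _; rewrite mxE; congr (_ ^+ 2); apply: eq_bigr => j _; rewrite mxE.
apply: opnorm_le => // v.
rewrite -(ler_pXn2r (n := 2))// ?nnegrE ?mulr_ge0 ?euclid_norm_ge0//.
rewrite exprMn /euclid_norm !sqr_sqrtr ?sum_sqr_ge0//.
have /choice[r rP] (nj : nat * 'I_m) : exists r : rat,
    v nj.2 ord0 < ratr r < v nj.2 ord0 + nj.1.+1%:R^-1.
  have /rat_in_itvoo[r] : v nj.2 ord0 < v nj.2 ord0 + nj.1.+1%:R^-1.
    by rewrite ltrDl invr_gt0 ltr0n.
  by rewrite in_itv /= => rr; exists r.
have rv j : (fun n => ratr (r (n, j)) : R) @ \oo --> v j ord0.
  apply/cvgrPdist_lt => e e_gt0; near=> n.
  have /andP[r1 r2] := rP (n, j); rewrite distrC ger0_norm ?subr_ge0 ?ltW//.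
  rewrite ltrBlDl; apply: lt_trans r2 _; rewrite ltrD2l /=.
  by near: n; exact: near_infty_natSinv_lt (PosNum e_gt0).
have cvg_sum (f : 'I_m -> nat -> R) (l : 'I_m -> R) :
    (forall j, f j @ \oo --> l j) ->
    (fun n => \sum_(j < m) f j n) @ \oo --> \sum_(j < m) l j.
  by move=> fl; apply: cvg_big => [|j _]; [exact: add_continuous|exact: fl].
rewrite -subr_ge0.
have cvgf : (fun n => c ^+ 2 * (\sum_(j < m) ratr (r (n, j)) ^+ 2) -
    \sum_(i < m) (\sum_(j < m) A i j * ratr (r (n, j))) ^+ 2) @ \oo -->
    c ^+ 2 * (\sum_(j < m) v j ord0 ^+ 2) - \sum_(i < m) (A *m v) i ord0 ^+ 2.
  apply: cvgB.
    apply: cvgMr; apply: (cvg_sum (fun j n => ratr (r (n, j)) ^+ 2)) => j.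
    by rewrite expr2; under eq_fun do rewrite expr2; apply: cvgM; exact: rv.
  apply: (cvg_sum (fun i n => (\sum_(j < m) A i j * ratr (r (n, j))) ^+ 2)) => i.
  rewrite expr2; under eq_fun do rewrite expr2.
  suff H : (fun n => \sum_(j < m) A i j * ratr (r (n, j))) @ \oo --> (A *m v) i ord0.
    by apply: cvgM.
  rewrite mxE; apply: (cvg_sum (fun j n => A i j * ratr (r (n, j)))) => j.
  by apply: cvgMr; exact: rv.
rewrite -(cvg_lim _ cvgf)//; apply: limr_ge; first by apply/cvg_ex; eexists; exact: cvgf.
apply: nearW => n; rewrite subr_ge0.
have := Ac (\col_j r (n, j)).
rewrite (eq_bigr (fun i => (\sum_(j < m) A i j * ratr (r (n, j))) ^+ 2)).
  by rewrite [in leRHS](eq_bigr (fun j => ratr (r (n, j)) ^+ 2))// => j _; rewrite mxE.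
by move=> i _; congr (_ ^+ 2); apply: eq_bigr => j _; rewrite mxE.
Unshelve. all: by end_near. Qed.

(** The norm is at most [c] on a countable intersection of polynomial conditions
    on the entries. *)
Lemma measurable_opnorm d (T : measurableType d) (M : T -> 'M[R]_m) :
  (forall i j, measurable_fun setT (fun w => M w i j)) ->
  measurable_fun setT (fun w => opnorm (M w)).
Proof.
move=> mM; apply: (measurability _ (RGenOInfty.measurableE R)) => //.
move=> _ [_ [c ->] <-]; rewrite setTI.
rewrite (_ : _ @^-1` _ = ~` [set w | opnorm (M w) <= c]); last first.
  apply/seteqP; split=> w /=; rewrite in_itv /= andbT ltNge; first by move=> /negP.
  by move=> H; apply/negP.
apply: measurableC; have [c0|c0] := ltP c 0.
  rewrite (_ : mkset _ = set0)//; apply/seteqP; split=> // w /= H.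
  by have := le_lt_trans (le_trans (opnorm_ge0 (M w)) H) c0; rewrite ltxx.
rewrite (_ : mkset _ = \bigcap_(n : nat) [set w | forall v : 'cV[rat]_m,
    unpickle n = Some v ->
    \sum_(i < m) (\sum_(j < m) M w i j * ratr (v j ord0)) ^+ 2 <=
    c ^+ 2 * \sum_(j < m) ratr (v j ord0) ^+ 2]); last first.
  apply/seteqP; split=> w /=.
    by move=> /(opnorm_le_ratP _ c0) H n _ v _.
  move=> H; apply/(opnorm_le_ratP _ c0) => v.
  by apply: (H (pickle v)) => //; rewrite pickleK.
apply: bigcapT_measurable => n.
case: (@unpickle 'cV[rat]_m n) => [v|]; last first.
  by rewrite (_ : mkset _ = setT)//; apply/seteqP; split.
rewrite (_ : mkset _ = [set w |
    \sum_(i < m) (\sum_(j < m) M w i j * ratr (v j ord0)) ^+ 2 <=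
    c ^+ 2 * \sum_(j < m) ratr (v j ord0) ^+ 2]); last first.
  by apply/seteqP; split=> w /= H; [exact: H|move=> _ [<-]].
rewrite -[X in measurable X]setTI; apply: measurable_fun_ler => //.
apply: measurable_sum => i; apply: measurable_funX.
by apply: measurable_sum => j; apply: measurable_funM.
Qed.

End OperatorNorm.

(** * Moments of matrix products along the past *)

(** Lets the generic lemmas on iterated operators peel factors off products of
    matrices of a size that need not be a successor. *)
HB.instance Definition _ (R : realType) (n : nat) :=
  Monoid.isLaw.Build 'M[R]_n 1%:M mulmx (@mulmxA R n n n n) (@mul1mx R n n)
    (@mulmx1 R n n).

Lemma garch_size_gt0 (p q : nat) : (0 < (maxn p 2 + maxn q 2).-1)%N.
Proof. by lia. Qed.

Definition garch_idx0 (p q : nat) : 'I_((maxn p 2 + maxn q 2).-1) :=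
  Ordinal (garch_size_gt0 p q).

Section GarchProducts.
Variables (R : realType) (p q : nat) (theta : 'rV[R]_(1 + p + q)).
Variables ulo uhi rho0 : R.
Hypothesis q_gt0 : (0 < q)%N.
Hypothesis p_gt0 : (0 < p)%N.
Hypothesis ulo_gt0 : 0 < ulo.
Hypothesis ulohi : ulo < uhi.
Hypothesis thetaU : param_set ulo uhi rho0 theta.

Local Notation m := (maxn p 2 + maxn q 2).-1.
Local Notation A := (garch_mx theta).

Local Notation i0 := (garch_idx0 p q).

Let s_ge0 i : 0 <= par_s theta i.
Proof. exact: (par_sU_ge0 ulo_gt0 _ thetaU). Qed.

Let t_ge0 i : 0 <= par_t theta i.
Proof. exact: (par_tU_ge0 ulo_gt0 _ thetaU). Qed.

Let uhi_ge0 : 0 <= uhi. Proof. exact/ltW/(lt_trans ulo_gt0). Qed.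

Let s_le i : par_s theta i <= uhi.
Proof.
have [ip|ip] := boolP (0 < i <= p)%N; last by rewrite par_s_out.
by have /andP[] := par_sU thetaU ip.
Qed.

Let t_le i : par_t theta i <= uhi.
Proof.
have [ip|ip] := boolP (0 < i <= q)%N; last by rewrite par_t_out.
by have /andP[] := par_tU thetaU ip.
Qed.

Lemma garch_mx_ge0 e i j : 0 <= A e i j.
Proof.
rewrite mxE; case: ifP => _.
  case: ifP => _ //; apply: addr_ge0 => //; apply: mulrn_wge0.
  by rewrite mulr_ge0// sqr_ge0.
by case: ifP => _; [apply: mulrn_wge0; rewrite sqr_ge0|rewrite ler0n].
Qed.

Lemma garch_mx_le e i j : A e i j <= (uhi + 1) * (1 + e ^+ 2).
Proof.
have e2 : 0 <= e ^+ 2 by rewrite sqr_ge0.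
have ue2 : 0 <= uhi * e ^+ 2 by rewrite mulr_ge0.
have u0 := uhi_ge0.
rewrite mxE mulrDl mul1r mulrDr mulr1; case: ifP => _.
  case: ifP => _; last first.
    by rewrite -addrA; apply: le_trans (s_le _) _; rewrite lerDl !addr_ge0.
  rewrite -addrA; apply: lerD; first exact: t_le.
  apply: (@le_trans _ _ (uhi * e ^+ 2)); last by rewrite lerDl !addr_ge0.
  by case: (nat_of_ord j == 0%N); rewrite ?mulr1n ?mulr0n// ler_wpM2r.
case: ifP => _.
  apply: (@le_trans _ _ (e ^+ 2)); first by case: (nat_of_ord j == 0%N); rewrite ?mulr1n ?mulr0n.
  by rewrite addrA lerDr !addr_ge0.
apply: (@le_trans _ _ 1); first by case: (nat_of_ord i == j.+1); rewrite ?ler01.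
by rewrite addrCA lerDl !addr_ge0.
Qed.

(** The positive corner entry bounds all products from below, whatever the
    innovations, and keeps the logarithms of their norms finite. *)
Lemma garch_mx00 e : ulo <= A e i0 i0.
Proof.
have iE : nat_of_ord i0 = 0%N by [].
rewrite mxE iE eqxx ifT; last by lia.
have qq : (0 < 1 <= q)%N by [].
have /andP[t1 _] := par_tU thetaU qq; apply: le_trans t1 _.
by rewrite mulr1n lerDl mulr_ge0// sqr_ge0.
Qed.

Lemma measurable_garch_mx i j :
  measurable_fun setT (fun e : R => A e i j).
Proof.
rewrite (_ : (fun e => A e i j) = fun e => if (i == 0 :> nat) then
      (if (j < maxn q 2)%N then
        par_t theta j.+1 + (par_s theta 1 * e ^+ 2) *+ (j == 0 :> nat)
      else par_s theta (j - maxn q 2).+2)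
    else if (i == maxn q 2 :> nat) then (e ^+ 2) *+ (j == 0 :> nat)
    else (i == j.+1 :> nat)%:R); last by apply/funext => e; rewrite mxE.
have m2 : measurable_fun setT (fun e : R => e ^+ 2) by exact: exprn_measurable.
case: (nat_of_ord i == 0%N).
  case: (j < maxn q 2)%N; last by [].
  case: (nat_of_ord j == 0%N); last first.
    by under eq_fun do rewrite mulr0n addr0; exact: measurable_cst.
  by apply: measurable_funD => //; apply: measurable_funM.
case: (nat_of_ord i == maxn q 2); last exact: measurable_cst.
by case: (nat_of_ord j == 0%N); last exact: measurable_cst.
Qed.

(** Products along the past: [A_(-1) A_(-2) ... A_(-n)]. *)
Definition past_prod (n : nat) (om : seqspace R) : 'M[R]_m :=
  \big[mulmx/1%:M]_(0 <= i < n) A (om (- (i.+1)%:Z)).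

Definition past_norm n om : R := opnorm (past_prod n om).

Lemma past_prodS n om : past_prod n.+1 om = past_prod n om *m A (om (- (n.+1)%:Z)).
Proof. by rewrite /past_prod big_nat_recr. Qed.

Lemma past_prod0 om : past_prod 0 om = 1%:M.
Proof. by rewrite /past_prod big_geq. Qed.

Lemma past_prodD n k om :
  past_prod (n + k) om = past_prod n om *m past_prod k (tshift (- n%:Z) om).
Proof.
elim: k => [|k ih]; first by rewrite addn0 past_prod0 mulmx1.
rewrite addnS past_prodS ih past_prodS mulmxA; congr (_ *m A _).
by rewrite /tshift /relabel -opprD; congr (om (- _)); clear; lia.
Qed.

Lemma past_prod_ge0 n om i j : 0 <= past_prod n om i j.
Proof.
elim: n i j => [|n ih] i j; first by rewrite past_prod0 mxE ler0n.
rewrite past_prodS mxE; apply: sumr_ge0 => k _.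
by rewrite mulr_ge0// garch_mx_ge0.
Qed.

Lemma past_prod00 n om : ulo ^+ n <= past_prod n om i0 i0.
Proof.
elim: n => [|n ih]; first by rewrite past_prod0 mxE eqxx expr0.
rewrite past_prodS mxE exprSr (bigD1 i0)//=.
apply: (@le_trans _ _ (past_prod n om i0 i0 * A (om (- n.+1%:Z)) i0 i0)).
  by rewrite ler_pM ?exprn_ge0 ?(ltW ulo_gt0)// garch_mx00.
by rewrite lerDl; apply: sumr_ge0 => k _; rewrite mulr_ge0 ?past_prod_ge0 ?garch_mx_ge0.
Qed.

Lemma measurable_past_prod n i j :
  measurable_fun setT (fun om => past_prod n om i j).
Proof.
elim: n i j => [|n ih] i j.
  rewrite (_ : (fun om => _) = cst ((1%:M : 'M[R]_m) i j)); first exact: measurable_cst.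
  by apply/funext => om; rewrite past_prod0.
rewrite (_ : (fun om => _) = fun om : seqspace R =>
    \sum_k past_prod n om i k * A (om (- n.+1%:Z)) k j); last first.
  by apply/funext => om; rewrite past_prodS mxE.
apply: measurable_sum => k; apply: measurable_funM => //.
apply: (measurableT_comp (f := fun e => A e k j)); first exact: measurable_garch_mx.
exact: measurable_coord.
Qed.

Lemma past_prod_depends n :
  depends_on (fun k : int => (- n%:Z <= k < 0)%R) (past_prod n).
Proof.
move=> om om' H; rewrite /past_prod; apply: eq_big_nat => i /andP[_ iN].
by rewrite H//; clear -iN; lia.
Qed.

Lemma measurable_past_norm n : measurable_fun setT (past_norm n).
Proof. by apply: (measurable_opnorm i0) => i j; exact: measurable_past_prod. Qed.

Lemma past_norm_ge n om : ulo ^+ n <= past_norm n om.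
Proof.
apply: le_trans (past_prod00 n om) _; apply: le_trans (ler_norm _) _.
exact: (entry_le_opnorm i0).
Qed.

Lemma past_norm_gt0 n om : 0 < past_norm n om.
Proof. by apply: lt_le_trans (past_norm_ge n om); rewrite exprn_gt0. Qed.

Lemma past_normD n k om :
  past_norm (n + k) om <= past_norm n om * past_norm k (tshift (- n%:Z) om).
Proof. by rewrite /past_norm past_prodD; exact: (opnorm_mul i0). Qed.

Lemma past_norm1_le om :
  past_norm 1 om <= (m * m)%:R * (uhi + 1) * (1 + om (- 1) ^+ 2).
Proof.
apply: le_trans (opnorm_le_sum i0 _) _; rewrite past_prodS past_prod0 mul1mx.
apply: (@le_trans _ _ (\sum_(i < m) \sum_(j < m) (uhi + 1) * (1 + om (- 1) ^+ 2))).
  apply: ler_sum => i _; apply: ler_sum => j _.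
  by rewrite ger0_norm ?garch_mx_ge0// garch_mx_le.
rewrite !sumr_const !card_ord -mulrnA -mulrA.
by rewrite mulr_natl.
Qed.

End GarchProducts.

Section SmallPowers.
Variable R : realType.

(** Second-order expansion of [s |-> x ^ s] at [s = 0]. *)
Lemma powR_le_expansion (x s : R) : 0 < x -> 0 <= s ->
  x `^ s <= 1 + s * ln x + s ^+ 2 * ((1 + x `^ s) * ln x ^+ 2).
Proof.
move=> x0 s0.
have lnE : ln (x `^ s) = s * ln x by rewrite ln_powR.
have z0 : 0 < x `^ s by rewrite powR_gt0.
have ln_le (y : R) : 0 < y -> ln y <= y - 1.
  move=> y0; have y1 : -1 < y - 1 by lra.
  by have := le_ln1Dx y1; rewrite (addrC 1) subrK.
(* z - 1 <= z ln z and z ln z - ln z = (z - 1) ln z <= (1 + z) (ln z)^2 *)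
have l1 : ln (x `^ s) <= x `^ s - 1 by exact: ln_le.
have l2 : x `^ s - 1 <= x `^ s * ln (x `^ s).
  have : ln (x `^ s)^-1 <= (x `^ s)^-1 - 1 by apply: ln_le; rewrite invr_gt0.
  rewrite lnV ?posrE// => H.
  have : x `^ s * (1 - (x `^ s)^-1) <= x `^ s * ln (x `^ s).
    by rewrite (ler_wpM2l (ltW z0))//; lra.
  by rewrite mulrBr mulr1 divff// gt_eqF.
move: l1 l2; rewrite lnE; move: (x `^ s) z0 (ln x) => z z0 l l1 l2.
have -> : s ^+ 2 * ((1 + z) * l ^+ 2) = (1 + z) * (s * l) ^+ 2 by ring.
move: (s * l) l1 l2 => y l1 l2.
suff : (z - 1) * y <= (1 + z) * y ^+ 2 by nra.
have y2 : 0 <= y ^+ 2 by rewrite sqr_ge0.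
by have [y0|y0] := leP 0 y; nra.
Qed.

Lemma ln_le_powR (x a : R) : 1 <= x -> 0 < a -> ln x <= a^-1 * x `^ a.
Proof.
move=> x1 a0; have x0 : 0 < x by exact: lt_le_trans x1.
rewrite mulrC ler_pdivlMr// mulrC -ln_powR.
have z0 : 0 < x `^ a by rewrite powR_gt0.
have z1 : -1 < x `^ a - 1 by lra.
by have := le_ln1Dx z1; rewrite (addrC 1) subrK; lra.
Qed.

Lemma powR_ge1 (x a : R) : 1 <= x -> 0 <= a -> 1 <= x `^ a.
Proof. by move=> x1 a0; rewrite -(powRr0 x) ler_powR. Qed.

Lemma powR_1Dle (x t : R) : 0 <= x -> 0 <= t -> (1 + x) `^ t <= 2 `^ t * (1 + x `^ t).
Proof.
move=> x0 t0; have [x1|x1] := leP x 1.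
  apply: (@le_trans _ _ (2 `^ t)).
    by rewrite ge0_ler_powR ?nnegrE ?addr_ge0//; lra.
  by rewrite ler_peMr ?powR_ge0// lerDl powR_ge0.
apply: (@le_trans _ _ ((2 * x) `^ t)).
  by rewrite ge0_ler_powR ?nnegrE ?mulr_ge0 ?addr_ge0//; lra.
by rewrite powRM// ler_wpM2l ?powR_ge0// lerDr.
Qed.

Lemma geometric_sum_le (x : R) (n : nat) : 0 <= x -> x < 1 ->
  \sum_(0 <= j < n) x ^+ j <= (1 - x)^-1.
Proof.
move=> x0 x1; have g0 : 0 < 1 - x by rewrite subr_gt0.
rewrite -[leRHS]mul1r ler_pdivlMr// mulrC big_mkord -[1 - x]opprB mulNr -subrX1.
by rewrite opprB lerBlDr lerDl exprn_ge0.
Qed.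

(** Below [1] the logarithm is bounded by that of [c]; above, [ln x] is
    dominated by [x] to the power [a / 4], so that its square and [x ^ s] cost
    the power [a / 2] each. *)
Lemma sqr_ln_le (x s a c : R) : 0 < c -> c <= x -> 0 <= s -> 2 * s <= a -> 0 < a ->
  (1 + x `^ s) * ln x ^+ 2 <= (2 * ln c ^+ 2 + 32 / a ^+ 2) * (1 + x `^ a).
Proof.
move=> c0 cx s0 sa a0.
have x0 : 0 < x by exact: lt_le_trans cx.
have xa0 : 0 <= x `^ a by exact: powR_ge0.
have lc0 : 0 <= ln c ^+ 2 by exact: sqr_ge0.
have ia0 : 0 <= 32 / a ^+ 2 by rewrite divr_ge0 ?exprn_ge0 ?ltW.
have [x1|x1] := leP x 1.
  have e1 : (1 : R) `^ s = 1 by rewrite powR1.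
  have xs : x `^ s <= 1 by rewrite -[leRHS]e1 ge0_ler_powR ?nnegrE ?(ltW x0).
  have lx : ln x ^+ 2 <= ln c ^+ 2.
    have cl : ln c <= ln x by rewrite ler_ln// posrE.
    by have := ln_le0 x1; nra.
  have lx0 : 0 <= ln x ^+ 2 by exact: sqr_ge0.
  have xs0 := powR_ge0 x s.
  apply: (@le_trans _ _ (2 * ln c ^+ 2)); first by nra.
  by rewrite mulrDr mulr1 mulrDl; nra.
have x1' := ltW x1.
have a4 : 0 < a / 4 by rewrite divr_gt0.
have lx : ln x <= 4 / a * x `^ (a / 4).
  by rewrite -invf_div; exact: ln_le_powR.
have lx0 : 0 <= ln x by exact: ln_ge0.
have lx2 : ln x ^+ 2 <= 16 / a ^+ 2 * x `^ (a / 2).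
  apply: (@le_trans _ _ ((4 / a * x `^ (a / 4)) ^+ 2)).
    by rewrite lerXn2r// nnegrE// mulr_ge0 ?powR_ge0 ?divr_ge0 ?ltW.
  rewrite exprMn -[(_ `^ _) ^+ 2]powR_mulrn ?powR_ge0// -powRrM.
  rewrite (_ : a / 4 * 2%:R = a / 2); last by field.
  by rewrite expr_div_n (_ : 4 ^+ 2 = 16 :> R)//; ring.
have xs : 1 + x `^ s <= 2 * x `^ (a / 2).
  have : x `^ s <= x `^ (a / 2) by apply: ler_powR => //; lra.
  by have := @powR_ge1 x (a / 2) x1' _; lra.
apply: (@le_trans _ _ (2 * x `^ (a / 2) * (16 / a ^+ 2 * x `^ (a / 2)))).
  by apply: ler_pM => //; rewrite ?sqr_ge0// addr_ge0// powR_ge0.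
rewrite (_ : 2 * _ * _ = 32 / a ^+ 2 * (x `^ (a / 2) * x `^ (a / 2))); last first.
  by move: (x `^ _) => z; field; rewrite gt_eqF.
rewrite -powRD; last by rewrite (gt_eqF x0) implybT.
rewrite (_ : a / 2 + a / 2 = a); last by field.
by nra.
Qed.

End SmallPowers.

Section Submultiplicative.
Variable R : realType.
Variable X : nat -> \bar R.
Hypothesis X0 : forall k, (0 <= X k)%E.
Hypothesis XD : forall k l, (X (k + l)%N <= X k * X l)%E.

Lemma submul_fin : (X 0%N < +oo)%E -> (X 1%N < +oo)%E -> forall n, (X n < +oo)%E.
Proof.
move=> X0fin X1fin; elim=> // n ih; rewrite -addn1; apply: le_lt_trans (XD _ _) _.
by rewrite lte_mul_pinfty// ge0_fin_numE.
Qed.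

(** Grouping the indices by their quotient by [n] compares the series with a
    geometric one of ratio [X n]. *)
Lemma submul_summable n : (forall k, (X k < +oo)%E) -> (0 < n)%N ->
  (X n < 1)%E -> (\sum_(0 <= k <oo) X k < +oo)%E.
Proof.
move=> Xfin n0 xn1.
pose x k := fine (X k).
have xE k : (X k = (x k)%:E)%E.
  by rewrite fineK// ge0_fin_numE ?Xfin.
have x0 k : 0 <= x k by exact: fine_ge0.
have xD k l : x (k + l)%N <= x k * x l.
  by rewrite -lee_fin EFinM -!xE.
have r1 : x n < 1 by rewrite -lte_fin -xE.
pose B := \sum_(0 <= l < n) x l.
have xpow j l : x (j * n + l)%N <= x n ^+ j * x l.
  elim: j => [|j ih]; first by rewrite mul0n add0n expr0 mul1r.
  rewrite mulSn -addnA exprS -mulrA; apply: le_trans (xD _ _) _.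
  by rewrite ler_wpM2l.
have partial J : \sum_(0 <= k < J * n) x k <= B * \sum_(0 <= j < J) x n ^+ j.
  elim: J => [|J ih]; first by rewrite mul0n !big_geq// mulr0.
  rewrite mulSn addnC (big_cat_nat (n := J * n)%N) ?leq_addr//=.
  rewrite big_nat_recr//= mulrDr lerD//.
  rewrite -{1}[(J * n)%N]add0n big_addn addKn mulrC mulr_sumr.
  by apply: ler_sum => l _; rewrite addnC.
rewrite (@eq_eseriesr _ _ (fun k => (x k)%:E))//.
apply: (@le_lt_trans _ _ (B * (1 - x n)^-1)%:E); last exact: ltry.
apply: lime_le; first by apply: is_cvg_nneseries => k _ _; rewrite lee_fin.
apply: nearW => J; rewrite sumEFin lee_fin.
apply: (@le_trans _ _ (\sum_(0 <= k < J * n) x k)).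
  rewrite [leRHS](big_cat_nat (n := J)) ?leq_pmulr//= lerDl.
  by apply: sumr_ge0.
apply: le_trans (partial J) _; apply: ler_wpM2l; last exact: geometric_sum_le.
by apply: sumr_ge0.
Qed.

End Submultiplicative.

Section Moments.
Context (R : realType) (p q : nat) (theta : 'rV[R]_(1 + p + q)).
Variables ulo uhi rho0 : R.
Hypothesis q_gt0 : (0 < q)%N.
Hypothesis p_gt0 : (0 < p)%N.
Hypothesis ulo_gt0 : 0 < ulo.
Hypothesis ulohi : ulo < uhi.
Hypothesis thetaU : param_set ulo uhi rho0 theta.
Context d (T : measurableType d) (P : probability T R).
Variable eps : int -> {RV P >-> R}.
Hypothesis eps_iid : iid eps.
Local Notation path := (seqpath eps).
Local Notation N := (past_norm theta).

Let mN n : measurable_fun setT (N n).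
Proof.
exact: measurable_past_norm.
Qed.
Let N_gt0 n om : 0 < N n om.
Proof. exact: (past_norm_gt0 (ulo := ulo) (uhi := uhi) (rho0 := rho0)). Qed.

Let N_ge n om : ulo ^+ n <= N n om.
Proof. exact: (past_norm_ge (uhi := uhi) (rho0 := rho0)). Qed.

Definition past_moment (s : R) (n : nat) : \bar R :=
  (\int[P]_w (N n (path w) `^ s)%:E)%E.

Lemma past_moment_ge0 s n : (0 <= past_moment s n)%E.
Proof. by apply: integral_ge0 => w _; rewrite lee_fin powR_ge0. Qed.

Lemma past_momentE s n :
  past_moment s n = (\int[P]_w (N n (path w) `^ s)%:E)%E.
Proof. by []. Qed.

Opaque past_moment.

Lemma measurable_normpow s n :
  measurable_fun setT (fun om => (N n om `^ s)%:E).
Proof.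
apply/measurable_EFinP.
by apply: (measurableT_comp (measurable_powR s)); exact: mN.
Qed.

(** Past norms over adjacent blocks are independent, hence their moments
    are submultiplicative. *)
Lemma past_momentD s n k : 0 <= s ->
  (past_moment s (n + k) <= past_moment s n * past_moment s k)%E.
Proof.
move=> s0.
have mp : measurable_fun setT path by exact: measurable_seqpath.
have ms : measurable_fun setT (fun om => (N k (tshift (- n%:Z) om) `^ s)%:E).
  by apply: (measurableT_comp (measurable_normpow s k)); exact: measurable_tshift.
have -> : past_moment s k =
    (\int[P]_w (N k (tshift (- n%:Z) (path w)) `^ s)%:E)%E.
  have F0 om : (0 <= (N k om `^ s)%:E)%E by rewrite lee_fin powR_ge0.
  rewrite past_momentE.
  exact/esym/(expect_tshift eps_iid (- n%:Z) (measurable_normpow s k) F0).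
rewrite !past_momentE.
rewrite -(depends_on_integralM eps_iid (I := fun k => (- n%:Z <= k < 0)%R)
    (J := fun k => (k < - n%:Z)%R) (F := fun om => (N n om `^ s)%:E)
    (Z := fun om => (N k (tshift (- n%:Z) om) `^ s)%:E)); first last.
- by move=> om; rewrite lee_fin powR_ge0.
- by move=> om; rewrite lee_fin powR_ge0.
- exact: ms.
- exact: measurable_normpow.
- move=> om om' H; rewrite /past_norm.
  rewrite (_ : past_prod theta k (tshift (- n%:Z) om) =
               past_prod theta k (tshift (- n%:Z) om')) //.
  by apply: past_prod_depends => i ii; apply: H; lia.
- by move=> om om' H; rewrite /past_norm; congr (opnorm _ `^ s)%:E; exact: past_prod_depends.
- by move=> i; lia.
apply: ge0_le_integral; first exact: measurableT.
- by move=> w _; rewrite lee_fin powR_ge0.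
- by apply: (measurableT_comp (measurable_normpow s (n + k))).
- apply: emeasurable_funM.
    by apply: (measurableT_comp (measurable_normpow s n)).
  by apply: (measurableT_comp ms).
move=> w _; rewrite -EFinM lee_fin -powRM ?(ltW (N_gt0 _ _))//.
have N0 i om : 0 <= N i om by exact/ltW/N_gt0.
apply: ge0_ler_powR => //; rewrite ?nnegrE ?mulr_ge0//.
exact: past_normD.
Qed.

Variable kappa : R.
Hypothesis kappa_gt0 : 0 < kappa.
Hypothesis eps_moment : (\int[P]_w (`|eps 0 w ^+ 2| `^ kappa)%:E < +oo)%E.

Lemma eps_sqr_momentE k :
  (\int[P]_w (`|eps k w ^+ 2| `^ kappa)%:E = \int[P]_w (`|eps 0 w ^+ 2| `^ kappa)%:E)%E.
Proof.
pose F (om : seqspace R) : \bar R := (`|om 0 ^+ 2| `^ kappa)%:E.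
have mF : measurable_fun setT F.
  apply/measurable_EFinP; apply: (measurableT_comp (measurable_powR kappa)).
  apply: measurableT_comp => //; apply: measurable_funX; exact: measurable_coord.
have F0 om : (0 <= F om)%E by rewrite lee_fin powR_ge0.
rewrite -[RHS](expect_tshift eps_iid k mF F0).
by apply: eq_integral => w _; rewrite /F /tshift /relabel add0r.
Qed.

Let mpath : measurable_fun setT path. Proof. exact: measurable_seqpath. Qed.

Lemma measurable_normpow_path s n :
  measurable_fun setT (fun w => (N n (path w) `^ s)%:E).
Proof. exact: (measurableT_comp (measurable_normpow s n) mpath). Qed.

Let past_moment1 : (past_moment kappa 1 < +oo)%E.
Proof.
pose K := ((((maxn p 2 + maxn q 2).-1 * (maxn p 2 + maxn q 2).-1)%N%:R * (uhi + 1)) `^ kappa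
  * 2 `^ kappa).
have K0 : 0 <= K by rewrite mulr_ge0 ?powR_ge0.
have mE : measurable_fun setT (fun w => (`|eps (- 1) w ^+ 2| `^ kappa)%:E).
  apply/measurable_EFinP; apply: (measurableT_comp (measurable_powR kappa)).
  by apply: measurableT_comp => //; exact: measurable_funX.
rewrite ?past_momentE.
apply: (@le_lt_trans _ _ (\int[P]_w (K%:E * (1 + (`|eps (- 1) w ^+ 2| `^ kappa)%:E)))%E).
  apply: ge0_le_integral; first exact: measurableT.
  - by move=> w _; rewrite lee_fin powR_ge0.
  - exact: measurable_normpow_path.
  - by apply: emeasurable_funM => //; apply: emeasurable_funD.
  move=> w _; rewrite -EFinD -EFinM lee_fin.
  have u0 : 0 <= uhi + 1 by rewrite addr_ge0// ltW// (lt_trans ulo_gt0).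
  have c0 : 0 <= (((maxn p 2 + maxn q 2).-1 * (maxn p 2 + maxn q 2).-1)%N%:R * (uhi + 1)).
    by rewrite mulr_ge0.
  have e0 : 0 <= eps (- 1) w ^+ 2 by rewrite sqr_ge0.
  apply: (@le_trans _ _ ((((maxn p 2 + maxn q 2).-1 * (maxn p 2 + maxn q 2).-1)%N%:R
      * (uhi + 1) * (1 + eps (- 1) w ^+ 2)) `^ kappa)).
    apply: ge0_ler_powR; rewrite ?nnegrE ?(ltW (N_gt0 _ _)) ?(ltW kappa_gt0)//.
      by rewrite mulr_ge0// addr_ge0.
    exact: (past_norm1_le ulo_gt0 ulohi thetaU).
  rewrite powRM ?addr_ge0// /K -[leRHS]mulrA ler_wpM2l ?powR_ge0//.
  by rewrite [`|eps _ _ ^+ 2|]ger0_norm// powR_1Dle// ltW.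
rewrite ge0_integralZl//; last first.
- by move=> w _; rewrite adde_ge0// lee_fin powR_ge0.
- exact: emeasurable_funD.
rewrite ge0_integralD//; try by move=> w _; rewrite lee_fin powR_ge0.
rewrite integral_cst//= mul1e probability_setT eps_sqr_momentE.
by apply: lte_mul_pinfty => //; rewrite lte_add_pinfty// ltry.
Qed.

(** [x ^ s <= 1 + x ^ kappa] reduces to the power [kappa], and
    submultiplicativity to one matrix. *)
Lemma past_moment_fin s n : 0 <= s -> s <= kappa -> (past_moment s n < +oo)%E.
Proof.
move=> s0 sk.
have fin : (past_moment kappa n < +oo)%E.
  have m0 : (past_moment kappa 0 < +oo)%E.
    rewrite past_momentE (eq_integral (cst (opnorm (1%:M : 'M[R]_((maxn p 2 + maxn q 2).-1)) `^ kappa)%:E)).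
      by rewrite integral_cst//= probability_setT mule1 ltry.
    by move=> w _; rewrite /past_norm past_prod0.
  exact: (submul_fin (past_moment_ge0 kappa)
    (fun i j => past_momentD i j (ltW kappa_gt0)) m0 past_moment1 n).
rewrite ?past_momentE.
apply: (@le_lt_trans _ _ (\int[P]_w (1 + (N n (path w) `^ kappa)%:E))%E).
  apply: ge0_le_integral; first exact: measurableT.
  - by move=> w _; rewrite lee_fin powR_ge0.
  - exact: measurable_normpow_path.
  - by apply: emeasurable_funD => //; exact: measurable_normpow_path.
  move=> w _; rewrite -EFinD lee_fin; set x := N n (path w).
  have x0 : 0 < x by exact: N_gt0.
  have [x1|x1] := leP 1 x.
    by apply: le_trans (ler_powR x1 sk) _; rewrite lerDr.
  have e1 : (1 : R) `^ s = 1 by rewrite powR1.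
  apply: (@le_trans _ _ 1); last by rewrite lerDl powR_ge0.
  by rewrite -[leRHS]e1 ge0_ler_powR ?nnegrE// ltW.
rewrite ge0_integralD//; [|by move=> w _; rewrite lee_fin powR_ge0|exact: measurable_normpow_path].
rewrite integral_cst//= mul1e probability_setT.
by rewrite lte_add_pinfty ?ltry//; move: fin; rewrite past_momentE.
Qed.

Lemma integrable_normpow n : P.-integrable setT (fun w => (N n (path w) `^ kappa)%:E).
Proof.
apply/integrableP; split; first exact: measurable_normpow_path.
under eq_integral do rewrite gee0_abs ?lee_fin ?powR_ge0//.
by have := past_moment_fin n (ltW kappa_gt0) (lexx _); rewrite past_momentE.
Qed.

(** The logarithm is bounded from below because the norm is at least [ulo ^+ n],
    and from above by a power of the norm. *)
Lemma integrable_lognorm n : P.-integrable setT (fun w => (ln (N n (path w)))%:E).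
Proof.
pose c := `|ln (ulo ^+ n)|.
have i1 : P.-integrable setT (fun w => (c + kappa^-1 * N n (path w) `^ kappa)%:E).
  rewrite (_ : (fun w => _) = (EFin \o cst c) \+
      (fun w => (kappa^-1)%:E * (N n (path w) `^ kappa)%:E))%E.
    apply: integrableD => //; first exact: finite_measure_integrable_cst.
    by apply: integrableZl => //; exact: integrable_normpow.
  by apply/funext => w.
apply: (le_integrable _ _ _ i1) => //.
  apply/measurable_EFinP; apply: (measurableT_comp (@measurable_ln R)).
  exact: (measurableT_comp (mN n) mpath).
move=> w _; rewrite !abse_EFin lee_fin.
have x0 := N_gt0 n (path w); have xc := N_ge n (path w).
have un0 : 0 < ulo ^+ n by rewrite exprn_gt0.
set x := N n (path w) in x0 xc *.
have k0 : 0 <= kappa^-1 * x `^ kappa by rewrite mulr_ge0 ?powR_ge0// invr_ge0 ltW.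
have c0 : 0 <= c by exact: normr_ge0.
rewrite [leRHS]ger0_norm ?addr_ge0//.
have lxc : ln (ulo ^+ n) <= ln x by rewrite ler_ln// posrE.
have lxc' : - c <= ln x by apply: le_trans lxc; rewrite /c lerNl -normrN ler_norm.
have [x1|x1] := leP 1 x.
  by rewrite ger0_norm ?ln_ge0//; have := ln_le_powR x1 kappa_gt0; lra.
by rewrite ler0_norm; [lra|apply: ln_le0; exact: ltW].
Qed.

(** [E log N < 0] is the derivative at [s = 0] of [E N^s]. *)
Lemma past_moment_lt1 n : (\int[P]_w (ln (N n (path w)))%:E < 0)%E ->
  exists s, [/\ 0 < s, s <= 1, s <= kappa & (past_moment s n < 1)%E].
Proof.
move=> L0.
have un0 : 0 < ulo ^+ n by rewrite exprn_gt0.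
pose K := 2 * ln (ulo ^+ n) ^+ 2 + 32 / kappa ^+ 2.
have K0 : 0 <= K.
  have k0 := ltW kappa_gt0; have l0 := sqr_ge0 (ln (ulo ^+ n)).
  by rewrite /K addr_ge0// mulr_ge0// invr_ge0 exprn_ge0.
pose L := fine (\int[P]_w (ln (N n (path w)))%:E)%E.
have iL := integrable_lognorm n; have iM := integrable_normpow n.
have LE : (\int[P]_w (ln (N n (path w)))%:E = L%:E)%E.
  by rewrite fineK//; exact: integrable_fin_num iL.
pose M := fine (\int[P]_w (N n (path w) `^ kappa)%:E)%E.
have ME : (\int[P]_w (N n (path w) `^ kappa)%:E = M%:E)%E.
  by rewrite fineK//; exact: integrable_fin_num iM.
have M0 : 0 <= M.
  by rewrite -lee_fin -ME; apply: integral_ge0 => w _; rewrite lee_fin powR_ge0.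
have {}L0 : L < 0 by rewrite -lte_fin -LE.
pose B := K * (1 + M) + 1.
have B0 : 0 < B by rewrite ltr_wpDl// mulr_ge0// addr_ge0.
(* at this size the quadratic term is at most half of the linear one *)
pose s := Num.min 1 (Num.min (kappa / 2) (- L / (2 * B))).
have s0 : 0 < s.
  by rewrite !lt_min ltr01 !divr_gt0 ?mulr_gt0// oppr_gt0.
have s1 : s <= 1 by rewrite ge_min lexx.
have sk : s <= kappa / 2 by rewrite !ge_min lexx orbT.
have sL : s <= - L / (2 * B) by rewrite !ge_min lexx !orbT.
exists s; split=> //; first by apply: le_trans sk _; rewrite ler_pdivrMr// ler_pMr// ler1n.
rewrite past_momentE.
apply: (@le_lt_trans _ _ (1 + s * L + s ^+ 2 * (K * (1 + M)))%:E).
  have -> : ((1 + s * L + s ^+ 2 * (K * (1 + M)))%:E = \int[P]_w ((1 + s ^+ 2 * K)%:E +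
      (s%:E * (ln (N n (path w)))%:E + (s ^+ 2 * K)%:E * (N n (path w) `^ kappa)%:E)))%E.
    rewrite integralD//; last 2 first.
    - by apply: finite_measure_integrable_cst.
    - by apply: integrableD => //; apply: integrableZl.
    rewrite integralD//; [|exact: integrableZl|exact: integrableZl].
    rewrite !integralZl// LE ME integral_cst//= probability_setT mule1.
    by rewrite -!EFinM -!EFinD; congr EFin; ring.
  apply: ge0_le_integral; first exact: measurableT.
  - by move=> w _; rewrite lee_fin powR_ge0.
  - exact: measurable_normpow_path.
  - apply: emeasurable_funD => //; apply: emeasurable_funD.
      by apply: measurable_funeM; exact: measurable_int iL.
    by apply: measurable_funeM; exact: measurable_int iM.
  move=> w _; rewrite -!EFinM -!EFinD lee_fin.
  have x0 := N_gt0 n (path w); have xc := N_ge n (path w).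
  apply: le_trans (powR_le_expansion x0 (ltW s0)) _.
  have sk2 : 2 * s <= kappa by lra.
  have := sqr_ln_le un0 xc (ltW s0) sk2 kappa_gt0; rewrite -/K => H.
  have s20 : 0 <= s ^+ 2 by rewrite sqr_ge0.
  have := ler_wpM2l s20 H; rewrite (mulrDr K) mulr1 (mulrDr (s ^+ 2)) mulrA; lra.
rewrite lte_fin; have KB : K * (1 + M) <= B by rewrite lerDl.
have : s * (2 * B) <= - L by rewrite -ler_pdivlMr ?mulr_gt0.
have : 0 <= K * (1 + M) by rewrite mulr_ge0// addr_ge0.
move: (K * (1 + M)) KB => C CB C0 H; nra.
Qed.

Lemma past_moment_summable s n : 0 <= s -> s <= kappa -> (0 < n)%N ->
  (past_moment s n < 1)%E -> (\sum_(0 <= k <oo) past_moment s k < +oo)%E.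
Proof.
move=> s0 sk n0 xn1.
exact: (submul_summable (past_moment_ge0 s) (fun k l => past_momentD k l s0)
  (fun k => past_moment_fin k s0 sk) n0 xn1).
Qed.

(** The matrices enter the Lyapunov exponent in the order of increasing
    times; reversing the time turns them into a product along the past. *)
Lemma Elog_normE n :
  Elog_norm theta eps n = (\int[P]_w (ln (N n.+1 (path w)))%:E)%E.
Proof.
pose phi (k : int) : int := - k - 1.
have phiK : cancel phi phi by move=> k; rewrite /phi; lia.
pose F om : \bar R := (ln (N n.+1 om))%:E.
have mF : measurable_fun setT F.
  apply/measurable_EFinP; apply: (measurableT_comp (@measurable_ln R)).
  exact: mN.
transitivity (\int[P]_w F (relabel phi (path w)))%E.
  apply: eq_integral => w _; rewrite /F.
  rewrite (_ : \big[_/_]_(_ <= i < _) _ = past_prod theta n.+1 (relabel phi (path w))).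
    by rewrite lne_EFin//; exact: N_gt0.
  apply: eq_big_nat => i _; congr (garch_mx theta _).
  by rewrite /relabel /seqpath /phi; congr (eps _ w); lia.
exact: (expect_relabel_signed eps_iid phiK mF).
Qed.

(** A negative exponent makes some [E log N_n] negative, hence some small moment
    of [N_n] less than one; submultiplicativity then makes the moments summable. *)
Theorem past_moment_small : (lyapunov theta eps < 0)%E ->
  exists s, [/\ 0 < s, s <= 1, s <= kappa &
    (\sum_(0 <= k <oo) past_moment s k < +oo)%E].
Proof.
rewrite /lyapunov => /ereal_inf_lt[_ [n n1 <-]] Hn.
have L0 : (\int[P]_w (ln (N n.+1 (path w)))%:E < 0)%E.
  rewrite -Elog_normE ltNge; apply/negP => E0; move: Hn.
  by rewrite ltNge mule_ge0// lee_fin invr_ge0.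
have [s [s0 s1 sk xs]] := past_moment_lt1 L0.
by exists s; split=> //; apply: (past_moment_summable (ltW s0) sk _ xs).
Qed.

End Moments.

(** * Trajectories of the volatility recursion *)

Lemma int_lag_sub (k : int) (i j : nat) : (j <= i)%N ->
  k + i%:Z - j%:Z = k + (i - j)%:Z.
Proof. by lia. Qed.

Lemma int_lag_add1 (k : int) (i j : nat) : (i <= j)%N ->
  k + i%:Z - j%:Z = k + 1 - (j - i).+1%:Z.
Proof. by lia. Qed.

Section GarchPath.
Variables (R : realType) (p q : nat) (theta : 'rV[R]_(1 + p + q)).
Variables ulo uhi rho0 : R.
Hypothesis q_gt0 : (0 < q)%N.
Hypothesis p_gt0 : (0 < p)%N.
Hypothesis ulo_gt0 : 0 < ulo.
Hypothesis ulo_lt1 : ulo < 1.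
Hypothesis ulohi : ulo < uhi.
Hypothesis thetaU : param_set ulo uhi rho0 theta.

(** The squared volatilities [a] driven by the innovations [e] along a single
    trajectory: the estimates of this section are deterministic. *)
Definition garch_path (e a : int -> R) := forall k, 0 <= a k /\
  a k = par_x theta
    + \sum_(1 <= i < p.+1) par_s theta i * (a (k - i%:Z) * e (k - i%:Z) ^+ 2)
    + \sum_(1 <= j < q.+1) par_t theta j * a (k - j%:Z).

Variables e a : int -> R.
Hypothesis ea : garch_path e a.
Local Notation y2 k := (a k * e k ^+ 2).

Let a_ge0 k : 0 <= a k. Proof. by case: (ea k). Qed.
Let y2_ge0 k : 0 <= y2 k. Proof. by rewrite mulr_ge0// sqr_ge0. Qed.
Let s_ge0 i : 0 <= par_s theta i.
Proof. exact: (par_sU_ge0 ulo_gt0 _ thetaU). Qed.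
Let t_ge0 i : 0 <= par_t theta i.
Proof. exact: (par_tU_ge0 ulo_gt0 _ thetaU). Qed.
Let x_ge : ulo <= par_x theta.
Proof. by have /andP[] := par_xU thetaU. Qed.

Let sum_s_ge0 k n : 0 <= \sum_(1 <= i < n) par_s theta i * y2 (k - i%:Z).
Proof. by apply: sumr_ge0 => i _; rewrite mulr_ge0. Qed.
Let sum_t_ge0 k n : 0 <= \sum_(1 <= j < n) par_t theta j * a (k - j%:Z).
Proof. by apply: sumr_ge0 => i _; rewrite mulr_ge0. Qed.

Lemma garch_path_ge_x k : par_x theta <= a k.
Proof. by have [_ ->] := ea k; rewrite -addrA lerDl addr_ge0. Qed.

Lemma garch_path_ge k : ulo <= a k.
Proof. exact: le_trans (garch_path_ge_x k). Qed.

Let le_sum_term (f : nat -> R) n i : (forall j, 0 <= f j) -> (0 < i <= n)%N ->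
  f i <= \sum_(1 <= j < n.+1) f j.
Proof.
move=> f0 /andP[i0 iN]; rewrite (bigD1_seq i) ?mem_index_iota ?iota_uniq ?i0//=.
by rewrite lerDl sumr_ge0.
Qed.

(** A squared observation enters the next [p] volatilities, with coefficients at
    least [ulo]. *)
Lemma garch_path_ge_y2 k i : (0 < i <= p)%N -> ulo * y2 (k - i%:Z) <= a k.
Proof.
move=> ip; have [_ ->] := ea k; rewrite -addrA addrCA.
have x0 := le_trans (ltW ulo_gt0) x_ge.
apply: (@le_trans _ _ (par_s theta i * y2 (k - i%:Z))).
  by rewrite ler_wpM2r//; have /andP[] := par_sU thetaU ip.
apply: le_trans (le_sum_term (f := fun i => par_s theta i * y2 (k - i%:Z)) _ ip) _.
  by move=> j; rewrite mulr_ge0.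
by rewrite lerDl addr_ge0.
Qed.

Lemma garch_path_ge_a k i : (0 < i <= q)%N -> ulo * a (k - i%:Z) <= a k.
Proof.
move=> ip; have [_ ->] := ea k.
have x0 := le_trans (ltW ulo_gt0) x_ge.
apply: (@le_trans _ _ (par_t theta i * a (k - i%:Z))).
  by rewrite ler_wpM2r//; have /andP[] := par_tU thetaU ip.
apply: le_trans (le_sum_term (f := fun i => par_t theta i * a (k - i%:Z)) _ ip) _.
  by move=> j; rewrite mulr_ge0.
by rewrite lerDr addr_ge0.
Qed.

Local Notation m := (maxn p 2 + maxn q 2).-1.
Local Notation Q := (maxn q 2).
Local Notation i0 := (garch_idx0 p q).

(** The state that the matrices of the model act on: the last squared
    volatilities, followed by the last squared observations. *)
Definition state (k : int) : 'cV[R]_m := \col_(i < m)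
  if (i < maxn q 2)%N then a (k - i%:Z) else y2 (k - (i - maxn q 2).+1%:Z).

Lemma state_ge0 k i : 0 <= state k i ord0.
Proof. by rewrite mxE; case: ifP. Qed.

Lemma state_le k i : ulo * state k i ord0 <= a k.
Proof.
rewrite mxE; case: ifP => iQ; last first.
  by apply: garch_path_ge_y2; case: i iQ => i /= im; lia.
have [i00|i00] := posnP i; last by apply: garch_path_ge_a; lia.
by rewrite i00 subr0 ger_pMl ?(ltW ulo_lt1)// (lt_le_trans ulo_gt0)// garch_path_ge.
Qed.

Lemma state0 k : state k i0 ord0 = a k.
Proof. by rewrite mxE /= ifT ?subr0//; lia. Qed.

Let sum_padded (f : nat -> R) (n n' : nat) : (n <= n')%N ->
  (forall i, (n <= i)%N -> f i = 0) -> \sum_(i < n') f i = \sum_(i < n) f i.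
Proof.
move=> nn' f0; rewrite -!(big_mkord xpredT f) (big_cat_nat (n := n))//=.
rewrite [X in _ + X]big_nat_cond [X in _ + X]big1 ?addr0// => i /andP[/andP[ni _] _].
exact: f0.
Qed.

(** The companion form of the recursion; the coefficients that pad [p] and [q]
    up to [2] vanish. *)
Lemma stateS (k : int) : state (k + 1) =
  garch_mx theta (e k) *m state k + par_x theta *: delta_mx i0 ord0.
Proof.
apply/colP => i.
rewrite [RHS](_ : _ = \sum_j garch_mx theta (e k) i j * state k j ord0
  + par_x theta * (i == i0)%:R); last by rewrite !mxE eqxx andbT.
rewrite mxE.
have [iz|iz] := eqVneq i i0.
  rewrite iz /= ifT; last by lia.
  rewrite subr0 mulr1; have [_ ->] := ea (k + 1); rewrite -addrA addrC.
  congr (_ + _).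
  have mQ : m = (Q + (maxn p 2).-1)%N by lia.
  pose F j := (if (j < Q)%N then par_t theta j.+1
      + (par_s theta 1 * e k ^+ 2) *+ (j == 0%N) else par_s theta (j - Q).+2)
    * (if (j < Q)%N then a (k - j%:Z) else y2 (k - (j - Q).+1%:Z)).
  transitivity (\sum_(0 <= j < m) F j); last first.
    by rewrite big_mkord; apply: eq_bigr => j _; rewrite !mxE.
  rewrite mQ [RHS](big_cat_nat (n := Q)) ?leq_addr//=.
  rewrite -{2}[Q]add0n [X in _ = _ + X]big_addn addKn.
  have -> : \sum_(0 <= j < Q) F j = par_s theta 1 * y2 k
      + \sum_(0 <= j < Q) par_t theta j.+1 * a (k - j%:Z).
    have Q0 : (0 < Q)%N by lia.
    rewrite (big_ltn Q0) [in RHS](big_ltn Q0) /F Q0 /= mulr1n subr0 addrA.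
    congr (_ + _); first by ring.
    rewrite big_nat_cond [RHS]big_nat_cond; apply: eq_bigr => j /andP[/andP[j0 jQ] _].
    by rewrite jQ gtn_eqF// mulr0n addr0.
  have -> : \sum_(0 <= j < (maxn p 2).-1) F (j + Q)%N =
      \sum_(0 <= j < (maxn p 2).-1) par_s theta j.+2 * y2 (k - j.+1%:Z).
    apply: eq_bigr => j _; rewrite /F ltnNge leq_addl /=.
    by rewrite addnK.
  rewrite -addrA addrCA [LHS]addrC; congr (_ + _).
    rewrite big_add1 /= !big_mkord.
    rewrite [RHS](sum_padded (f := fun j => par_t theta j.+1 * a (k - j%:Z)) (n := q)) ?leq_maxl//.
      by apply: eq_bigr => j _; congr (_ * a _); lia.
    by move=> j qj; rewrite par_t_out ?mul0r//; lia.
  rewrite big_add1 /= !big_mkord.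
  have -> : par_s theta 1 * y2 k + \sum_(i < (maxn p 2).-1) par_s theta i.+2 * y2 (k - i.+1%:Z) =
     \sum_(i < maxn p 2) par_s theta i.+1 * y2 (k - i%:Z).
    have -> : maxn p 2 = (maxn p 2).-1.+1 by lia.
    by rewrite big_ord_recl subr0.
  rewrite [RHS](sum_padded (f := fun j => par_s theta j.+1 * y2 (k - j%:Z)) (n := p)) ?leq_maxl//.
    by apply: eq_bigr => j _; congr (_ * (a _ * e _ ^+ 2)); lia.
  by move=> j qj; rewrite par_s_out ?mul0r//; lia.
have i1 : nat_of_ord i != 0%N by apply: contraNneq iz => H; apply/eqP/val_inj.
rewrite mulr0 addr0.
have im1 : (i.-1 < m)%N by case: i {iz} i1 => i /= im; lia.
pose j0 : 'I_m := Ordinal im1.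
have [iQ|iQ] := eqVneq (nat_of_ord i) Q.
  rewrite iQ ltnn subnn (bigD1 i0)//= [X in _ = _ + X]big1; last first.
    move=> j jz; rewrite mxE (negbTE i1) iQ eqxx.
    rewrite (negbTE (_ : nat_of_ord j != 0%N)) ?mulr0n ?mul0r//.
  have -> : garch_mx theta (e k) i i0 = e k ^+ 2 by rewrite mxE (negbTE i1) iQ eqxx.
  by rewrite state0 addr0 addrK mulrC.
rewrite (bigD1 j0)//= [X in _ = _ + X]big1; last first.
  move=> j jz; rewrite mxE (negbTE i1) (negbTE iQ).
  rewrite (negbTE (_ : nat_of_ord i != j.+1)) ?mulr0n ?mul0r//.
  by apply: contraNneq jz => H; apply/eqP/val_inj; rewrite /= H.
have -> : garch_mx theta (e k) i j0 = 1.
  by rewrite mxE (negbTE i1) (negbTE iQ) /= prednK ?lt0n// eqxx.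
rewrite mul1r addr0 mxE /=.
case: (ltnP i Q) => iq.
  by rewrite ifT; [congr (a _); lia|lia].
rewrite ifF; last by lia.
by congr (a _ * e _ ^+ 2); lia.
Qed.

Lemma state_unroll k n : state k = past_prod theta n (tshift k e) *m state (k - n%:Z)
  + par_x theta *: \sum_(0 <= i < n) past_prod theta i (tshift k e) *m delta_mx i0 ord0.
Proof.
elim: n => [|n ih].
  by rewrite past_prod0 mul1mx subr0 big_geq// scaler0 addr0.
rewrite {1}ih big_nat_recr//= scalerDr past_prodS addrA [RHS]addrAC; congr (_ + _).
have -> : k - n%:Z = k - n.+1%:Z + 1 by lia.
rewrite stateS mulmxDr mulmxA -scalemxAr; congr (_ *m garch_mx _ _ *m _ + _).
by rewrite /tshift /relabel addrC.
Qed.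

Definition past_sum n om : R := par_x theta * \sum_(0 <= i < n) past_prod theta i om i0 i0.

Lemma garch_path_unroll k n : a k = past_sum n (tshift k e)
  + \sum_j past_prod theta n (tshift k e) i0 j * state (k - n%:Z) j ord0.
Proof.
rewrite -[LHS]state0 [in LHS](state_unroll k n) mxE addrC [X in _ + X]mxE; congr (_ + _).
rewrite mxE summxE; congr (_ * _); apply: eq_bigr => i _.
rewrite mxE (bigD1 i0)//= mxE !eqxx mulr1 big1 ?addr0// => j ji.
by rewrite mxE (negbTE ji) mulr0.
Qed.

Lemma past_sum_le k n : past_sum n (tshift k e) <= a k.
Proof.
rewrite [leRHS](garch_path_unroll k n) lerDl; apply: sumr_ge0 => j _.
by rewrite mulr_ge0 ?state_ge0//; exact: (past_prod_ge0 ulo_gt0 thetaU).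
Qed.

(** Every coordinate of the remote state is dominated by its volatility. *)
Lemma past_sum_remainder k n : a k - past_sum n (tshift k e) <=
  m%:R * past_norm theta n (tshift k e) * (a (k - n%:Z) / ulo).
Proof.
rewrite {1}(garch_path_unroll k n) addrC addKr -mulrA.
apply: (@le_trans _ _ (\sum_(j < m) past_norm theta n (tshift k e) * (a (k - n%:Z) / ulo))).
  apply: ler_sum => j _; apply: ler_pM.
  - exact: (past_prod_ge0 ulo_gt0 thetaU).
  - exact: state_ge0.
  - by apply: le_trans (ler_norm _) _; exact: entry_le_opnorm.
  - by rewrite ler_pdivlMr// mulrC state_le.
by rewrite sumr_const card_ord mulr_natl.
Qed.

Definition growth : R := 1 + (p + q)%:R * (uhi / ulo).

Let uhi_ulo_ge0 : 0 <= uhi / ulo.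
Proof. by rewrite divr_ge0 ?(ltW ulo_gt0)// ltW// (lt_trans ulo_gt0). Qed.

Lemma growth_ge1 : 1 <= growth.
Proof. by rewrite lerDl mulr_ge0. Qed.

(** All but the most recent terms of the recursion already entered the previous
    volatility, with coefficients at least [ulo]. *)
Lemma garch_path_growth k : a k <= growth * (y2 (k - 1) + a (k - 1)).
Proof.
set B := y2 (k - 1) + a (k - 1).
have uhi0 : 0 <= uhi by rewrite ltW// (lt_trans ulo_gt0).
have aB : a (k - 1) <= B by rewrite lerDr.
have yB : y2 (k - 1) <= B by rewrite lerDl.
have B0 : 0 <= B by rewrite addr_ge0.
have BB : B <= B / ulo by rewrite ler_pdivlMr// ler_piMr// ltW.
have shift1 (i : nat) : (0 < i)%N -> k - i%:Z = k - 1 - (i.-1)%:Z by clear; lia.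
have [_ ->] := ea k; rewrite /growth mulrDl mul1r natrD mulrDl mulrDl -[leLHS]addrA.
apply: lerD; first exact: le_trans (garch_path_ge_x (k - 1)) aB.
have bound (c f : nat -> R) n : (forall i, (0 < i <= n)%N -> c i <= uhi) ->
    (forall i, (0 < i <= n)%N -> 0 <= f i <= B / ulo) ->
    \sum_(1 <= i < n.+1) c i * f i <= n%:R * (uhi / ulo) * B.
  move=> cu fB; apply: (@le_trans _ _ (\sum_(1 <= i < n.+1) uhi * (B / ulo))).
    rewrite big_nat_cond [leRHS]big_nat_cond; apply: ler_sum => i.
    rewrite andbT ltnS => iN; have /andP[f0 fB'] := fB _ iN.
    apply: (@le_trans _ _ (uhi * f i)); first by rewrite ler_wpM2r// cu.
    by rewrite ler_wpM2l.
  rewrite sumr_const_nat subSS subn0 -[leLHS]mulr_natl.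
  by rewrite -!mulrA (mulrC ulo^-1).
apply: lerD; apply: bound => i iN.
- by have /andP[] := par_sU thetaU iN.
- rewrite y2_ge0 /=; have [->|i1] := eqVneq i 1%N; first exact: le_trans yB BB.
  rewrite ler_pdivlMr// mulrC shift1; last by clear -iN; lia.
  by apply: le_trans (garch_path_ge_y2 _ _) aB; clear -iN i1; lia.
- by have /andP[] := par_tU thetaU iN.
- rewrite a_ge0 /=; have [->|i1] := eqVneq i 1%N; first exact: le_trans aB BB.
  rewrite ler_pdivlMr// mulrC shift1; last by clear -iN; lia.
  by apply: le_trans (garch_path_ge_a _ _) aB; clear -iN i1; lia.
Qed.

Lemma garch_path_growthX k n :
  a k <= growth ^+ n * (\sum_(1 <= i < n.+1) y2 (k - i%:Z) + a (k - n%:Z)).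
Proof.
have g1 := growth_ge1; have g0 : 0 <= growth by exact: le_trans g1.
elim: n => [|n ih]; first by rewrite big_geq// expr0 mul1r add0r subr0.
apply: le_trans ih _; rewrite exprSr -mulrA ler_wpM2l ?exprn_ge0//.
rewrite [in leRHS]big_nat_recr//= -addrA mulrDr; apply: lerD.
  by rewrite ler_peMl// sumr_ge0.
have -> : k - n.+1%:Z = k - n%:Z - 1 by clear; lia.
exact: garch_path_growth.
Qed.

Lemma garch_path_geX k n : ulo ^+ n * a (k - n%:Z) <= a k.
Proof.
elim: n => [|n ih]; first by rewrite expr0 mul1r subr0.
apply: le_trans ih; rewrite exprSr -mulrA ler_wpM2l ?exprn_ge0 ?(ltW ulo_gt0)//.
have -> : k - n.+1%:Z = k - n%:Z - 1%:Z by clear; lia.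
exact: garch_path_ge_a.
Qed.

(** Going back [n] steps costs the factor [growth ^+ n] and leaves the
    observations of these steps together with the volatility [a (k - n)]. The
    latter is at most a constant times each of the later volatilities, which are
    the ratios of [y2] to [e ^+ 2]: it is controlled by the observations unless
    all recent innovations are small. *)
Lemma garch_path_ratio k n W : 0 < \sum_(1 <= i < n.+1) e (k - i%:Z) ^+ 2 ->
  ulo ^+ n * \sum_(1 <= i < n.+1) y2 (k - i%:Z) <= W ->
  a k <= (growth / ulo ^+ 2) ^+ n *
    (1 + (\sum_(1 <= i < n.+1) e (k - i%:Z) ^+ 2)^-1) * W.
Proof.
set E2 := \sum_(_ <= _ < _) _; set Y := \sum_(_ <= _ < _) _ => E0 YW.
have un0 : 0 < ulo ^+ n by rewrite exprn_gt0.
have Y0 : 0 <= Y by rewrite sumr_ge0.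
have g0 : 0 <= growth ^+ n by rewrite exprn_ge0// (le_trans ler01)// growth_ge1.
have aY : a (k - n%:Z) <= Y / (ulo ^+ n * E2).
  rewrite ler_pdivlMr ?mulr_gt0// mulrA mulr_sumr /Y.
  rewrite big_nat_cond [leRHS]big_nat_cond; apply: ler_sum => i.
  rewrite andbT ltnS => /andP[i1 iN]; rewrite ler_wpM2r ?sqr_ge0//.
  apply: le_trans (garch_path_geX _ (n - i)).
  have -> : k - i%:Z - (n - i)%:Z = k - n%:Z by clear -iN; lia.
  rewrite mulrC ler_wpM2r// ler_wiXn2l ?(ltW ulo_gt0) ?(ltW ulo_lt1)//.
  exact: leq_subr.
apply: le_trans (garch_path_growthX k n) _; rewrite -/Y.
rewrite -!mulrA exprMn -mulrA ler_wpM2l//.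
apply: (@le_trans _ _ (ulo ^- n * ((1 + E2^-1) * Y))).
  rewrite mulrA mulrDr mulr1 mulrDl; apply: lerD.
    by rewrite ler_peMl// invf_ge1// exprn_ile1// ltW.
  by apply: le_trans aY _; rewrite invfM mulrC.
rewrite exprVn -exprM mulnC exprM expr2 invfM -mulrA ler_wpM2l ?invr_ge0 ?(ltW un0)//.
rewrite mulrCA ler_wpM2l ?addr_ge0 ?invr_ge0 ?(ltW E0)//.
by rewrite mulrC ler_pdivlMr// mulrC.
Qed.

Section Representation.
Variables rho kap : R.
Hypothesis rho_gt0 : 0 < rho.
Hypothesis rho_lt1 : rho < 1.
Hypothesis rho0_ge0 : 0 <= rho0.
Hypothesis rho0_lt1 : rho0 < 1.
Hypothesis kap_gt : rho0 < kap.
Hypothesis kap_rho : kap <= rho ^+ q.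
Local Notation c := (ccoef theta).

Definition repr_const : R :=
  (q%:R * (uhi * (1 + uhi / (1 - rho0)) / ulo) + p%:R * (uhi / ulo))
  * rho ^- (p + q) * geom_gain rho0 kap.

Let c0E : c 0 = par_x theta + \sum_(1 <= j < q.+1) par_t theta j * c 0.
Proof.
have gap : 0 < 1 - \sum_(1 <= j < q.+1) par_t theta j.
  by apply: lt_le_trans (c0_gap thetaU); rewrite subr_gt0.
rewrite -mulr_suml /ccoef; field; by rewrite gt_eqF.
Qed.

Let sum_out (f b : nat -> R) n M : (n < M)%N -> (forall i, (n < i)%N -> f i = 0) ->
  \sum_(1 <= i < n.+1) f i * b i = \sum_(1 <= i < M) f i * b i.
Proof.
move=> nM f0; rewrite [RHS](big_cat_nat (n := n.+1))//= [X in _ = _ + X]big_nat_cond.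
rewrite [X in _ = _ + X]big1 ?addr0// => i /andP[/andP[ni _] _].
by rewrite f0 ?mul0r.
Qed.

Let cE i : (0 < i)%N -> c i = par_s theta i + \sum_(1 <= j < i) par_t theta j * c (i - j).
Proof.
move=> i0; rewrite ccoefE//; congr (_ + _).
  by case: leqP => // pi; rewrite mulr0n par_s_out//; clear -pi; lia.
rewrite [RHS](big_cat_nat (n := (minn q i.-1).+1))//=; last by clear -i0; lia.
rewrite [X in _ = _ + X]big_nat_cond [X in _ = _ + X]big1 ?addr0//.
move=> j /andP[/andP[j1 j2] _]; rewrite par_t_out ?mul0r//; clear -j1 j2 i0; lia.
Qed.

(** The error made when [a k] is represented by the last observations only. *)
Let defect k i := a k - c 0 - \sum_(1 <= l < i) c l * y2 (k - l%:Z).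

(** The representations of the volatilities on the right-hand side of the
    recursion reassemble that of [a k], by the recursion of the coefficients. *)
Let defect_rec k i M : (0 < i <= M)%N -> (p < M)%N -> (q < M)%N ->
  defect k i = \sum_(1 <= j < i) par_t theta j * defect (k - j%:Z) (i - j)
   + (\sum_(i <= j < M) par_t theta j * (a (k - j%:Z) - c 0)
      + \sum_(i <= l < M) par_s theta l * y2 (k - l%:Z)).
Proof.
move=> /andP[i0 iM] pM qM.
have := c0E; rewrite /defect; move: (c 0) => z zE.
have -> : a k - z - \sum_(1 <= l < i) c l * y2 (k - l%:Z) =
    \sum_(1 <= j < M) par_t theta j * (a (k - j%:Z) - z)
    + \sum_(1 <= l < M) par_s theta l * y2 (k - l%:Z)
    - \sum_(1 <= l < i) c l * y2 (k - l%:Z).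
  congr (_ - _); have [_ {1}->] := ea k; rewrite {1}zE.
  rewrite -(sum_out (fun j => a (k - j%:Z) - z) qM); last first.
    by move=> j qj; rewrite par_t_out//; clear -qj; lia.
  rewrite -(sum_out (fun j => y2 (k - j%:Z)) pM); last first.
    by move=> j qj; rewrite par_s_out//; clear -qj; lia.
  under [X in _ = X + _]eq_bigr do rewrite mulrBr; rewrite sumrB.
  by ring.
rewrite (big_cat_nat (n := i) i0 iM) /= [X in _ + X - _](big_cat_nat (n := i) i0 iM) /=.
have -> : \sum_(1 <= j < i) par_t theta j * (a (k - j%:Z) - z
      - \sum_(1 <= l < i - j) c l * y2 (k - j%:Z - l%:Z)) =
    \sum_(1 <= j < i) par_t theta j * (a (k - j%:Z) - z)
    - \sum_(1 <= j < i) par_t theta j *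
        \sum_(1 <= l < i - j) c l * y2 (k - j%:Z - l%:Z).
  by rewrite -sumrB; apply: eq_bigr => j _; rewrite -mulrBr.
have -> : \sum_(1 <= l < i) c l * y2 (k - l%:Z) =
   \sum_(1 <= l < i) par_s theta l * y2 (k - l%:Z) +
   \sum_(1 <= j < i) par_t theta j *
        \sum_(1 <= l < i - j) c l * y2 (k - j%:Z - l%:Z).
  transitivity (\sum_(1 <= l < i) (par_s theta l * y2 (k - l%:Z) +
      \sum_(1 <= j < i | (j < l)%N) par_t theta j * c (l - j) * y2 (k - l%:Z))).
    rewrite big_nat_cond [RHS]big_nat_cond; apply: eq_bigr => l.
    rewrite andbT => /andP[l1 li]; rewrite cE// mulrDl mulr_suml; congr (_ + _).
    by rewrite [LHS](big_nat_widen _ _ i)// ltnW.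
  rewrite big_split /=; congr (_ + _).
  rewrite (exchange_big_dep_nat xpredT)//= big_nat_cond [RHS]big_nat_cond.
  apply: eq_bigr => j; rewrite andbT => /andP[j1 ji]; rewrite mulr_sumr.
  rewrite [RHS](_ : _ = \sum_(1 + j <= l < i) par_t theta j * (c (l - j) * y2 (k - l%:Z))).
    rewrite [RHS](big_nat_widenl _ 1)//=.
    by apply: eq_big => [l|l _]; [rewrite add1n|rewrite -mulrA].
  rewrite big_addn; apply: eq_bigr => l _; rewrite addnK.
  by congr (_ * (_ * (a _ * e _ ^+ 2))); clear; lia.
by ring.
Qed.

(** The defects satisfy the recursion of the coefficients, with a source at the
    first [maxn p q] indices only: they decay at the same geometric rate. *)
Lemma garch_path_repr k n :
  `|a k - c 0 - \sum_(1 <= l < n.+1) c l * y2 (k - l%:Z)| <=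
    repr_const * a (k - n%:Z) * rho ^+ n.+1.
Proof.
pose k0 := k - n.+1%:Z; pose A := a (k - n%:Z).
have AE : A = a (k0 + 1) by rewrite /A /k0; congr a; clear; lia.
pose K := q%:R * (uhi * (1 + uhi / (1 - rho0)) / ulo) + p%:R * (uhi / ulo).
have uhi0 : 0 <= uhi by rewrite ltW// (lt_trans ulo_gt0).
have r0 : 0 < 1 - rho0 by rewrite subr_gt0.
have c00 : 0 <= c 0 by apply: le_trans (ltW ulo_gt0) _; exact: (c0_ge ulo_gt0 rho0_lt1 thetaU).
have K1 : 0 <= uhi * (1 + uhi / (1 - rho0)) / ulo.
  by rewrite divr_ge0 ?(ltW ulo_gt0)// mulr_ge0// addr_ge0// divr_ge0// ltW.
have K0 : 0 <= K by rewrite addr_ge0// mulr_ge0.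
have A0 : 0 <= A := a_ge0 _.
have rec i : (0 < i)%N -> `|defect (k0 + i%:Z) i| <= K * A * rho ^- (p + q) * rho ^+ i
    + \sum_(1 <= j < (minn q i.-1).+1) par_t theta j * `|defect (k0 + (i - j)%:Z) (i - j)|.
  move=> i0; pose M := (i + p + q).+1.
  have [iM pM qM] : [/\ (0 < i <= M)%N, (p < M)%N & (q < M)%N].
    by rewrite /M; clear -i0; split; lia.
  rewrite (defect_rec _ iM pM qM).
  rewrite addrC; apply: le_trans (ler_normD _ _) _; apply: lerD; last first.
    apply: le_trans (ler_norm_sum _ _ _) _.
    rewrite (big_cat_nat (n := (minn q i.-1).+1))//=; last by clear -i0; lia.
    rewrite [X in _ + X]big_nat_cond [X in _ + X]big1 ?addr0; last first.
      move=> j /andP[/andP[j1 j2] _]; rewrite par_t_out ?mul0r ?normr0//.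
      by clear -j1 j2 i0; lia.
    rewrite big_nat_cond [leRHS]big_nat_cond; apply: ler_sum => j.
    rewrite andbT => /andP[j1 j2]; rewrite normrM ger0_norm//.
    have -> : k0 + i%:Z - j%:Z = k0 + (i - j)%:Z.
      by apply: int_lag_sub; clear -j2; lia.
    by [].
  have tail (f b : nat -> R) (m' : nat) (B : R) : (m' < M)%N -> 0 <= B ->
      (forall j, (m' < j)%N -> f j = 0) -> (forall j, 0 <= f j <= uhi) ->
      (forall j, (i <= j <= m')%N -> `|b j| <= B) ->
      `|\sum_(i <= j < M) f j * b j| <= m'%:R * (uhi * B) * (i <= m')%:R.
    move=> mM B0 f0 fu bB; case: (leqP i m') => im; last first.
      rewrite mulr0 big_nat_cond big1 ?normr0// => j /andP[/andP[ij _] _].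
      by rewrite f0 ?mul0r// (leq_trans im).
    rewrite mulr1 (big_cat_nat (n := m'.+1))//=; last exact: leqW.
    rewrite [X in _ + X]big_nat_cond [X in _ + X]big1 ?addr0; last first.
      by move=> j /andP[/andP[ij _] _]; rewrite f0 ?mul0r.
    apply: le_trans (ler_norm_sum _ _ _) _.
    apply: (@le_trans _ _ (\sum_(i <= j < m'.+1) uhi * B)).
      rewrite big_nat_cond [leRHS]big_nat_cond; apply: ler_sum => j.
      rewrite andbT ltnS => ij; have /andP[fj0 fju] := fu j.
      by rewrite normrM ger0_norm// ler_pM// bB.
    rewrite sumr_const_nat -[leLHS]mulr_natl ler_wpM2r ?mulr_ge0// ler_nat.
    by clear -i0; lia.
  have near_a j : (i <= j <= q)%N -> a (k0 + i%:Z - j%:Z) <= A / ulo.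
    move=> ij; rewrite ler_pdivlMr// mulrC AE.
    have -> : k0 + i%:Z - j%:Z = k0 + 1 - (j - i).+1%:Z.
      by apply: int_lag_add1; clear -ij; lia.
    by apply: garch_path_ge_a; clear -ij i0; lia.
  have near_y j : (i <= j <= p)%N -> y2 (k0 + i%:Z - j%:Z) <= A / ulo.
    move=> ij; rewrite ler_pdivlMr// mulrC AE.
    have -> : k0 + i%:Z - j%:Z = k0 + 1 - (j - i).+1%:Z.
      by apply: int_lag_add1; clear -ij; lia.
    by apply: garch_path_ge_y2; clear -ij i0; lia.
  have Au0 : 0 <= A / ulo by rewrite divr_ge0// ltW.
  have c0A : c 0 <= uhi / (1 - rho0) * (A / ulo).
    apply: le_trans (c0_le ulo_gt0 rho0_lt1 thetaU) _.
    by rewrite ler_peMr ?divr_ge0// ?(ltW r0)// ler_pdivlMr// mul1r garch_path_ge.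
  have B0 : 0 <= (1 + uhi / (1 - rho0)) * (A / ulo).
    by rewrite mulr_ge0// addr_ge0// divr_ge0// ltW.
  have t1 := @tail (par_t theta) (fun j => a (k0 + i%:Z - j%:Z) - c 0) q
    ((1 + uhi / (1 - rho0)) * (A / ulo)).
  have t2 := @tail (par_s theta) (fun j => y2 (k0 + i%:Z - j%:Z)) p (A / ulo).
  have ind (m' : nat) : (m' <= p + q)%N -> (i <= m')%:R <= rho ^- (p + q) * rho ^+ i.
    move=> mpq; case: (leqP i m') => im; last first.
      by rewrite mulr_ge0 ?invr_ge0 ?exprn_ge0// ltW.
    rewrite mulrC ler_pdivlMr ?exprn_gt0// mul1r.
    by rewrite ler_wiXn2l ?(ltW rho_gt0) ?(ltW rho_lt1)//; clear -im mpq; lia.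
  apply: le_trans (ler_normD _ _) _.
  have -> : K * A * rho ^- (p + q) * rho ^+ i =
     q%:R * (uhi * ((1 + uhi / (1 - rho0)) * (A / ulo))) * (rho ^- (p + q) * rho ^+ i)
     + p%:R * (uhi * (A / ulo)) * (rho ^- (p + q) * rho ^+ i).
    by rewrite /K; ring.
  apply: lerD.
    apply: le_trans (t1 _ _ _ _ _) _ => //.
    - by move=> j qj; rewrite par_t_out//; clear -qj; lia.
    - move=> j; rewrite t_ge0 /=; have [jq|jq] := boolP (0 < j <= q)%N.
        by have /andP[] := par_tU thetaU jq.
      by rewrite par_t_out.
    - move=> j ij; apply: le_trans (ler_normB _ _) _.
      by rewrite !ger0_norm// mulrDl mul1r lerD// near_a.
    by apply: ler_wpM2l; [do 2!apply: mulr_ge0 => //|exact: ind (leq_addl _ _)].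
  apply: le_trans (t2 _ _ _ _ _) _ => //.
  - by move=> j qj; rewrite par_s_out//; clear -qj; lia.
  - move=> j; rewrite s_ge0 /=; have [jq|jq] := boolP (0 < j <= p)%N.
      by have /andP[] := par_sU thetaU jq.
    by rewrite par_s_out.
  - by move=> j ij; rewrite ger0_norm// near_y.
  by apply: ler_wpM2l; [do 2!apply: mulr_ge0 => //|exact: ind (leq_addr _ _)].
have KA0 : 0 <= K * A * rho ^- (p + q).
  by rewrite !mulr_ge0// invr_ge0 exprn_ge0// ltW.
have := geom_recursion rho_gt0 rho_lt1 rho0_ge0 kap_gt kap_rho
  (t := par_t theta) (fun j _ => t_ge0 j) (proj1 thetaU) KA0 rec (ltn0Sn n).
rewrite /k0 subrK => H; apply: le_trans H _.
suff -> : repr_const * a (k - n%:Z) = K * A * rho ^- (p + q) * geom_gain rho0 kap by [].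
by rewrite /repr_const -/K -/A; ring.
Qed.

End Representation.

End GarchPath.

(** * The stationary volatility as a functional of the innovations *)

Section InfiniteSums.
Variable R : realType.
Implicit Types b : nat -> R.

(** The sum of a series of nonnegative terms, [0] when it diverges. *)
Definition rsum b : R := fine (\sum_(0 <= i <oo) (b i)%:E)%E.

Lemma rsum_le b (M : R) : (forall i, 0 <= b i) ->
  (forall n, \sum_(0 <= i < n) b i <= M) -> rsum b <= M.
Proof.
move=> b0 bM; have M0 : 0 <= M by have := bM 0%N; rewrite big_geq.
have : (\sum_(0 <= i <oo) (b i)%:E <= M%:E)%E.
  apply: lime_le; first by apply: is_cvg_nneseries => k _ _; rewrite lee_fin.
  by apply: nearW => n; rewrite sumEFin lee_fin.
rewrite /rsum; case: (\sum_(_ <= _ <oo) _)%E => [r||] //=.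
Qed.

Lemma rsum_fin_ge b n : (forall i, 0 <= b i) ->
  (\sum_(0 <= i <oo) (b i)%:E < +oo)%E -> \sum_(0 <= i < n) b i <= rsum b.
Proof.
move=> b0 bfin; rewrite -lee_fin /rsum fineK; last first.
  by rewrite ge0_fin_numE// nneseries_ge0// => i _ _; rewrite lee_fin.
by rewrite -sumEFin; apply: nneseries_lim_ge => i _ _; rewrite lee_fin.
Qed.

Lemma rsum_ge b (M : R) n : (forall i, 0 <= b i) ->
  (forall n, \sum_(0 <= i < n) b i <= M) -> \sum_(0 <= i < n) b i <= rsum b.
Proof.
move=> b0 bM; apply: rsum_fin_ge => //; apply: (@le_lt_trans _ _ M%:E); last exact: ltry.
apply: lime_le; first by apply: is_cvg_nneseries => k _ _; rewrite lee_fin.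
by apply: nearW => k; rewrite sumEFin lee_fin.
Qed.

Lemma rsum_ge0 b : (forall i, 0 <= b i) -> 0 <= rsum b.
Proof. by move=> b0; apply: fine_ge0; apply: nneseries_ge0 => i _ _; rewrite lee_fin. Qed.

Lemma rsum_lee b : (forall i, 0 <= b i) ->
  ((rsum b)%:E <= \sum_(0 <= i <oo) (b i)%:E)%E.
Proof.
move=> b0; rewrite /rsum.
have : (0 <= \sum_(0 <= i <oo) (b i)%:E)%E.
  by apply: nneseries_ge0 => i _ _; rewrite lee_fin.
by case: (\sum_(_ <= _ <oo) _)%E => [r||] //= _; rewrite leey.
Qed.

Lemma measurable_nneseries d (T : measurableType d) (f : nat -> T -> R) :
  (forall i t, 0 <= f i t) -> (forall i, measurable_fun setT (f i)) ->
  measurable_fun setT (fun t => \sum_(0 <= i <oo) (f i t)%:E)%E.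
Proof.
move=> f0 mf.
apply: (ge0_emeasurable_sum (h := fun i t => (f i t)%:E) (P := xpredT)).
  by move=> k x _ _; rewrite lee_fin.
by move=> k _; apply/measurable_EFinP.
Qed.

Lemma measurable_rsum d (T : measurableType d) (f : nat -> T -> R) :
  (forall i t, 0 <= f i t) -> (forall i, measurable_fun setT (f i)) ->
  measurable_fun setT (fun t => rsum (fun i => f i t)).
Proof.
by move=> f0 mf; apply: measurableT_comp => //; exact: measurable_nneseries.
Qed.

Lemma powRD_le (x y s : R) : 0 <= x -> 0 <= y -> 0 < s -> s <= 1 ->
  (x + y) `^ s <= x `^ s + y `^ s.
Proof.
move=> x0 y0 s0 s1; have [xy|xy] := eqVneq (x + y) 0.
  by rewrite xy powR0 ?gt_eqF// addr_ge0 ?powR_ge0.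
have xy0 : 0 < x + y by rewrite lt0r xy addr_ge0.
have part z : 0 <= z -> z <= x + y -> z / (x + y) * (x + y) `^ s <= z `^ s.
  move=> z0 zxy; have [->|zn] := eqVneq z 0; first by rewrite !mul0r powR_ge0.
  have zp : 0 < z by rewrite lt0r zn.
  have -> : z `^ s = (z / (x + y)) `^ s * (x + y) `^ s.
    by rewrite -powRM ?divr_ge0 ?(ltW xy0)// divfK.
  rewrite ler_wpM2r ?powR_ge0//; apply: ger1_powR => //.
  by rewrite divr_gt0//= ler_pdivrMr// mul1r.
have -> : (x + y) `^ s = x / (x + y) * (x + y) `^ s + y / (x + y) * (x + y) `^ s.
  by rewrite -mulrDl -mulrDl divff// mul1r.
by apply: lerD; apply: part => //; rewrite ?lerDl ?lerDr.
Qed.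

Lemma powR_sum_le b s n : (forall i, 0 <= b i) -> 0 < s -> s <= 1 ->
  (\sum_(0 <= i < n) b i) `^ s <= \sum_(0 <= i < n) b i `^ s.
Proof.
move=> b0 s0 s1; elim: n => [|n ih]; first by rewrite !big_geq// powR0 ?gt_eqF.
rewrite !big_nat_recr//=; apply: le_trans (powRD_le _ _ s0 s1) _ => //.
  exact: sumr_ge0.
by rewrite lerD2r.
Qed.

Lemma powR_rsum_le b s : (forall i, 0 <= b i) -> 0 < s -> s <= 1 ->
  ((rsum b `^ s)%:E <= \sum_(0 <= i <oo) (b i `^ s)%:E)%E.
Proof.
move=> b0 s0 s1.
have [fin|] := ltP (\sum_(0 <= i <oo) (b i `^ s)%:E)%E +oo%E; last first.
  by rewrite leye_eq => /eqP ->; rewrite leey.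
set r := rsum (fun i => b i `^ s).
have -> : (\sum_(0 <= i <oo) (b i `^ s)%:E)%E = r%:E.
  rewrite /r /rsum fineK// ge0_fin_numE// nneseries_ge0// => i _ _.
  by rewrite lee_fin powR_ge0.
have r0 : 0 <= r by apply: rsum_ge0 => i; exact: powR_ge0.
have sV0 : 0 <= s^-1 by rewrite invr_ge0 ltW.
have H : rsum b <= r `^ s^-1.
  apply: rsum_le => // n.
  have S0 : 0 <= \sum_(0 <= i < n) b i by exact: sumr_ge0.
  rewrite -[leLHS]powRr1// -(divff (lt0r_neq0 s0)) powRrM.
  apply: ge0_ler_powR => //; rewrite ?nnegrE ?powR_ge0//.
  apply: le_trans (powR_sum_le _ b0 s0 s1) _.
  by apply: rsum_fin_ge => // i; exact: powR_ge0.
rewrite lee_fin.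
have -> : r = (r `^ s^-1) `^ s by rewrite -powRrM mulVf ?gt_eqF// powRr1.
by apply: ge0_ler_powR; rewrite ?nnegrE ?powR_ge0 ?rsum_ge0// ltW.
Qed.

End InfiniteSums.

Lemma ae_forallZ d (T : measurableType d) (R : realType) (mu : {measure set T -> \bar R})
    (A : int -> T -> Prop) :
  (forall k, {ae mu, forall w, A k w}) -> {ae mu, forall w, forall k, A k w}.
Proof.
move=> H; have H1 := ae_foralln (fun n => H (Posz n)).
have H2 := ae_foralln (fun n => H (Negz n)).
by apply: filterS2 H1 H2 => w A1 A2 [n|n].
Qed.

Lemma measurable_gt d (T : measurableType d) (R : realType) (F : T -> R) (c : R) :
  measurable_fun setT F -> measurable (setT `&` [set t | c < F t]).
Proof.
move=> mF; rewrite (_ : [set t | c < F t] = F @^-1` `]c, +oo[%classic); first exact: mF.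
by apply/seteqP; split=> t /=; rewrite in_itv/= andbT.
Qed.

Lemma markov_ge d (T : measurableType d) (R : realType) (mu : {measure set T -> \bar R})
    (F : T -> R) (c : R) : measurable_fun setT F -> (forall t, 0 <= F t) -> 0 <= c ->
  (c%:E * mu [set t | (c <= F t)%R] <= \int[mu]_t (F t)%:E)%E.
Proof.
move=> mF F0 c0.
have mA : measurable [set t | c <= F t].
  by rewrite -[X in measurable X]setTI; exact: measurable_fun_le.
rewrite -integral_cst//.
apply: (@le_trans _ _ (\int[mu]_(t in [set t | (c <= F t)%R]) (F t)%:E)%E).
  apply: ge0_le_integral => //.
  - by apply: measurable_funTS; exact/measurable_EFinP.
apply: ge0_subset_integral => //; first exact/measurable_EFinP.
by move=> t _; rewrite lee_fin.
Qed.

Section StationaryVolatility.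
Context (R : realType) (p q : nat) (theta : 'rV[R]_(1 + p + q)).
Variables ulo uhi rho0 : R.
Hypothesis q_gt0 : (0 < q)%N.
Hypothesis p_gt0 : (0 < p)%N.
Hypothesis ulo_gt0 : 0 < ulo.
Hypothesis ulo_lt1 : ulo < 1.
Hypothesis ulohi : ulo < uhi.
Hypothesis thetaU : param_set ulo uhi rho0 theta.
Context d (T : measurableType d) (P : probability T R).
Variable eps : int -> {RV P >-> R}.
Hypothesis eps_iid : iid eps.
Local Notation path := (seqpath eps).
Variable s : R.
Hypothesis s_gt0 : 0 < s.
Hypothesis s_le1 : s <= 1.
Hypothesis s_sum : (\sum_(0 <= k <oo) past_moment theta eps s k < +oo)%E.
Local Notation m := (maxn p 2 + maxn q 2).-1.
Local Notation i0 := (garch_idx0 p q).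
Local Notation N := (past_norm theta).

(** The stationary squared volatility at time [0] as a functional of the past
    innovations. *)
Definition sig2 (om : seqspace R) : R :=
  rsum (fun n => par_x theta * past_prod theta n om i0 i0).

Let x_ge0 : 0 <= par_x theta.
Proof. by have /andP[H _] := par_xU thetaU; apply: le_trans (ltW ulo_gt0) H. Qed.

Let term_ge0 om n : 0 <= par_x theta * past_prod theta n om i0 i0.
Proof. by rewrite mulr_ge0//; exact: (past_prod_ge0 ulo_gt0 thetaU). Qed.

Lemma sig2_ge0 om : 0 <= sig2 om.
Proof. exact: rsum_ge0. Qed.

Lemma measurable_sig2 : measurable_fun setT sig2.
Proof.
apply: measurable_rsum => [i om|i]; first exact: term_ge0.
by apply: measurable_funM => //; exact: measurable_past_prod.
Qed.

Lemma sig2_depends : depends_on (fun k : int => k < 0) sig2.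
Proof.
move=> om om' H; rewrite /sig2; congr rsum; apply/funext => n.
rewrite (_ : past_prod theta n om = past_prod theta n om')//.
by apply: past_prod_depends => k /andP[_ k0]; exact: H.
Qed.

Let past_sumE n om :
  past_sum theta n om = \sum_(0 <= i < n) par_x theta * past_prod theta i om i0 i0.
Proof. by rewrite /past_sum mulr_sumr. Qed.

Let mpath : measurable_fun setT path. Proof. exact: measurable_seqpath. Qed.

Section Volatility.
Variable a : int -> T -> R.
Hypothesis ma : forall k, measurable_fun setT (a k).
Hypothesis a_path : {ae P, forall w, garch_path theta (path w) (a ^~ w)}.
Hypothesis a_tight : forall k K, P [set w | K < a k w] = P [set w | K < a 0 w].

Let far (k : int) (eta : R) : set T :=
  \bigcap_n [set w | past_sum theta n (tshift k (path w)) <= a k w - eta].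

Let mpast_sum n k : measurable_fun setT (fun w => past_sum theta n (tshift k (path w))).
Proof.
apply: (measurableT_comp (f := past_sum theta n)); last first.
  by apply: measurableT_comp mpath; exact: measurable_tshift.
by apply: measurable_funM => //; apply: measurable_sum => i; exact: measurable_past_prod.
Qed.

Let mfar k eta : measurable (far k eta).
Proof.
apply: bigcap_measurable => // n _; rewrite -[X in measurable X]setTI.
apply: measurable_fun_le => //; exact: measurable_funB.
Qed.

Let tail_small (e : R) : 0 < e -> exists K : R, 0 < K /\ (P [set w | (K < a 0 w)%R] <= e%:E)%E.
Proof.
move=> e0; pose F (n : nat) := [set w | n.+1%:R < a 0 w].
have mF n : measurable (F n).
  by rewrite -[X in measurable X]setTI; exact: measurable_gt.
have F0 : \bigcap_n F n = set0.
  apply/seteqP; split=> // w H; have := H (Num.bound (a 0 w)) I.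
  rewrite /F /= ltNge => /negP; apply.
  apply: le_trans (ler_norm _) _; apply: le_trans (ltW (archi_boundP (normr_ge0 _))) _.
  rewrite ler_nat; apply: leqW; rewrite /Num.bound.
  by rewrite normr_id.
have : (P \o F) x @[x --> \oo] --> P (\bigcap_n F n).
  apply: nonincreasing_cvg_mu => //.
  - by apply: le_lt_trans (probability_le1 _ _) _; rewrite ?ltry.
  - by rewrite F0.
  - move=> n k nk; apply/subsetPset => w; rewrite /F /=; apply: le_lt_trans.
    by rewrite ler_nat.
rewrite F0 measure0 => /fine_cvgP[_ /cvgrPdist_le /(_ _ e0)].
move=> [n _ /(_ _ (leqnn n))] /=; rewrite sub0r normrN => H.
exists n.+1%:R; split=> //; rewrite -[P _]fineK ?fin_num_measure//; last exact: mF.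
by rewrite lee_fin; apply: le_trans H; exact: ler_norm.
Qed.

Let moment_small (e : R) : 0 < e -> exists n, (past_moment theta eps s n <= e%:E)%E.
Proof.
move=> e0; apply: contrapT => /forallNP H.
pose S := fine (\sum_(0 <= k <oo) past_moment theta eps s k)%E.
have SE : (\sum_(0 <= k <oo) past_moment theta eps s k = S%:E)%E.
  by rewrite fineK// ge0_fin_numE// nneseries_ge0// => i _ _; exact: past_moment_ge0.
pose n := Num.bound (S / e).
have nS : S < n%:R * e.
  rewrite -ltr_pdivrMr//; apply: le_lt_trans (ler_norm _) _.
  by apply: lt_le_trans (archi_boundP (normr_ge0 _)) _; rewrite ler_nat /n /Num.bound normr_id.
have : ((n%:R * e)%:E <= S%:E)%E.
  rewrite -SE; apply: le_trans (nneseries_lim_ge n _); last first.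
    by move=> i _ _; exact: past_moment_ge0.
  rewrite -(_ : (\sum_(0 <= i < n) e%:E = (n%:R * e)%:E)%E); last first.
    by rewrite sumEFin sumr_const_nat subn0 mulr_natl.
  by apply: lee_sum => i _; apply/ltW; rewrite ltNge; apply/negP; exact: H.
by rewrite lee_fin leNgt nS.
Qed.

(** The remainder after [n] steps is at most a constant times [N_n a_(k-n)]: by
    stationarity the second factor is tight, and the first one tends to [0] in
    probability because its moments are summable. *)
Let far0 k eta : 0 < eta -> P (far k eta) = 0%E.
Proof.
move=> eta0; apply/eqP; rewrite eq_le measure_ge0 andbT.
apply/lee_addgt0Pr => e e0; rewrite add0e.
have e20 : 0 < e / 2 by rewrite divr_gt0.
have [K [K0 PK]] := tail_small e20.
have m0 : 0 < m%:R :> R by rewrite ltr0n; exact: garch_size_gt0.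
pose c := (eta * ulo / (m%:R * K)) `^ s.
have c0 : 0 < c by rewrite powR_gt0// divr_gt0 ?mulr_gt0.
have [n Xn] := moment_small (mulr_gt0 c0 e20).
pose F w := N n (tshift k (path w)) `^ s.
have N0 om : 0 < N n om by exact: (past_norm_gt0 (ulo := ulo) (uhi := uhi) (rho0 := rho0)).
have mF : measurable_fun setT F.
  apply: (measurableT_comp (measurable_powR s)).
  apply: (measurableT_comp (measurable_past_norm theta n)).
  by apply: measurableT_comp mpath; exact: measurable_tshift.
have PF : (P [set w | (c <= F w)%R] <= (e / 2)%:E)%E.
  have F0 w : 0 <= F w by exact: powR_ge0.
  have EF : (\int[P]_w (F w)%:E = past_moment theta eps s n)%E.
    rewrite past_momentE; apply: (expect_tshift eps_iid k (F := fun om => (N n om `^ s)%:E)).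
      exact: measurable_normpow.
    by move=> om; rewrite lee_fin powR_ge0.
  have := le_trans (@markov_ge _ _ _ P F c mF F0 (ltW c0)) (_ : (_ <= (c * (e / 2))%:E)%E).
  rewrite EF => /(_ Xn); rewrite EFinM lee_pmul2l//.
have [Z [mZ Z0 subZ]] := a_path.
have mA : measurable [set w | K < a (k - n%:Z) w].
  by rewrite -[X in measurable X]setTI; exact: measurable_gt.
have mB : measurable [set w | c <= F w].
  by rewrite -[X in measurable X]setTI; exact: measurable_fun_le.
apply: (@le_trans _ _ (P (Z `|` ([set w | K < a (k - n%:Z) w] `|` [set w | c <= F w])))).
  apply: le_measure; rewrite ?inE//; first by do 2!apply: measurableU => //.
  move=> w farw; have [Zw|nZ] := pselect (Z w); first by left.
  right; have gp : garch_path theta (path w) (a ^~ w).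
    by apply: contrapT => ng; apply: nZ; exact: subZ.
  have [aK|aK] := ltP K (a (k - n%:Z) w); [by left|right].
  have r1 : a k w - past_sum theta n (tshift k (path w)) <=
      m%:R * N n (tshift k (path w)) * (a (k - n%:Z) w / ulo).
    exact: (past_sum_remainder q_gt0 p_gt0 ulo_gt0 ulo_lt1 ulohi thetaU gp).
  have r2 : eta <= a k w - past_sum theta n (tshift k (path w)).
    by have := farw n I; rewrite /= => H; rewrite lerBrDr addrC -lerBrDr.
  have r3 : eta <= m%:R * N n (tshift k (path w)) * (K / ulo).
    apply: le_trans (le_trans r2 r1) _; rewrite ler_wpM2l//.
      by rewrite mulr_ge0// ltW.
    by rewrite ler_wpM2r// invr_ge0 ltW.
  rewrite /= /c /F; apply: ge0_ler_powR; rewrite ?nnegrE ?(ltW s_gt0) ?(ltW (N0 _))//.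
    by rewrite ltW// divr_gt0 ?mulr_gt0.
  rewrite ler_pdivrMr ?mulr_gt0// -ler_pdivlMr//.
  by apply: le_trans r3 _; rewrite le_eqVlt; apply/orP; left; apply/eqP; ring.
apply: le_trans (measureU2 _ mZ _) _; first exact: measurableU.
rewrite [X in (X + _)%E]Z0 add0e; apply: le_trans (measureU2 _ mA mB) _.
rewrite [e]splitr EFinD; apply: leeD; last exact: PF.
have tight := a_tight (k - n%:Z) K.
by apply: le_trans PK; rewrite le_eqVlt; apply/orP; left; apply/eqP; exact: tight.
Qed.

(** By positivity the partial sums of the series lie below every solution, and
    by [far0] almost no trajectory exceeds their supremum. *)
Theorem volatility_sig2 : {ae P, forall w, forall k, a k w = sig2 (tshift k (path w))}.
Proof.
apply: ae_forallZ => k.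
have fars : {ae P, forall w, forall j : nat, ~ far k j.+1%:R^-1 w}.
  apply: ae_foralln => j; exists (far k j.+1%:R^-1); split=> //.
  - by apply: far0; rewrite invr_gt0.
  - by move=> w /contrapT.
apply: filterS2 a_path fars => w gp nf.
have ps n : past_sum theta n (tshift k (path w)) <= a k w.
  exact: (past_sum_le q_gt0 p_gt0 ulo_gt0 ulo_lt1 ulohi thetaU gp).
apply/eqP; rewrite eq_le; apply/andP; split; last first.
  by apply: rsum_le => // n; rewrite -past_sumE.
apply/ler_addgt0Pr => e e0.
have [j _ je] : exists2 j : nat, True & j.+1%:R^-1 <= e.
  exists (Num.bound e^-1) => //; rewrite -[leRHS]invrK lef_pV2 ?posrE ?invr_gt0//.
  apply: le_trans (ler_norm _) _; apply: le_trans (ltW (archi_boundP (normr_ge0 _))) _.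
  by rewrite ler_nat leqW// /Num.bound normr_id.
have := nf j; rewrite /far => /existsNP[n /not_implyP[_ /negP]]; rewrite /= -ltNge => H.
apply: ltW; apply: lt_le_trans (_ : past_sum theta n (tshift k (path w)) + j.+1%:R^-1 <= _).
  by rewrite -ltrBlDr.
apply: lerD => //; rewrite past_sumE.
by apply: (rsum_ge (M := a k w)) => // l; rewrite -past_sumE.
Qed.

End Volatility.

(** Powers of exponent at most [1] are subadditive, so that the moments of the
    matrix products add up. *)
Lemma sig2_moment : (\int[P]_w (sig2 (path w) `^ s)%:E < +oo)%E.
Proof.
have mN' n : measurable_fun setT (fun w => N n (path w) `^ s).
  apply: (measurableT_comp (measurable_powR s)).
  exact: (measurableT_comp (measurable_past_norm theta n)).
have mN n : measurable_fun setT (fun w => (N n (path w) `^ s)%:E).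
  exact/measurable_EFinP/mN'.
have N0 om n : 0 <= N n om.
  by apply/ltW; exact: (past_norm_gt0 (ulo := ulo) (uhi := uhi) (rho0 := rho0)).
apply: (@le_lt_trans _ _ (\int[P]_w \sum_(0 <= n <oo)
   ((par_x theta `^ s)%:E * (N n (path w) `^ s)%:E))%E).
  apply: ge0_le_integral => //.
  - by move=> w _; rewrite lee_fin powR_ge0.
  - apply/measurable_EFinP; apply: (measurableT_comp (measurable_powR s)).
    by apply: measurableT_comp mpath; exact: measurable_sig2.
  - rewrite (_ : (fun w => _) = fun w => \sum_(0 <= n <oo) (par_x theta `^ s * N n (path w) `^ s)%:E)%E//.
    apply: measurable_nneseries => [i w|i]; first by rewrite mulr_ge0 ?powR_ge0.
    by apply: measurable_funM; [exact: measurable_cst|exact: mN'].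
  move=> w _; apply: le_trans (powR_rsum_le (term_ge0 _) s_gt0 s_le1) _.
  apply: lee_nneseries => [i _ _|i _]; first by rewrite lee_fin powR_ge0.
  rewrite -EFinM lee_fin powRM//; last exact: (past_prod_ge0 ulo_gt0 thetaU).
  rewrite ler_wpM2l ?powR_ge0//; apply: ge0_ler_powR => //; rewrite ?nnegrE ?(ltW s_gt0)//.
    exact: (past_prod_ge0 ulo_gt0 thetaU).
  by apply: le_trans (ler_norm _) _; exact: (entry_le_opnorm i0).
rewrite integral_nneseries//; last 2 first.
- by move=> n; exact: emeasurable_funM.
- by move=> n w _; rewrite mule_ge0// lee_fin powR_ge0.
rewrite (@eq_eseriesr _ _ (fun n => (par_x theta `^ s)%:E * past_moment theta eps s n)%E); last first.
  move=> n _; rewrite ge0_integralZl//.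
    by move=> w _; rewrite lee_fin powR_ge0.
  by rewrite lee_fin powR_ge0.
rewrite nneseriesZl; last by move=> n _; exact: past_moment_ge0.
apply: lte_mul_pinfty => //; first by rewrite lee_fin powR_ge0.
Qed.

Opaque sig2.

Section Discounted.
Variable r : R.
Hypothesis r_gt0 : 0 < r.
Hypothesis r_lt1 : r < 1.

Definition memory_terms (om : seqspace R) (i : nat) : R :=
  (r ^+ i * sig2 (tshift (- i%:Z) om)) `^ s.

(** The power [s] is taken term by term: this has a finite mean, and still
    controls the power [s] of the discounted sum of the past volatilities. *)
Definition memory (om : seqspace R) : R := rsum (memory_terms om).

Lemma memory_terms_ge0 om i : 0 <= memory_terms om i.
Proof. exact: powR_ge0. Qed.

Lemma memory_ge0 om : 0 <= memory om.
Proof. by apply: rsum_ge0 => i; exact: memory_terms_ge0. Qed.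

Lemma measurable_memory_terms i : measurable_fun setT (memory_terms ^~ i).
Proof.
apply: (measurableT_comp (measurable_powR s)); apply: measurable_funM => //.
by apply: measurableT_comp measurable_sig2 _; exact: measurable_tshift.
Qed.

Lemma memory_termsE om i : memory_terms om i = (r ^+ i * sig2 (tshift (- i%:Z) om)) `^ s.
Proof. by []. Qed.

Opaque memory_terms.

Lemma measurable_memory : measurable_fun setT memory.
Proof.
apply: (measurable_rsum (f := fun i om => memory_terms om i)).
  by move=> i om; exact: memory_terms_ge0.
exact: measurable_memory_terms.
Qed.

Lemma memory_depends : depends_on (fun k : int => k < 0) memory.
Proof.
move=> om om' H; suff E : memory_terms om = memory_terms om' by rewrite /memory E.
apply/funext => i; rewrite !memory_termsE.
suff -> : sig2 (tshift (- i%:Z) om) = sig2 (tshift (- i%:Z) om') by [].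
by apply: sig2_depends => k k0; apply: H; clear -k0; lia.
Qed.

Let memory_esum om := (\sum_(0 <= i <oo) (memory_terms om i)%:E)%E.

Let mmemory_esum : measurable_fun setT memory_esum.
Proof.
apply: (measurable_nneseries (f := fun i om => memory_terms om i)).
  by move=> i om; exact: memory_terms_ge0.
exact: measurable_memory_terms.
Qed.

Let memory_esum_ge0 om : (0 <= memory_esum om)%E.
Proof. by apply: nneseries_ge0 => i _ _; rewrite lee_fin memory_terms_ge0. Qed.

Let memory_esum_moment : (\int[P]_w memory_esum (path w) < +oo)%E.
Proof.
rewrite integral_nneseries; last 3 first.
- exact: measurableT.
- move=> n; apply/measurable_EFinP.
  exact: (measurableT_comp (measurable_memory_terms n)).
- by move=> n w _; rewrite lee_fin memory_terms_ge0.
pose rs := r `^ s.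
have rs0 : 0 <= rs by exact: powR_ge0.
have rs1 : rs < 1.
  have -> : 1 = (1 : R) `^ s by rewrite powR1.
  by rewrite gt0_ltr_powR ?nnegrE ?(ltW r_gt0).
pose M := fine (\int[P]_w (sig2 (path w) `^ s)%:E)%E.
have ME : (\int[P]_w (sig2 (path w) `^ s)%:E = M%:E)%E.
  rewrite fineK// ge0_fin_numE ?sig2_moment//.
  by apply: integral_ge0 => w _; rewrite lee_fin powR_ge0.
have M0 : 0 <= M.
  by rewrite -lee_fin -ME; apply: integral_ge0 => w _; rewrite lee_fin powR_ge0.
have ms2 : measurable_fun setT (fun om => (sig2 om `^ s)%:E).
  apply/measurable_EFinP; apply: (measurableT_comp (measurable_powR s)).
  exact: measurable_sig2.
rewrite (@eq_eseriesr _ _ (fun n => (rs ^+ n * M)%:E)); last first.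
  move=> n _.
  rewrite (eq_integral (fun w => (rs ^+ n)%:E * (sig2 (tshift (- n%:Z) (path w)) `^ s)%:E)%E).
    rewrite ge0_integralZl//; last 3 first.
    - apply: (measurableT_comp ms2); apply: measurableT_comp mpath.
      exact: measurable_tshift.
    - by move=> w _; rewrite lee_fin powR_ge0.
    - by rewrite lee_fin exprn_ge0.
    rewrite (expect_tshift eps_iid (- n%:Z) ms2); last by move=> om; rewrite lee_fin powR_ge0.
    by rewrite ME.
  move=> w _; rewrite -EFinM memory_termsE powRM ?sig2_ge0 ?exprn_ge0 ?(ltW r_gt0)//.
  have -> : (r ^+ n) `^ s = rs ^+ n; last by [].
  rewrite /rs -[RHS]powR_mulrn ?powR_ge0// -powRrM -[r ^+ n]powR_mulrn ?(ltW r_gt0)//.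
  by rewrite -powRrM mulrC.
apply: (@le_lt_trans _ _ ((1 - rs)^-1 * M)%:E); last exact: ltry.
apply: lime_le.
  by apply: is_cvg_nneseries => k _ _; rewrite lee_fin mulr_ge0 ?exprn_ge0.
apply: nearW => J; rewrite sumEFin lee_fin -mulr_suml ler_wpM2r//.
exact: geometric_sum_le.
Qed.

Lemma memory_moment : (\int[P]_w (memory (path w))%:E < +oo)%E.
Proof.
apply: le_lt_trans memory_esum_moment; apply: ge0_le_integral.
- exact: measurableT.
- by move=> w _; rewrite lee_fin memory_ge0.
- by apply/measurable_EFinP; exact: measurableT_comp measurable_memory mpath.
- exact: measurableT_comp mmemory_esum mpath.
by move=> w _; apply: rsum_lee => i; exact: memory_terms_ge0.
Qed.

Lemma memory_ge : {ae P, forall w, forall (k : int) n,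
  (\sum_(0 <= i < n) r ^+ i * sig2 (tshift (k - i%:Z) (path w))) `^ s
    <= memory (tshift k (path w))}.
Proof.
apply: ae_forallZ => k.
have mk : measurable_fun setT (fun w => memory_esum (tshift k (path w))).
  apply: (measurableT_comp mmemory_esum); apply: measurableT_comp mpath.
  exact: measurable_tshift.
have : {ae P, forall w, setT w -> memory_esum (tshift k (path w)) \is a fin_num}.
  apply: integrable_ae => //; apply/integrableP; split=> //.
  under eq_integral do rewrite gee0_abs//.
  apply: le_lt_trans memory_esum_moment; rewrite le_eqVlt; apply/orP; left; apply/eqP.
  exact: (expect_tshift eps_iid k mmemory_esum memory_esum_ge0).
apply: filterS => w /(_ I) fin n.
have b0 i : 0 <= r ^+ i * sig2 (tshift (k - i%:Z) (path w)).
  by rewrite mulr_ge0 ?sig2_ge0 ?exprn_ge0// ltW.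
apply: le_trans (powR_sum_le _ b0 s_gt0 s_le1) _.
rewrite (eq_bigr (memory_terms (tshift k (path w)))) => [|i _].
  apply: rsum_fin_ge; first exact: memory_terms_ge0.
  by have := fin; rewrite ge0_fin_numE// => H; exact: H.
by rewrite memory_termsE tshiftD addrC.
Qed.

End Discounted.

End StationaryVolatility.

(** * Conditional variances under other parameters *)

Section WeightedPast.
Variables (R : realType) (p q : nat).
Variables ulo uhi rho0 : R.
Hypothesis q_gt0 : (0 < q)%N.
Hypothesis p_gt0 : (0 < p)%N.
Hypothesis ulo_gt0 : 0 < ulo.
Hypothesis ulo_lt1 : ulo < 1.
Hypothesis ulohi : ulo < uhi.
Hypothesis rho0_ge0 : 0 <= rho0.
Hypothesis rho0_lt1 : rho0 < 1.
Variables r kap : R.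
Hypothesis r_gt0 : 0 < r.
Hypothesis r_lt1 : r < 1.
Hypothesis kap_gt : rho0 < kap.
Hypothesis kap_r : kap <= (r ^+ 2) ^+ q.
Local Notation U := (param_set ulo uhi rho0).
Implicit Types (u v : 'rV[R]_(1 + p + q)) (z : int -> R).

(** The conditional variances built from the last [n - 1], resp. from all,
    squared observations [z] before time [k]. *)
Definition wpart z (k : int) u (n : nat) : R :=
  ccoef u 0 + \sum_(1 <= i < n) ccoef u i * z (k - i%:Z).

Definition winf z (k : int) u : R :=
  ccoef u 0 + rsum (fun i => ccoef u i.+1 * z (k - i.+1%:Z)).

(** The coefficients decay at the rate [r ^+ 2]: one factor [r ^+ i] discounts
    the observations, the other one measures the speed of convergence. *)
Let rho := r ^+ 2.
Let rho_gt0 : 0 < rho. Proof. exact: exprn_gt0. Qed.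
Let rho_lt1 : rho < 1. Proof. by rewrite exprn_ilt1// ltW. Qed.
Let r_ge0 : 0 <= r. Proof. exact: ltW. Qed.

Local Notation cb := (ccoef_bound p uhi rho0 rho kap).
Local Notation cl := (ccoef_lip p q uhi rho0 rho kap).
Local Notation c0l := (c0_lip q uhi rho0).

Let cb0 : 0 <= cb. Proof. exact: (ccoef_bound_ge0 p ulo_gt0 ulohi _ rho0_ge0 kap_gt). Qed.
Let cl0 : 0 <= cl. Proof. exact: (ccoef_lip_ge0 p q ulo_gt0 ulohi _ rho0_ge0 kap_gt). Qed.
Let c0l0 : 0 <= c0l. Proof. exact: (c0_lip_ge0 q ulo_gt0 ulohi rho0_lt1). Qed.

Let cu_ge0 u i : U u -> 0 <= ccoef u i.
Proof. by move=> uU; exact: (ccoef_ge0 q_gt0 p_gt0 ulo_gt0 rho0_lt1 i uU). Qed.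

Let cbn n : 0 <= cb * r ^+ n.
Proof. exact: (mulr_ge0 cb0 (exprn_ge0 n r_ge0)). Qed.

Variables (z : int -> R) (k : int) (S : R).
Hypothesis z_ge0 : forall j, 0 <= z j.
Hypothesis zS : forall n, \sum_(1 <= i < n) r ^+ i * z (k - i%:Z) <= S.

Let S_ge0 : 0 <= S. Proof. by have := zS 0; rewrite big_geq. Qed.

Lemma wpart_ge_c0 u n : U u -> ccoef u 0 <= wpart z k u n.
Proof.
move=> uU; rewrite lerDl big_nat_cond; apply: sumr_ge0 => i _.
by rewrite mulr_ge0//; exact: cu_ge0.
Qed.

Lemma wpart_ge u n : U u -> ulo <= wpart z k u n.
Proof.
by move=> uU; apply: le_trans (wpart_ge_c0 _ uU); exact: (c0_ge ulo_gt0 rho0_lt1 uU).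
Qed.

Let tail_le u n m : U u -> (n <= m)%N -> (0 < n)%N ->
  \sum_(n <= i < m) ccoef u i * z (k - i%:Z) <= cb * r ^+ n * S.
Proof.
move=> uU nm n0; apply: (@le_trans _ _ (cb * r ^+ n * \sum_(n <= i < m) r ^+ i * z (k - i%:Z))).
  rewrite mulr_sumr big_nat_cond [leRHS]big_nat_cond; apply: ler_sum => i.
  rewrite andbT => /andP[ni _]; rewrite mulrA ler_wpM2r//.
  apply: le_trans (ccoef_le ulo_gt0 ulohi rho_gt0 rho_lt1 rho0_ge0 kap_gt kap_r uU _) _.
    exact: leq_trans ni.
  rewrite -mulrA ler_wpM2l// /rho -[leLHS]exprM mul2n -addnn exprD ler_wpM2r ?exprn_ge0//.
  by rewrite ler_wiXn2l// ltW.
apply: ler_wpM2l; first exact: cbn.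
apply: le_trans (zS m).
rewrite [leRHS](big_cat_nat (n := n))//= lerDr; apply: sumr_ge0 => i _.
by rewrite mulr_ge0 ?exprn_ge0.
Qed.

Let term_ge0 u i : U u -> 0 <= ccoef u i.+1 * z (k - i.+1%:Z).
Proof. by move=> uU; rewrite mulr_ge0//; exact: cu_ge0. Qed.

Let shift_sum (F : nat -> R) n : \sum_(0 <= i < n) F i.+1 = \sum_(1 <= i < n.+1) F i.
Proof. by rewrite [RHS]big_add1. Qed.

Let sum_bounded u n : U u -> \sum_(0 <= i < n) ccoef u i.+1 * z (k - i.+1%:Z) <= cb * r * S.
Proof.
move=> uU; rewrite (shift_sum (fun i => ccoef u i * z (k - i%:Z))).
by rewrite -{1}[r]expr1; exact: tail_le.
Qed.

Lemma wpart_le_winf u n : U u -> wpart z k u n <= winf z k u.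
Proof.
move=> uU; rewrite lerD2l; case: n => [|n].
  by rewrite big_geq// rsum_ge0// => i; exact: term_ge0.
rewrite -(shift_sum (fun i => ccoef u i * z (k - i%:Z))).
apply: (rsum_ge (M := cb * r * S)) => [i|m]; [exact: term_ge0|exact: sum_bounded].
Qed.

Lemma winf_le_wpart u n : U u -> (0 < n)%N ->
  winf z k u <= wpart z k u n + cb * r ^+ n * S.
Proof.
move=> uU n0; rewrite /winf /wpart -addrA lerD2l; apply: rsum_le => [i|m].
  exact: term_ge0.
rewrite (shift_sum (fun i => ccoef u i * z (k - i%:Z))).
have [mn|nm] := leqP m.+1 n.
  rewrite [leRHS](_ : _ = (\sum_(1 <= i < m.+1) ccoef u i * z (k - i%:Z) +
      \sum_(m.+1 <= i < n) ccoef u i * z (k - i%:Z)) + cb * r ^+ n * S).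
    rewrite -addrA lerDl; apply: addr_ge0 (mulr_ge0 (cbn n) S_ge0).
    by apply: sumr_ge0 => i _; rewrite mulr_ge0//; exact: cu_ge0.
  by congr (_ + _); rewrite -big_cat_nat.
by rewrite (big_cat_nat (n := n)) ?(ltnW nm)//= lerD2l tail_le// ltnW.
Qed.

Lemma wpart_close u v delta n : U u -> U v -> par_close delta u v ->
  `|wpart z k u n - wpart z k v n| <= (c0l + cl * S) * delta.
Proof.
move=> uU vU uv.
have d0 : 0 <= delta by apply: le_trans (uv ord0); exact: normr_ge0.
rewrite /wpart opprD addrACA -sumrB.
apply: le_trans (ler_normD _ _) _; rewrite mulrDl; apply: lerD.
  exact: (c0_close ulo_gt0 rho0_lt1 uU vU uv).
apply: le_trans (ler_norm_sum _ _ _) _.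
apply: (@le_trans _ _ (cl * delta * \sum_(1 <= i < n) r ^+ i * z (k - i%:Z))); last first.
  by rewrite mulrAC ler_wpM2r// ler_wpM2l.
rewrite mulr_sumr big_nat_cond [leRHS]big_nat_cond; apply: ler_sum => i.
rewrite andbT => /andP[i1 _]; rewrite -mulrBl normrM [`|z _|]ger0_norm// mulrA ler_wpM2r//.
apply: le_trans (ccoef_close q_gt0 p_gt0 ulo_gt0 ulohi rho_gt0 rho_lt1 rho0_ge0 rho0_lt1 kap_gt kap_r uU vU uv i1) _.
apply: ler_wpM2l; first exact: mulr_ge0 cl0 d0.
rewrite /rho -[leLHS]exprM ler_wiXn2l// ?(ltW r_lt1)//.
by rewrite leq_pmull.
Qed.

Lemma wpart_winf_close u v delta n : U u -> U v -> par_close delta u v -> (0 < n)%N ->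
  `|wpart z k u n - winf z k v| <= (c0l + cl * S) * delta + cb * S * r ^+ n.
Proof.
move=> uU vU uv n0; rewrite -(subrKA (wpart z k v n)).
apply: le_trans (ler_normD _ _) _; apply: lerD; first exact: wpart_close.
rewrite distrC ger0_norm ?subr_ge0 ?wpart_le_winf// lerBlDl.
by rewrite [cb * S * _]mulrAC; exact: winf_le_wpart.
Qed.

Lemma wpart_ge_recent u n N : U u -> (N < n)%N ->
  ulo ^+ N * \sum_(1 <= i < N.+1) z (k - i%:Z) <= wpart z k u n.
Proof.
move=> uU Nn; apply: (@le_trans _ _ (\sum_(1 <= i < N.+1) ccoef u i * z (k - i%:Z))).
  rewrite mulr_sumr big_nat_cond [leRHS]big_nat_cond; apply: ler_sum => i.
  rewrite andbT ltnS => /andP[i1 iN]; rewrite ler_wpM2r//.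
  apply: le_trans (ccoef_ge q_gt0 p_gt0 ulo_gt0 uU i1).
  by rewrite ler_wiXn2l// ltW.
have := c0_ge ulo_gt0 rho0_lt1 uU; rewrite /wpart; move: (ccoef u 0) => c0 c0ge.
rewrite [X in _ <= _ + X](big_cat_nat (n := N.+1))//= addrCA lerDl addr_ge0//.
  exact: le_trans (ltW ulo_gt0) c0ge.
by apply: sumr_ge0 => i _; rewrite mulr_ge0//; exact: cu_ge0.
Qed.

End WeightedPast.

Section PathVariance.
Variables (R : realType) (p q : nat) (theta : 'rV[R]_(1 + p + q)).
Variables ulo uhi rho0 : R.
Hypothesis q_gt0 : (0 < q)%N.
Hypothesis p_gt0 : (0 < p)%N.
Hypothesis ulo_gt0 : 0 < ulo.
Hypothesis ulo_lt1 : ulo < 1.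
Hypothesis ulohi : ulo < uhi.
Hypothesis thetaU : param_set ulo uhi rho0 theta.
Hypothesis rho0_ge0 : 0 <= rho0.
Hypothesis rho0_lt1 : rho0 < 1.
Variables r kap : R.
Hypothesis r_gt0 : 0 < r.
Hypothesis r_lt1 : r < 1.
Hypothesis kap_gt : rho0 < kap.
Hypothesis kap_r : kap <= (r ^+ 2) ^+ q.
Local Notation U := (param_set ulo uhi rho0).
Implicit Types (u v : 'rV[R]_(1 + p + q)).

Variables e a : int -> R.
Hypothesis ea : garch_path theta e a.
Variables (k : int) (S : R).
Hypothesis aS : forall n, \sum_(0 <= i < n) r ^+ i * a (k - i%:Z) <= S.

Local Notation z := (fun j => a j * e j ^+ 2).

Let rho := r ^+ 2.
Let rho_gt0 : 0 < rho. Proof. exact: exprn_gt0. Qed.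
Let rho_lt1 : rho < 1. Proof. by rewrite exprn_ilt1// ltW. Qed.
Let r_ge0 : 0 <= r. Proof. exact: ltW. Qed.
Let a_ge0 j : 0 <= a j. Proof. by case: (ea j). Qed.

Lemma path_obs_ge0 j : 0 <= z j.
Proof. by rewrite mulr_ge0// sqr_ge0. Qed.

Let a_le_S i : r ^+ i * a (k - i%:Z) <= S.
Proof.
apply: le_trans (aS i.+1); rewrite big_nat_recr//= lerDr; apply: sumr_ge0 => j _.
by rewrite mulr_ge0 ?exprn_ge0.
Qed.

Lemma ulo_le_memory : ulo <= S.
Proof.
have := a_le_S 0; rewrite expr0 mul1r subr0; apply: le_trans.
exact: (garch_path_ge ulo_gt0 thetaU ea).
Qed.

Let S_ge0 : 0 <= S. Proof. exact: le_trans (ltW ulo_gt0) ulo_le_memory. Qed.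

Lemma path_obs_sum n : \sum_(1 <= i < n) r ^+ i * z (k - i%:Z) <= S / ulo.
Proof.
case: n => [|n]; first by rewrite big_geq// divr_ge0// ltW.
rewrite big_add1 /= ler_pdivlMr// mulrC; apply: le_trans (aS n).
rewrite mulr_sumr; apply: ler_sum => i _.
apply: (@le_trans _ _ (r ^+ i * (ulo * z (k - i.+1%:Z)))).
  rewrite mulrCA exprSr -mulrA ler_wpM2l ?exprn_ge0// ler_piMl ?(ltW r_lt1)//.
  by rewrite mulr_ge0 ?path_obs_ge0// ltW.
rewrite ler_wpM2l ?exprn_ge0//.
have -> : k - i.+1%:Z = k - i%:Z - 1%:Z by clear; lia.
exact: (garch_path_ge_y2 ulo_gt0 thetaU ea).
Qed.

Definition variance_const : R :=
  (c0_lip q uhi rho0 + ccoef_lip p q uhi rho0 (r ^+ 2) kap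
   + ccoef_bound p uhi rho0 (r ^+ 2) kap) / ulo.

Lemma variance_const_ge0 : 0 <= variance_const.
Proof.
apply: divr_ge0 (ltW ulo_gt0); apply: addr_ge0; first apply: addr_ge0.
- exact: (c0_lip_ge0 q ulo_gt0 ulohi rho0_lt1).
- exact: (ccoef_lip_ge0 p q ulo_gt0 ulohi _ rho0_ge0 kap_gt).
- exact: (ccoef_bound_ge0 p ulo_gt0 ulohi _ rho0_ge0 kap_gt).
Qed.

Lemma path_variance_close u v delta n : U u -> U v -> par_close delta u v -> (0 < n)%N ->
  `|wpart z k u n - winf z k v| <= variance_const * (delta + r ^+ n) * S.
Proof.
move=> uU vU uv n0.
have d0 : 0 <= delta by apply: le_trans (uv ord0); exact: normr_ge0.
apply: le_trans (wpart_winf_close q_gt0 p_gt0 ulo_gt0 ulohi rho0_ge0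
  rho0_lt1 r_gt0 r_lt1 kap_gt kap_r (z := z) path_obs_ge0 path_obs_sum uU vU uv n0) _.
have c0l0 : 0 <= c0_lip q uhi rho0 by exact: (c0_lip_ge0 q ulo_gt0 ulohi rho0_lt1).
have cl0 : 0 <= ccoef_lip p q uhi rho0 (r ^+ 2) kap by exact: (ccoef_lip_ge0 p q ulo_gt0 ulohi _ rho0_ge0 kap_gt).
have cb0 : 0 <= ccoef_bound p uhi rho0 (r ^+ 2) kap by exact: (ccoef_bound_ge0 p ulo_gt0 ulohi _ rho0_ge0 kap_gt).
rewrite /variance_const.
move: (c0_lip q uhi rho0) (ccoef_lip _ _ _ _ _ _) (ccoef_bound _ _ _ _ _) c0l0 cl0 cb0.
move=> A B C A0 B0 C0.
have S1 : 1 <= S / ulo by rewrite ler_pdivlMr// mul1r ulo_le_memory.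
have rn0 : 0 <= r ^+ n by exact: exprn_ge0.
move: (r ^+ n) rn0 => rn rn0.
have -> : (A + B + C) / ulo * (delta + rn) * S = (A + B + C) * (S / ulo) * (delta + rn).
  by ring.
move: (S / ulo) S1 => X X1.
rewrite mulrDr; apply: lerD; last first.
  by rewrite ler_wpM2r// ler_wpM2r ?(le_trans ler01)// lerDr addr_ge0.
rewrite ler_wpM2r// !mulrDl -addrA lerD//; first by rewrite ler_peMr.
by rewrite lerDl mulr_ge0// (le_trans ler01).
Qed.

(** [a k] and [winf z k theta] are both within a constant times [r ^+ n] of the
    same partial sum. *)
Lemma path_variance_true : a k = winf z k theta.
Proof.
pose K := repr_const p q ulo uhi rho0 rho kap + variance_const.
have Kn n : `|a k - winf z k theta| <= K * S * r ^+ n.+1.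
  rewrite -(subrKA (wpart z k theta n.+1)).
  apply: le_trans (ler_normD _ _) _; rewrite /K 2!mulrDl; apply: lerD; last first.
    have tt : par_close 0 theta theta by move=> i; rewrite subrr normr0.
    apply: le_trans (path_variance_close thetaU thetaU tt (ltn0Sn n)) _.
    by rewrite add0r mulrAC.
  rewrite /wpart opprD addrA.
  apply: le_trans (garch_path_repr ulo_gt0 ulohi thetaU ea
    rho_gt0 rho_lt1 rho0_ge0 rho0_lt1 kap_gt kap_r k n) _.
  have rc0 : 0 <= repr_const p q ulo uhi rho0 rho kap.
    have uhi0 : 0 <= uhi by rewrite ltW// (lt_trans ulo_gt0).
    have kap0 : 0 < kap by exact: le_lt_trans kap_gt.
    have gap : 0 <= 1 - rho0 by rewrite subr_ge0 ltW.
    rewrite /repr_const mulr_ge0//; last first.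
      by rewrite invr_ge0 subr_ge0 ler_pdivrMr// mul1r ltW.
    rewrite mulr_ge0 ?invr_ge0 ?exprn_ge0 ?(ltW rho_gt0)// addr_ge0// mulr_ge0//.
      by rewrite divr_ge0 ?(ltW ulo_gt0)// mulr_ge0// addr_ge0// divr_ge0.
    by rewrite divr_ge0// ltW.
  have -> : rho ^+ n.+1 = r ^+ n.+1 * r ^+ n.+1.
    by rewrite /rho -[LHS]exprM mul2n -addnn exprD.
  move: (repr_const _ _ _ _ _ _ _) rc0 => rc rc0.
  rewrite -!mulrA ler_wpM2l// mulrA.
  rewrite ler_wpM2r ?exprn_ge0//; apply: le_trans (a_le_S n).
  by rewrite mulrC exprS ler_wpM2r// ler_piMl ?exprn_ge0// ltW.
apply/eqP; rewrite -subr_eq0 -normr_le0.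
have r1 : `|r| < 1 by rewrite ger0_norm.
have cv : (fun n => K * S * r ^+ n.+1) @ \oo --> K * S * 0.
  by apply: cvgMr; rewrite cvg_shiftS; exact: cvg_expr r1.
rewrite -(mulr0 (K * S)) -(cvg_lim (@Rhausdorff R) cv).
apply: limr_ge; first by apply/cvg_ex; exists (K * S * 0).
by apply: nearW => n; exact: Kn.
Qed.

(** The recent observations enter every conditional variance with the weights
    [c_i >= ulo ^+ i], as [garch_path_ratio] requires. *)
Lemma path_ratio_wpart u N n : U u -> (N < n)%N ->
  0 < \sum_(1 <= i < N.+1) e (k - i%:Z) ^+ 2 ->
  a k / wpart z k u n <= (growth p q ulo uhi / ulo ^+ 2) ^+ N *
    (1 + (\sum_(1 <= i < N.+1) e (k - i%:Z) ^+ 2)^-1).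
Proof.
move=> uU Nn E0; have w0 : 0 < wpart z k u n.
  by apply: lt_le_trans ulo_gt0 _; exact: (wpart_ge q_gt0 p_gt0 ulo_gt0 rho0_lt1 (z := z) k path_obs_ge0 n uU).
rewrite ler_pdivrMr//; apply: (garch_path_ratio q_gt0 ulo_gt0 ulo_lt1 ulohi thetaU ea) => //.
exact: (wpart_ge_recent q_gt0 p_gt0 ulo_gt0 ulo_lt1 rho0_lt1 (z := z) k path_obs_ge0 uU Nn).
Qed.

Lemma path_ratio_winf u N : U u ->
  0 < \sum_(1 <= i < N.+1) e (k - i%:Z) ^+ 2 ->
  a k / winf z k u <= (growth p q ulo uhi / ulo ^+ 2) ^+ N *
    (1 + (\sum_(1 <= i < N.+1) e (k - i%:Z) ^+ 2)^-1).
Proof.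
move=> uU E0; apply: le_trans (path_ratio_wpart uU (ltnSn N) E0).
have w0 : 0 < wpart z k u N.+1.
  by apply: lt_le_trans ulo_gt0 _; exact: (wpart_ge q_gt0 p_gt0 ulo_gt0 rho0_lt1 (z := z) k path_obs_ge0 N.+1 uU).
have ww : wpart z k u N.+1 <= winf z k u.
  exact: (wpart_le_winf q_gt0 p_gt0 ulo_gt0 ulohi rho0_ge0
    rho0_lt1 r_gt0 r_lt1 kap_gt kap_r (z := z) path_obs_ge0 path_obs_sum).
by rewrite ler_wpM2l// lef_pV2 ?posrE// (lt_le_trans w0).
Qed.

End PathVariance.

(** * Increments of the log-likelihood *)

Section LogLikelihood.
Variables (R : realType) (h : R -> R).
Hypothesis h_diff : forall y0 t : R, 0 < t -> derivable (g h y0) t 1.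
Variables (C1 : R -> R) (nu : R).
Hypothesis nu_ge0 : 0 <= nu.
Hypothesis g1_le : forall y0 t : R, 0 < t -> `|g1 h y0 t| <= C1 y0 * (t `^ nu + 1) / t.

Lemma g1_bound_ge0 y : 0 <= C1 y.
Proof.
have := le_trans (normr_ge0 _) (g1_le y ltr01).
by rewrite powR1 divr1 pmulr_lge0.
Qed.

Let gexp y x := g h y (expR x).

Let gexp_derive y (x : R) : is_derive x (1 : R) (gexp y) (g1 h y (expR x) * expR x).
Proof.
apply: (@is_derive1_comp R (g h y) (@expR R) x (g1 h y (expR x)) (expR x)).
apply: DeriveDef; first by apply: h_diff; exact: expR_gt0.
by rewrite /g1 derive1E.
Qed.

(** In the variable [ln t] the log-likelihood has derivative [t * g1 y t],
    which grows at most like a power of [t]. *)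
Lemma g_log_lip y t t' B : 0 < t -> 0 < t' -> t <= B -> t' <= B ->
  `|g h y t - g h y t'| <= C1 y * (B `^ nu + 1) * `|ln t - ln t'|.
Proof.
wlog tt : t t' / t' <= t.
  move=> H t0 t'0 tB t'B; have [tt|tt] := leP t' t; first exact: H.
  by rewrite distrC [`|ln t - _|]distrC; apply: H => //; exact: ltW.
move=> t0 t'0 tB t'B.
have lt : ln t' <= ln t by rewrite ler_ln ?posrE.
have cont : {within `[ln t', ln t], continuous (gexp y)}.
  apply: continuous_subspaceT => x; apply: differentiable_continuous.
  by apply/derivable1_diffP; exact: (@ex_derive _ _ _ _ _ _ _ (gexp_derive y x)).
have [c cin E] := MVT_segment lt (fun x _ => gexp_derive y x) cont.
have -> : g h y t - g h y t' = gexp y (ln t) - gexp y (ln t') by rewrite /gexp !lnK ?posrE.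
rewrite E normrM ler_wpM2r//.
have ec : expR c <= B.
  by apply: le_trans tB; rewrite -[leRHS]lnK ?posrE// ler_expR; move: cin; rewrite in_itv => /andP[].
have e0 := expR_gt0 c.
rewrite normrM [`|expR c|]gtr0_norm//.
apply: (@le_trans _ _ (C1 y * (expR c `^ nu + 1) / expR c * expR c)).
  by rewrite ler_wpM2r ?(ltW e0)// g1_le.
rewrite divfK ?gt_eqF// ler_wpM2l ?g1_bound_ge0// lerD2r.
apply: ge0_ler_powR => //; rewrite nnegrE; first exact: ltW.
exact: le_trans (ltW e0) ec.
Qed.

Lemma ln1D_le (x b : R) : 0 <= x -> 0 < b -> b <= 1 -> ln (1 + x) <= b^-1 * x `^ b.
Proof.
move=> x0 b0 b1; rewrite mulrC ler_pdivlMr// mulrC -ln_powR.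
apply: (@le_trans _ _ (ln (1 + x `^ b))).
  rewrite ler_ln ?posrE ?powR_gt0 ?ltr_pwDl ?powR_ge0//.
  by apply: le_trans (powRD_le ler01 x0 b0 b1) _; rewrite powR1.
have xb : -1 < x `^ b by apply: lt_le_trans (powR_ge0 _ _); rewrite ltrN10.
exact: (le_ln1Dx xb).
Qed.

(** Above [c] the logarithm is Lipschitz and grows more slowly than any power,
    hence it is Hoelder of every order [b]. A small order only asks for a small
    moment of the difference of the variances. *)
Lemma ln_dist_le (c W W' b : R) : 0 < c -> c <= W -> c <= W' -> 0 < b -> b <= 1 ->
  `|ln W - ln W'| <= b^-1 * (`|W - W'| / c) `^ b.
Proof.
wlog WW : W W' / W' <= W.
  move=> H c0 cW cW' b0 b1; have [tt|tt] := leP W' W; first exact: H.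
  by rewrite distrC [`|W - _|]distrC; apply: H => //; exact: ltW.
move=> c0 cW cW' b0 b1.
have W0 : 0 < W by exact: lt_le_trans cW.
have W'0 : 0 < W' by exact: lt_le_trans cW'.
have x0 : 0 <= `|W - W'| / c by rewrite divr_ge0// ltW.
rewrite [`|ln W - _|]ger0_norm ?subr_ge0 ?ler_ln ?posrE//.
apply: le_trans (ln1D_le x0 b0 b1).
rewrite -ln_div ?posrE// ler_ln ?posrE ?divr_gt0 ?ltr_pwDl//.
rewrite ger0_norm ?subr_ge0// -[W in leLHS](subrK W') addrC mulrDl divff ?gt_eqF//.
by rewrite lerD2l ler_wpM2l ?subr_ge0// lef_pV2 ?posrE.
Qed.

Lemma g_sqrt_ratio y a W W' M c b : 0 < a -> 0 < c -> c <= W -> c <= W' ->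
  a / W <= M -> a / W' <= M -> 0 < b -> b <= 1 ->
  `|g h y (Num.sqrt (a / W)) - g h y (Num.sqrt (a / W'))| <=
    C1 y * (M `^ (nu / 2) + 1) * (b^-1 * (`|W - W'| / c) `^ b).
Proof.
move=> a0 c0 cW cW' aM aM' b0 b1.
have W0 : 0 < W by exact: lt_le_trans cW.
have W'0 : 0 < W' by exact: lt_le_trans cW'.
have r0 : 0 < a / W by rewrite divr_gt0.
have r0' : 0 < a / W' by rewrite divr_gt0.
have M0 : 0 <= M by exact: le_trans (ltW r0) aM.
have -> : M `^ (nu / 2) = Num.sqrt M `^ nu.
  by rewrite -powR12_sqrt// -powRrM mulrC.
apply: le_trans (g_log_lip (B := Num.sqrt M) y _ _ _ _) _; rewrite ?sqrtr_gt0//.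
- by rewrite ler_sqrt.
- by rewrite ler_sqrt.
rewrite ler_wpM2l//.
  by rewrite mulr_ge0 ?g1_bound_ge0// addr_ge0 ?powR_ge0.
apply: le_trans (ln_dist_le c0 cW cW' b0 b1).
rewrite -!powR12_sqrt ?(ltW r0) ?(ltW r0')// !ln_powR -mulrBr normrM ger0_norm//.
have -> : ln (a / W) - ln (a / W') = ln W' - ln W by rewrite !ln_div ?posrE//; ring.
rewrite [`|ln W' - _|]distrC ler_piMl//; by rewrite invf_le1// ler1n.
Qed.

Definition lip_const (c s V M0 : R) : R :=
  (s / 2)^-1 * (V / c) `^ (s / 2) * (2 + 4 * (2 * M0) `^ nu).

Lemma lip_const_ge0 c s V M0 : 0 < s -> 0 <= lip_const c s V M0.
Proof.
move=> s0; rewrite /lip_const mulr_ge0//.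
  by rewrite mulr_ge0 ?powR_ge0// invr_ge0 divr_ge0// ltW.
by rewrite addr_ge0// mulr_ge0// powR_ge0.
Qed.

(** [E2] stands for the sum of the recent squared innovations, [S] for the
    memory, [1 + X] and [Q] for integrable bounds of [E2 ^- nu] and [S ^ s]. The
    ratios are at most a multiple [M] of [1 + E2^-1], and the increment is of
    the order of [C1 y * M ^ (nu / 2) * S ^ (s / 2)]; Young's inequality
    separates the power [nu] of [M] from the power [s] of [S]. *)
Lemma g_increment y a W W' c s V D S M0 E2 X Q :
  0 < a -> 0 < c -> c <= W -> c <= W' -> 0 < s -> s <= 1 -> 0 <= V -> 0 <= D ->
  0 <= S -> `|W - W'| <= V * D * S -> S `^ s <= Q ->
  0 <= M0 -> 0 < E2 -> a / W <= M0 * (1 + E2^-1) -> a / W' <= M0 * (1 + E2^-1) ->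
  0 <= X -> E2^-1 `^ nu <= 1 + X ->
  `|g h y (Num.sqrt (a / W)) - g h y (Num.sqrt (a / W'))| <=
    lip_const c s V M0 * D `^ (s / 2) * (C1 y * (1 + X + Q)).
Proof.
move=> a0 c0 cW cW' s0 s1 V0 D0 S0 WW SQ M00 E20 aM aM' X0 E2X.
have s20 : 0 < s / 2 by rewrite divr_gt0.
have s21 : s / 2 <= 1 by lra.
set M := M0 * (1 + E2^-1) in aM aM' *.
have M1 : 0 <= M by rewrite mulr_ge0// addr_ge0// invr_ge0 ltW.
apply: le_trans (g_sqrt_ratio y a0 c0 cW cW' aM aM' s20 s21) _.
have Q0 : 0 <= Q by apply: le_trans SQ; exact: powR_ge0.
have W1 : (`|W - W'| / c) `^ (s / 2) <= (V / c) `^ (s / 2) * D `^ (s / 2) * S `^ (s / 2).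
  rewrite -!powRM ?mulr_ge0 ?invr_ge0 ?(ltW c0)//.
  apply: ge0_ler_powR; rewrite ?nnegrE ?(ltW s20)//.
  - by rewrite divr_ge0// ltW.
  - by rewrite !mulr_ge0// invr_ge0 ltW.
  - have -> : V / c * D * S = V * D * S / c by ring.
    by rewrite ler_wpM2r// invr_ge0 ltW.
have Mnu : M `^ nu <= (2 * M0) `^ nu * (2 + X).
  have E0 : 0 <= E2^-1 by rewrite invr_ge0 ltW.
  rewrite /M powRM// ?addr_ge0// powRM// [2 `^ _ * _]mulrC -mulrA ler_wpM2l ?powR_ge0//.
  apply: le_trans (powR_1Dle E0 nu_ge0) _; rewrite ler_wpM2l ?powR_ge0//.
  by have -> : 2 + X = 1 + (1 + X) by [|ring]; rewrite lerD2l.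
have key : (M `^ (nu / 2) + 1) * S `^ (s / 2) <= (2 + 4 * (2 * M0) `^ nu) * (1 + X + Q).
  have m2 : (M `^ (nu / 2)) ^+ 2 = M `^ nu.
    by rewrite -powR_mulrn ?powR_ge0// -powRrM divfK.
  have S2 : (S `^ (s / 2)) ^+ 2 <= Q.
    by rewrite -powR_mulrn ?powR_ge0// -powRrM divfK.
  move: Mnu; rewrite -m2.
  have := powR_ge0 (2 * M0) nu; have := powR_ge0 M (nu / 2); have := powR_ge0 S (s / 2).
  move: (M `^ _) (S `^ _) S2 ((2 * M0) `^ _) => m1 S1 S2 K S10 m10 K0 Mnu.
  (* Young's inequality for the product, then for the square of [m1 + 1] *)
  have : (m1 + 1) * S1 <= 2 * m1 ^+ 2 + 2 + S1 ^+ 2.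
    have := sqr_ge0 (m1 + 1 - S1); have := sqr_ge0 (m1 - 1); have := sqr_ge0 S1.
    have := sqr_ge0 m1; lra.
  have KX : 0 <= K * X by rewrite mulr_ge0.
  have KQ : 0 <= K * Q by rewrite mulr_ge0.
  by lra.
rewrite /lip_const.
have Cy := g1_bound_ge0 y.
apply: (@le_trans _ _ (C1 y * (M `^ (nu / 2) + 1) * ((s / 2)^-1 *
   ((V / c) `^ (s / 2) * D `^ (s / 2) * S `^ (s / 2))))).
  rewrite ler_wpM2l ?mulr_ge0 ?addr_ge0 ?powR_ge0//.
  by rewrite ler_wpM2l// invr_ge0 ltW.
have P0 : 0 <= C1 y * (s / 2)^-1 * (V / c) `^ (s / 2) * D `^ (s / 2).
  by rewrite !mulr_ge0 ?powR_ge0// invr_ge0 ltW.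
have := ler_wpM2l P0 key.
move: (M `^ _ + 1) (S `^ _) (2 + _) (1 + X + Q) ((V / c) `^ _) (D `^ _) (s / 2)^-1.
move=> t1 t2 t3 t4 t5 t6 t7.
have -> : C1 y * t7 * t5 * t6 * (t1 * t2) = C1 y * t1 * (t7 * (t5 * t6 * t2)) by ring.
by have -> : C1 y * t7 * t5 * t6 * (t3 * t4) = t7 * t5 * t3 * t6 * (C1 y * t4) by ring.
Qed.

End LogLikelihood.

(** * Negative moments of the innovations *)

Section SmallBalls.
Context (R : realType) d (T : measurableType d) (P : probability T R).
Variable eps : int -> {RV P >-> R}.
Hypothesis eps_iid : iid eps.
Local Notation path := (seqpath eps).
Variable mu : R.
Hypothesis mu_gt0 : 0 < mu.
Hypothesis small :
  t `^ (- mu) * fine (P [set w | eps 0 w ^+ 2 <= t]) @[t --> 0^'+] --> 0.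

Let ball (t : R) := [set w | eps 0 w ^+ 2 <= t].

Let mball t : measurable (ball t).
Proof.
rewrite -[X in measurable X]setTI; apply: measurable_fun_le => //.
exact: measurable_funX.
Qed.

(** Near [0] this is the limit, elsewhere probabilities are at most one. *)
Lemma small_ball : exists2 C : R, 0 <= C & forall t, 0 < t -> (P (ball t) <= (C * t `^ mu)%:E)%E.
Proof.
have /cvgrPdist_le /(_ _ ltr01) := small.
move=> [t0 /= t00 H].
have t20 : 0 < t0 / 2 by rewrite divr_gt0.
exists (1 + (t0 / 2) `^ (- mu)); first by rewrite addr_ge0// powR_ge0.
move=> t tgt; have Pf : P (ball t) \is a fin_num by rewrite fin_num_measure.
rewrite -[leLHS]fineK// lee_fin.
have tm : 0 < t `^ mu by rewrite powR_gt0.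
have [tt|tt] := leP t (t0 / 2).
  have := H t; rewrite /= !sub0r !normrN gtr0_norm// => /(_ _ tgt).
  have tt0 : t < t0 by rewrite (le_lt_trans tt)// ltr_pdivrMr// ltr_pMr// ltr1n.
  move=> /(_ tt0); rewrite ger0_norm; last by rewrite mulr_ge0 ?powR_ge0 ?fine_ge0.
  rewrite powRN mulrC ler_pdivrMr// mul1r => H1.
  by apply: le_trans H1 _; rewrite ler_peMl ?(ltW tm)// lerDl powR_ge0.
apply: (@le_trans _ _ 1).
  by rewrite -lee_fin fineK// probability_le1.
rewrite mulrDl mul1r; apply: (@le_trans _ _ ((t0 / 2) `^ (- mu) * t `^ mu)); last first.
  by rewrite lerDr ltW.
rewrite powRN mulrC ler_pdivlMr ?powR_gt0// mul1r.
by apply: ge0_ler_powR; rewrite ?nnegrE ?ltW.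
Qed.

Lemma eps_neq0 k : {ae P, forall w, eps k w != 0}.
Proof.
have [C C0 HC] := small_ball.
have m0 j : measurable (eps j @^-1` [set 0]).
  by rewrite -[X in measurable X]setTI; apply: measurable_funP => //; exact: measurable_set1.
have P0 : P (eps k @^-1` [set 0]) = 0%E.
  rewrite (proj2 eps_iid k 0 _ (measurable_set1 0)).
  apply/eqP; rewrite eq_le measure_ge0 andbT; apply/lee_addgt0Pr => e e0; rewrite add0e.
  pose t := (e / (C + 1)) `^ mu^-1.
  have C10 : 0 < C + 1 by rewrite ltr_wpDl.
  have t0 : 0 < t by rewrite powR_gt0// divr_gt0.
  apply: (@le_trans _ _ (P (ball t))).
    apply: le_measure; rewrite ?inE//.
    by move=> w /= ew; rewrite /ball /= ew expr0n/= ltW.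
  apply: le_trans (HC _ t0) _; rewrite lee_fin /t -powRrM mulVf ?gt_eqF// powRr1; last first.
    by rewrite divr_ge0// ltW.
  by rewrite mulrA ler_pdivrMr// [leRHS]mulrC ler_wpM2r ?(ltW e0)// lerDl.
exists (eps k @^-1` [set 0]); split=> // w /= /negP; rewrite negbK => /eqP.
by [].
Qed.

Let half : R := 2^-1.
Let half_gt0 : 0 < half. Proof. by rewrite invr_gt0. Qed.
Let half_lt1 : half < 1. Proof. by rewrite invf_lt1// ltr1n. Qed.

Let tau := mu / 2.
Let tau_gt0 : 0 < tau. Proof. by rewrite divr_gt0. Qed.

Let dyadic (x : R) : 0 <= x -> ((x `^ (- tau))%:E <=
  1 + \sum_(0 <= j <oo) ((half ^+ j.+1) `^ (- tau) * (x <= half ^+ j)%R%:R)%:E)%E.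
Proof.
move=> x0; pose F j := (half ^+ j.+1) `^ (- tau) * (x <= half ^+ j)%R%:R.
suff : ((x `^ (- tau))%:E <= 1 + \sum_(0 <= j <oo) (F j)%:E)%E by [].
have F0 j : 0 <= F j.
  by rewrite mulr_ge0 ?powR_ge0.
have S0 : (0 <= \sum_(0 <= j <oo) (F j)%:E)%E.
  by apply: nneseries_ge0 => j _ _; rewrite lee_fin F0.
have [->|xn] := eqVneq x 0.
  by rewrite powR0 ?oppr_eq0 ?gt_eqF// adde_ge0.
have xp : 0 < x by rewrite lt0r xn.
have [x1|x1] := leP 1 x.
  apply: (@le_trans _ _ 1%E); last by rewrite leeDl.
  rewrite lee_fin powRN invf_le1 ?powR_gt0//; exact: (powR_ge1 x1 (ltW tau_gt0)).
have ex : exists j, half ^+ j < x.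
  exists (Num.bound x^-1); rewrite /half exprVn -[ltRHS]invrK ltf_pV2 ?posrE ?invr_gt0 ?exprn_gt0//.
  apply: le_lt_trans (ler_norm _) _; apply: lt_trans (archi_boundP (normr_ge0 _)) _.
  by rewrite -natrX ltr_nat /Num.bound normr_id ltn_expl.
have [j jx jmin] := ex_minnP ex.
case: j jx jmin => [|j] jx jmin; first by move: jx; rewrite expr0 ltNge (ltW x1).
have xj : x <= half ^+ j by rewrite leNgt; apply/negP => /jmin; rewrite ltnn.
apply: (@le_trans _ _ (F j)%:E).
  rewrite lee_fin /F xj mulr1 !powRN lef_pV2 ?posrE ?powR_gt0 ?exprn_gt0//.
  by apply: ge0_ler_powR; rewrite ?nnegrE ?exprn_ge0 ?(ltW half_gt0)// ltW.
apply: (@le_trans _ _ (\sum_(0 <= j <oo) (F j)%:E)%E); last by rewrite leeDr.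
apply: le_trans (nneseries_lim_ge j.+1 _); last by move=> i _ _; rewrite lee_fin F0.
by rewrite big_nat_recr//= leeDr// sume_ge0// => i _; rewrite lee_fin F0.
Qed.

(** Where the square lies between [2^-(j+1)] and [2^-j], its power [- tau] is of
    order [2^(j tau)], and this has probability of order [2^-(j mu)]: the series
    converges because [tau < mu]. *)
Lemma negative_moment k :
  (\int[P]_w ((eps k w ^+ 2) `^ (- tau))%:E < +oo)%E.
Proof.
have [C C0 HC] := small_ball.
pose G (om : seqspace R) : \bar R := ((om 0 ^+ 2) `^ (- tau))%:E.
have mG : measurable_fun setT G.
  apply/measurable_EFinP; apply: (measurableT_comp (measurable_powR (- tau))).
  by apply: measurable_funX; exact: measurable_coord.
have G0 om : (0 <= G om)%E by rewrite lee_fin powR_ge0.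
have -> : (\int[P]_w ((eps k w ^+ 2) `^ (- tau))%:E = \int[P]_w G (path w))%E.
  rewrite -(expect_tshift eps_iid k mG G0); apply: eq_integral => w _.
  by rewrite /G /tshift /relabel add0r.
pose F j w : R := (half ^+ j.+1) `^ (- tau) * (eps 0 w ^+ 2 <= half ^+ j)%R%:R.
have F0 j w : 0 <= F j w by rewrite mulr_ge0 ?powR_ge0.
have FE j : F j = fun w => (half ^+ j.+1) `^ (- tau) * \1_(ball (half ^+ j)) w.
  apply/funext => w; rewrite /F indicE; congr (_ * (_ %:R)).
  by congr nat_of_bool; apply/idP/idP; rewrite inE.
have mF j : measurable_fun setT (F j).
  by rewrite FE; apply: measurable_funM => //; exact: measurable_indic.
apply: (@le_lt_trans _ _ (\int[P]_w (1 + \sum_(0 <= j <oo) (F j w)%:E))%E).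
  apply: ge0_le_integral => //.
  - exact: (measurableT_comp mG (measurable_seqpath eps)).
  - by apply: emeasurable_funD => //; apply: (measurable_nneseries F0).
  by move=> w _; apply: dyadic; exact: sqr_ge0.
rewrite ge0_integralD//; last 2 first.
- by move=> w _; apply: nneseries_ge0 => j _ _; rewrite lee_fin.
- exact: (measurable_nneseries F0).
rewrite integral_cst//= mul1e probability_setT lte_add_pinfty ?ltry//.
rewrite integral_nneseries//; last 2 first.
- by move=> j; exact/measurable_EFinP.
- by move=> j w _; rewrite lee_fin.
pose q := half `^ tau.
have q0 : 0 < q by rewrite powR_gt0.
have q1 : q < 1.
  have -> : 1 = (1 : R) `^ tau by rewrite powR1.
  by rewrite gt0_ltr_powR ?nnegrE ?(ltW half_gt0).
apply: (@le_lt_trans _ _ (\sum_(0 <= j <oo) (C / q * q ^+ j)%:E)%E).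
  apply: lee_nneseries => [j _ _|j _].
    by apply: integral_ge0 => w _; rewrite lee_fin.
  rewrite FE (eq_integral (fun w => ((half ^+ j.+1) `^ (- tau))%:E * (\1_(ball (half ^+ j)) w)%:E)%E)//.
  rewrite ge0_integralZl//; last 2 first.
  - by apply/measurable_EFinP; exact: measurable_indic.
  - by rewrite lee_fin powR_ge0.
  rewrite integral_indic// setIT.
  have hj : 0 < half ^+ j by rewrite exprn_gt0.
  apply: (@le_trans _ _ (((half ^+ j.+1) `^ (- tau))%:E * (C * (half ^+ j) `^ mu)%:E)%E).
    by rewrite lee_wpmul2l ?lee_fin ?powR_ge0// HC.
  rewrite -EFinM lee_fin.
  have powhalf n t : (half ^+ n) `^ t = (half `^ t) ^+ n.
    rewrite -[RHS]powR_mulrn ?powR_ge0// -powRrM -[half ^+ n]powR_mulrn ?(ltW half_gt0)//.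
    by rewrite -powRrM mulrC.
  rewrite !powhalf powRN -/q.
  have -> : half `^ mu = q ^+ 2.
    by rewrite /q -powR_mulrn ?powR_ge0// -powRrM /tau divfK.
  rewrite exprVn -exprM mul2n -addnn exprD exprS invfM le_eqVlt; apply/orP; left; apply/eqP.
  field; by rewrite !gt_eqF ?exprn_gt0.
apply: (@le_lt_trans _ _ (C / q * (1 - q)^-1)%:E); last exact: ltry.
have Cq : 0 <= C / q by rewrite divr_ge0// ltW.
apply: lime_le.
  by apply: is_cvg_nneseries => j _ _; rewrite lee_fin mulr_ge0 ?exprn_ge0 ?(ltW q0).
apply: nearW => J; rewrite sumEFin lee_fin -mulr_sumr ler_wpM2l//.
exact: geometric_sum_le (ltW q0) q1.
Qed.

(** A product of independent factors: the single negative moment of an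
    innovation gives it a finite mean, for every [N]. *)
Definition recent_inverse (N : nat) (om : seqspace R) : R :=
  \prod_(1 <= i < N.+1) (om (- i%:Z) ^+ 2) `^ (- tau).

Lemma recent_inverse_ge0 N om : 0 <= recent_inverse N om.
Proof. by apply: prodr_ge0 => i _; exact: powR_ge0. Qed.

Lemma measurable_recent_inverse N : measurable_fun setT (recent_inverse N).
Proof.
apply: measurable_prod => i _; apply: (measurableT_comp (measurable_powR (- tau))).
by apply: measurable_funX; exact: measurable_coord.
Qed.

Lemma recent_inverse_depends N :
  depends_on (fun k : int => (- N%:Z <= k < 0)%R) (recent_inverse N).
Proof.
move=> om om' H; apply: eq_big_nat => i /andP[i1 iN].
by rewrite H//; clear -i1 iN; lia.
Qed.

Lemma recent_inverse_moment N : (\int[P]_w (recent_inverse N (path w))%:E < +oo)%E.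
Proof.
elim: N => [|N ih].
  rewrite (eq_integral (cst 1%E)); first by rewrite integral_cst//= probability_setT mule1 ltry.
  by move=> w _; rewrite /recent_inverse big_geq.
pose Z (om : seqspace R) : \bar R := ((om (- N.+1%:Z) ^+ 2) `^ (- tau))%:E.
pose F (om : seqspace R) : \bar R := (recent_inverse N om)%:E.
have mZ : measurable_fun setT Z.
  apply/measurable_EFinP; apply: (measurableT_comp (measurable_powR (- tau))).
  by apply: measurable_funX; exact: measurable_coord.
have mF : measurable_fun setT F by apply/measurable_EFinP; exact: measurable_recent_inverse.
rewrite (eq_integral (fun w => F (path w) * Z (path w)))%E; last first.
  by move=> w _; rewrite /F /Z -EFinM /recent_inverse big_nat_recr.
rewrite (depends_on_integralM eps_iid (I := fun k : int => (- N%:Z <= k < 0)%R)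
  (J := fun k : int => k == - N.+1%:Z)) //.
- apply: lte_mul_pinfty => //.
  + by apply: integral_ge0 => w _; rewrite lee_fin recent_inverse_ge0.
  + by rewrite ge0_fin_numE//; apply: integral_ge0 => w _; rewrite lee_fin recent_inverse_ge0.
  + exact: negative_moment.
- by move=> k /andP[k1 k2] /eqP kN; move: k1 k2; rewrite kN; clear; lia.
- by move=> om om' H; rewrite /F (recent_inverse_depends H).
- by move=> om om' H; rewrite /Z H.
- by move=> om; rewrite lee_fin recent_inverse_ge0.
- by move=> om; rewrite lee_fin powR_ge0.
Qed.

(** The inverse of the sum is at most the inverse of each of its terms; spread
    over [N] terms, the power [nu] costs at most [tau] for each of them. *)
Lemma recent_inverse_ge N nu om : 0 <= nu -> nu <= tau * N%:R ->
  (forall i, (0 < i <= N)%N -> om (- i%:Z) != 0) ->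
  0 < \sum_(1 <= i < N.+1) om (- i%:Z) ^+ 2 ->
  (\sum_(1 <= i < N.+1) om (- i%:Z) ^+ 2)^-1 `^ nu <= 1 + recent_inverse N om.
Proof.
move=> nu0 nuN om0; set E := \sum_(_ <= _ < _) _ => E0.
have [E1|E1] := leP 1 E.
  apply: (@le_trans _ _ 1); last by rewrite lerDl recent_inverse_ge0.
  have -> : 1 = (1 : R) `^ nu by rewrite powR1.
  apply: ge0_ler_powR; rewrite ?nnegrE ?invr_ge0 ?(ltW E0)//.
  by rewrite invf_le1.
apply: (@le_trans _ _ (recent_inverse N om)); last by rewrite lerDr.
apply: (@le_trans _ _ (E^-1 `^ (tau * N%:R))).
  by apply: ler_powR => //; rewrite invf_ge1// ltW.
rewrite powRrM powR_mulrn ?powR_ge0//.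
have -> : (E^-1 `^ tau) ^+ N = \prod_(1 <= i < N.+1) E `^ (- tau).
  rewrite prodr_const_nat subSS subn0 powRN; congr (_ ^+ _).
  have Et : E `^ tau != 0 by rewrite gt_eqF// powR_gt0.
  apply: (mulfI Et); rewrite divff// -powRM ?invr_ge0 ?(ltW E0)// divff ?gt_eqF//.
  by rewrite powR1.
rewrite big_nat_cond [leRHS]big_nat_cond; apply: ler_prod => i.
rewrite andbT ltnS => iN; rewrite powR_ge0/= !powRN.
have oi : 0 < om (- i%:Z) ^+ 2 by rewrite exprn_even_gt0//= om0.
rewrite lef_pV2 ?posrE ?powR_gt0//; apply: ge0_ler_powR; rewrite ?nnegrE ?(ltW tau_gt0) ?(ltW E0) ?(ltW oi)//.
rewrite /E (bigD1_seq i) ?mem_index_iota ?iota_uniq ?ltnS//= lerDl.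
by apply: sumr_ge0 => j _; exact: sqr_ge0.
Qed.

End SmallBalls.

(** * The limiting contrast *)

Lemma ae_exists (R : realType) d (T : measurableType d) (P : probability T R)
    (A : T -> Prop) : {ae P, forall w, A w} -> exists w, A w.
Proof.
move=> [N [mN N0 sub]]; apply: contrapT => /forallNP H.
have NT : N = setT by apply/seteqP; split=> // v _; apply: sub; exact: H.
have := probability_setT P; rewrite -NT => P1.
have : 0%E = 1%E :> \bar R by rewrite -P1.
by move/eqP; rewrite eqe eq_sym oner_eq0.
Qed.

Lemma measurable_inv_nneg (R : realType) d (T : measurableType d) (f : T -> R) :
  (forall t, 0 <= f t) -> measurable_fun setT f -> measurable_fun setT (fun t => (f t)^-1).
Proof.
move=> f0 mf; rewrite (_ : (fun t => (f t)^-1) = fun t => f t `^ (-1)).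
  exact: (measurableT_comp (measurable_powR (-1))).
by apply/funext => t; rewrite powR_inv1.
Qed.

Lemma rsum_split (R : realType) (b : nat -> R) (n : nat) (M : R) : (forall i, 0 <= b i) ->
  (forall m, \sum_(0 <= i < m) b i <= M) ->
  rsum b = \sum_(0 <= i < n) b i + rsum (fun i => b (n + i)%N).
Proof.
move=> b0 bM.
have cut m : \sum_(0 <= i < n + m) b i = \sum_(0 <= i < n) b i + \sum_(0 <= i < m) b (n + i)%N.
  rewrite (big_cat_nat (n := n)) ?leq_addr//=; congr (_ + _).
  rewrite -{1}[n]add0n big_addn addKn; apply: eq_bigr => i _; congr b.
  by rewrite addnC.
have tM m : \sum_(0 <= i < m) b (n + i)%N <= rsum b - \sum_(0 <= i < n) b i.
  by rewrite lerBrDl -cut; exact: (rsum_ge (M := M)).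
apply/eqP; rewrite eq_le; apply/andP; split; last first.
  by rewrite -lerBrDl; apply: rsum_le => // i; exact: b0.
apply: rsum_le => // m.
apply: (@le_trans _ _ (\sum_(0 <= i < n + m) b i)).
  rewrite [leRHS](big_cat_nat (n := m)) ?leq_addl//= lerDl.
  by apply: sumr_ge0.
rewrite cut lerD2l; apply: (rsum_ge (M := rsum b - \sum_(0 <= i < n) b i)) => // i.
Qed.

Lemma integral_posneg (R : realType) d (T : measurableType d) (P : probability T R)
    (F : T -> \bar R) : P.-integrable setT F ->
  [/\ (\int[P]_w F w = \int[P]_w maxe (F w) 0 - \int[P]_w maxe (- F w) 0)%E,
      (\int[P]_w maxe (F w) 0)%E \is a fin_num &
      (\int[P]_w maxe (- F w) 0)%E \is a fin_num].
Proof.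
move=> iF; have fp := integrable_pos_fin_num measurableT iF.
have fn := integrable_neg_fin_num measurableT iF.
by rewrite integralE; move: fp fn; rewrite funepos.unlock funeneg.unlock.
Qed.

(** The nonnegative difference has integral zero. *)
Lemma ae_eq_of_integral_le (R : realType) d (T : measurableType d) (P : probability T R)
    (A B : T -> \bar R) :
  measurable_fun setT A -> measurable_fun setT B ->
  (forall w, 0 <= A w)%E -> (forall w, 0 <= B w)%E ->
  {ae P, forall w, [/\ (A w <= B w)%E, A w \is a fin_num & B w \is a fin_num]} ->
  (\int[P]_w A w)%E \is a fin_num -> (\int[P]_w B w <= \int[P]_w A w)%E ->
  {ae P, forall w, A w = B w}.
Proof.
move=> mA mB A0 B0 AB IA IBA.
pose D (w : T) := (maxe (B w - A w) 0)%E.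
have mD : measurable_fun setT D.
  by apply: measurable_maxe => //; exact: emeasurable_funB.
have D0 w : (0 <= D w)%E by rewrite /D le_max lexx orbT.
have BAD : (\int[P]_w B w = \int[P]_w A w + \int[P]_w D w)%E.
  rewrite -ge0_integralD//; apply: ae_eq_integral => //.
    exact: emeasurable_funD.
  apply: filterS AB => w [le fA fB] _; rewrite /D max_l ?sube_ge0 ?fA ?orbT//.
  by rewrite addeC subeK.
have D00 : (\int[P]_w D w = 0)%E.
  apply/eqP; rewrite eq_le integral_ge0// andbT.
  by move: IBA; rewrite BAD -[leRHS]adde0 leeD2lE.
have Dabs : (\int[P]_w `|D w| = 0)%E.
  by rewrite -[RHS]D00; apply: eq_integral => w _; rewrite gee0_abs.
have Dae := (ae_eq_integral_abs P measurableT mD).1 Dabs.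
apply: filterS2 Dae AB => w /(_ I) D1 [le fA fB].
apply/eqP; rewrite eq_le le/= -sube_le0 ?fA ?orbT//.
by move: D1; rewrite /D /= => <-; rewrite le_max lexx.
Qed.

Section IndependentEquality.
Context (R : realType) d (T : measurableType d) (P : probability T R).

(** Independence decouples the two arguments of [`|X - Z|]: by Tonelli's theorem
    its mean over [X] vanishes for almost every value of [Z], and [X] is almost
    surely equal to such a value. *)
Lemma indep_eq_const (X Z : T -> R) :
  measurable_fun setT X -> measurable_fun setT Z ->
  (forall A B, measurable A -> measurable B ->
    P (X @^-1` A `&` Z @^-1` B) = P (X @^-1` A) * P (Z @^-1` B))%E ->
  {ae P, forall w, X w = Z w} -> exists c, {ae P, forall w, X w = c}.
Proof.
move=> mX mZ indep XZ.
pose G (x : R * R) : \bar R := (`|x.1 - x.2|)%:E.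
have mG : measurable_fun setT G.
  apply/measurable_EFinP; apply: measurableT_comp => //; exact: measurable_funB.
have G0 x : (0 <= G x)%E by rewrite lee_fin.
have [mI] := joint_law_fubini mX mZ indep mG G0.
have -> : (\int[P]_w G (X w, Z w) = 0)%E.
  rewrite (ae_eq_integral (cst 0%E))//; first by rewrite integral0.
    by apply: (measurableT_comp mG); exact: measurable_fun_pair.
  by apply: filterS XZ => w E _; rewrite /G /= E subrr normr0.
move=> /esym I0.
have I1 v : (0 <= \int[P]_w G (X w, Z v))%E by apply: integral_ge0.
have : (\int[P]_v `|\int[P]_w G (X w, Z v)| = 0)%E.
  by rewrite -[RHS]I0; apply: eq_integral => v _; rewrite gee0_abs.
move=> /(ae_eq_integral_abs P measurableT mI) /ae_exists[v /(_ I) Iv].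
exists (Z v).
have mGv : measurable_fun setT (fun w => G (X w, Z v)).
  by apply: (measurableT_comp mG); exact: measurable_fun_pair.
have : (\int[P]_w `|G (X w, Z v)| = 0)%E.
  by rewrite -[RHS]Iv; apply: eq_integral => w _; rewrite gee0_abs.
move=> /(ae_eq_integral_abs P measurableT mGv); apply: filterS => w /(_ I) [] /eqP.
by rewrite normr_eq0 subr_eq0 => /eqP.
Qed.

End IndependentEquality.

Section Contrast.
Local Arguments ccoef : simpl never.
Context (R : realType) (p q : nat) (theta : 'rV[R]_(1 + p + q)).
Variables ulo uhi rho0 : R.
Hypothesis q_gt0 : (0 < q)%N.
Hypothesis p_gt0 : (0 < p)%N.
Hypothesis ulo_gt0 : 0 < ulo.
Hypothesis ulo_lt1 : ulo < 1.
Hypothesis ulohi : ulo < uhi.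
Hypothesis rho0_ge0 : 0 <= rho0.
Hypothesis rho0_lt1 : rho0 < 1.
Local Notation U := (param_set ulo uhi rho0).
Hypothesis thetaU : U theta.
Variables r kap : R.
Hypothesis r_gt0 : 0 < r.
Hypothesis r_lt1 : r < 1.
Hypothesis kap_gt : rho0 < kap.
Hypothesis kap_r : kap <= (r ^+ 2) ^+ q.
Context d (T : measurableType d) (P : probability T R).
Variable eps : int -> {RV P >-> R}.
Hypothesis eps_iid : iid eps.
Local Notation path := (seqpath eps).
Variable s : R.
Hypothesis s_gt0 : 0 < s.
Hypothesis s_le1 : s <= 1.
Variables (h : R -> R) (C1 : R -> R) (nu : R).
Hypothesis h_meas : measurable_fun setT h.
Hypothesis h_diff : forall y0 t : R, 0 < t -> derivable (g h y0) t 1.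
Hypothesis nu_ge0 : 0 <= nu.
Hypothesis C1_meas : measurable_fun setT C1.
Hypothesis g1_le : forall y0 t : R, 0 < t -> `|g1 h y0 t| <= C1 y0 * (t `^ nu + 1) / t.
Hypothesis C1_int : (\int[P]_w (C1 (eps 0 w))%:E < +oo)%E.
Variables (mu : R) (N : nat).
Hypothesis mu_gt0 : 0 < mu.
Hypothesis nuN : nu <= mu / 2 * N%:R.
Hypothesis N_gt0 : (0 < N)%N.
Hypothesis inverse_moment : (\int[P]_w (recent_inverse mu N (path w))%:E < +oo)%E.
Hypothesis memory_moment : (\int[P]_w (memory theta s r (path w))%:E < +oo)%E.

Implicit Types (u v : 'rV[R]_(1 + p + q)) (om : seqspace R).

Local Notation a2 om := (sig2 theta om).

Definition obs2 om (j : int) : R := sig2 theta (tshift j om) * om j ^+ 2.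

Lemma obs2_ge0 om j : 0 <= obs2 om j.
Proof. by rewrite mulr_ge0 ?sqr_ge0//; exact: (sig2_ge0 ulo_gt0 thetaU). Qed.

Lemma obs2_tshift k om j : obs2 (tshift k om) j = obs2 om (j + k).
Proof. by rewrite /obs2 tshiftD. Qed.

(** The conditional variance at time [0] under the parameter [u]. *)
Definition vinf u om : R := winf (obs2 om) 0 u.

Let cu_ge0 u i : U u -> 0 <= ccoef u i.
Proof. by move=> uU; exact: (ccoef_ge0 q_gt0 p_gt0 ulo_gt0 rho0_lt1 i uU). Qed.

Let vterm_ge0 u om i : U u -> 0 <= ccoef u i.+1 * obs2 om (0 - i.+1%:Z).
Proof. by move=> uU; rewrite mulr_ge0 ?obs2_ge0 ?cu_ge0. Qed.

Lemma vinf_ge u om : U u -> ulo <= vinf u om.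
Proof.
move=> uU; apply: le_trans (c0_ge ulo_gt0 rho0_lt1 uU) _.
by rewrite /vinf /winf lerDl; apply: rsum_ge0 => i; exact: vterm_ge0.
Qed.

Lemma vinf_tshift u k om : vinf u (tshift k om) = winf (obs2 om) k u.
Proof.
rewrite /vinf /winf.
have -> : (fun i : nat => ccoef u i.+1 * obs2 (tshift k om) (0 - i.+1%:Z)) =
    (fun i : nat => ccoef u i.+1 * obs2 om (k - i.+1%:Z)).
  by apply/funext => i; rewrite obs2_tshift sub0r addrC.
by [].
Qed.

Let msig2 : measurable_fun setT (sig2 theta).
Proof. exact: (measurable_sig2 ulo_gt0 thetaU). Qed.

Let mpath : measurable_fun setT path. Proof. exact: measurable_seqpath. Qed.

Lemma measurable_obs2 j : measurable_fun setT (obs2^~ j).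
Proof.
apply: measurable_funM; last by apply: measurable_funX; exact: measurable_coord.
by apply: (measurableT_comp msig2); exact: measurable_tshift.
Qed.

Lemma obs2_depends (j : int) (om om' : seqspace R) :
  (forall i, i <= j -> om i = om' i) -> obs2 om j = obs2 om' j.
Proof.
move=> H; rewrite /obs2 H//; congr (_ * _).
apply: sig2_depends => i i0; apply: H; rewrite /tshift.
by clear -i0; lia.
Qed.

Lemma measurable_vinf u : U u -> measurable_fun setT (vinf u).
Proof.
move=> uU; apply: measurable_funD => //.
apply: (measurable_rsum (f := fun i om => ccoef u i.+1 * obs2 om (0 - i.+1%:Z))).
  by move=> i om; exact: vterm_ge0.
by move=> i; apply: measurable_funM => //; exact: measurable_obs2.
Qed.

Lemma vinf_depends u : depends_on (fun k : int => k < 0) (vinf u).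
Proof.
move=> om om' H; rewrite /vinf /winf.
have -> : (fun i : nat => ccoef u i.+1 * obs2 om (0 - i.+1%:Z)) =
    (fun i : nat => ccoef u i.+1 * obs2 om' (0 - i.+1%:Z)).
  apply/funext => i; congr (_ * _); apply: obs2_depends => j ji; apply: H.
  by clear -ji; lia.
by [].
Qed.

(** The trajectories on which all pathwise estimates are carried out. *)
Definition good (e : seqspace R) : Prop :=
  [/\ garch_path theta e (fun k => a2 (tshift k e)),
      forall (k : int) n,
        (\sum_(0 <= i < n) r ^+ i * a2 (tshift (k - i%:Z) e)) `^ s
          <= memory theta s r (tshift k e) &
      forall k, e k != 0].

Hypothesis good_ae : {ae P, forall w, good (path w)}.

Local Notation Q := (memory theta s r).

Section Good.
Variable e : seqspace R.
Hypothesis ge : good e.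

Let gp : garch_path theta e (fun k => a2 (tshift k e)). Proof. by case: ge. Qed.

Let S k := Q (tshift k e) `^ s^-1.

Let QS k : S k `^ s = Q (tshift k e).
Proof. by rewrite /S -powRrM mulVf ?gt_eqF// powRr1// memory_ge0. Qed.

Lemma good_memory k n :
  \sum_(0 <= i < n) r ^+ i * a2 (tshift (k - i%:Z) e) <= Q (tshift k e) `^ s^-1.
Proof.
have [_ /(_ k n) H _] := ge.
have s0 : 0 <= \sum_(0 <= i < n) r ^+ i * a2 (tshift (k - i%:Z) e).
  apply: sumr_ge0 => i _; rewrite mulr_ge0 ?exprn_ge0 ?(ltW r_gt0)//.
  exact: (sig2_ge0 ulo_gt0 thetaU).
have sV0 : 0 <= s^-1 by rewrite invr_ge0 ltW.
rewrite -[leLHS]powRr1// -(divff (lt0r_neq0 s_gt0)) powRrM.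
by apply: ge0_ler_powR; rewrite ?nnegrE ?powR_ge0 ?memory_ge0.
Qed.

Let ebig k : 0 < \sum_(1 <= i < N.+1) e (k - i%:Z) ^+ 2.
Proof.
have [_ _ en] := ge; rewrite big_ltn ?ltnS//; apply: ltr_pwDl.
  by rewrite exprn_even_gt0//= en.
by apply: sumr_ge0 => i _; exact: sqr_ge0.
Qed.

Let aS : forall k n, \sum_(0 <= i < n) r ^+ i * a2 (tshift (k - i%:Z) e) <= S k := good_memory.

Lemma good_obs_sum k n :
  \sum_(1 <= i < n) r ^+ i * obs2 e (k - i%:Z) <= Q (tshift k e) `^ s^-1 / ulo.
Proof.
exact: (path_obs_sum (a := fun k => a2 (tshift k e)) p_gt0 ulo_gt0 thetaU r_gt0 r_lt1 gp (aS k)).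
Qed.

Lemma good_sig2_ge k : ulo <= a2 (tshift k e).
Proof. exact: (garch_path_ge ulo_gt0 thetaU gp). Qed.

Lemma good_sig2 k : a2 (tshift k e) = winf (obs2 e) k theta.
Proof.
exact: (path_variance_true (a := fun k => a2 (tshift k e)) q_gt0 p_gt0 ulo_gt0 ulohi thetaU rho0_ge0
  rho0_lt1 r_gt0 r_lt1 kap_gt kap_r gp (aS k)).
Qed.

(** The random factor common to all the increments of the log-likelihood. *)
Definition envelope om : R := C1 (om 0) * (1 + recent_inverse mu N om + Q om).

Definition incr_const : R :=
  lip_const nu ulo s (variance_const p q ulo uhi rho0 r kap)
    ((growth p q ulo uhi / ulo ^+ 2) ^+ N).

Lemma incr_const_ge0 : 0 <= incr_const.
Proof. exact: lip_const_ge0. Qed.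

Let V0 : 0 <= variance_const p q ulo uhi rho0 r kap.
Proof. exact: (variance_const_ge0 p q ulo_gt0 ulohi rho0_ge0 rho0_lt1 r_gt0 kap_gt). Qed.

Let growth_ge0 : 0 <= (growth p q ulo uhi / ulo ^+ 2) ^+ N.
Proof.
have g1 := growth_ge1 p q ulo_gt0 ulohi.
by rewrite exprn_ge0// divr_ge0 ?exprn_ge0 ?(ltW ulo_gt0)// (le_trans ler01).
Qed.

Let inverse_le k :
  (\sum_(1 <= i < N.+1) e (k - i%:Z) ^+ 2)^-1 `^ nu <= 1 + recent_inverse mu N (tshift k e).
Proof.
have E : \sum_(1 <= i < N.+1) e (k - i%:Z) ^+ 2 =
    \sum_(1 <= i < N.+1) tshift k e (- i%:Z) ^+ 2.
  by apply: eq_bigr => i _; rewrite /tshift /relabel addrC.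
rewrite E; apply: recent_inverse_ge => //.
  by move=> i _; rewrite /tshift /relabel; case: ge.
by rewrite -E.
Qed.

Let g_incr k W W' D : ulo <= W -> ulo <= W' -> 0 <= D ->
  `|W - W'| <= variance_const p q ulo uhi rho0 r kap * D * S k ->
  a2 (tshift k e) / W <= (growth p q ulo uhi / ulo ^+ 2) ^+ N *
    (1 + (\sum_(1 <= i < N.+1) e (k - i%:Z) ^+ 2)^-1) ->
  a2 (tshift k e) / W' <= (growth p q ulo uhi / ulo ^+ 2) ^+ N *
    (1 + (\sum_(1 <= i < N.+1) e (k - i%:Z) ^+ 2)^-1) ->
  `|g h (e k) (Num.sqrt (a2 (tshift k e) / W)) -
    g h (e k) (Num.sqrt (a2 (tshift k e) / W'))| <=
  incr_const * D `^ (s / 2) * envelope (tshift k e).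
Proof.
move=> uW uW' D0 WW aW aW'.
have a0 : 0 < a2 (tshift k e) by apply: lt_le_trans ulo_gt0 (good_sig2_ge k).
have -> : envelope (tshift k e) =
    C1 (e k) * (1 + recent_inverse mu N (tshift k e) + Q (tshift k e)).
  by rewrite /envelope {1}/tshift /relabel add0r.
apply: (g_increment h_diff nu_ge0 g1_le (S := S k) _ a0 ulo_gt0 uW uW' s_gt0 s_le1 V0 D0 _
   WW _ growth_ge0 (ebig k) aW aW').
- exact: powR_ge0.
- by rewrite QS.
- exact: recent_inverse_ge0.
- exact: inverse_le.
Qed.

(** The price of replacing a parameter by a close one is a power of [delta],
    that of replacing the infinite past by the observed one a power of [r ^+ k]. *)
Lemma good_increment u v delta (k : nat) : U u -> U v -> par_close delta u v ->
  (N < k)%N ->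
  `|g h (e k%:Z) (Num.sqrt (a2 (tshift k%:Z e) / wpart (obs2 e) k%:Z u k)) -
    g h (e k%:Z) (Num.sqrt (a2 (tshift k%:Z e) / vinf v (tshift k%:Z e)))| <=
  incr_const * (delta + r ^+ k) `^ (s / 2) * envelope (tshift k%:Z e).
Proof.
move=> uU vU uv Nk; have k0 : (0 < k)%N by exact: leq_ltn_trans Nk.
have d0 : 0 <= delta by apply: le_trans (uv ord0); exact: normr_ge0.
apply: g_incr.
- exact: (wpart_ge q_gt0 p_gt0 ulo_gt0 rho0_lt1 k%:Z (obs2_ge0 e) k uU).
- exact: vinf_ge.
- by rewrite addr_ge0// exprn_ge0// ltW.
- rewrite vinf_tshift.
  exact: (path_variance_close (a := fun k => a2 (tshift k e)) q_gt0 p_gt0 ulo_gt0 ulohi thetaU rho0_ge0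
    rho0_lt1 r_gt0 r_lt1 kap_gt kap_r gp (aS k) uU vU uv k0).
- exact: (path_ratio_wpart (a := fun k => a2 (tshift k e)) q_gt0 p_gt0 ulo_gt0 ulo_lt1 ulohi thetaU
    rho0_lt1 gp uU Nk (ebig k)).
- rewrite vinf_tshift.
  exact: (path_ratio_winf (a := fun k => a2 (tshift k e)) q_gt0 p_gt0 ulo_gt0 ulo_lt1 ulohi thetaU rho0_ge0
    rho0_lt1 r_gt0 r_lt1 kap_gt kap_r gp (aS k) vU (ebig k)).
Qed.

(** Both sides are compared with the conditional variance built from the last
    [N] observations. *)
Lemma good_contrast_increment u v delta (k : int) : U u -> U v -> par_close delta u v ->
  `|g h (e k) (Num.sqrt (a2 (tshift k e) / vinf u (tshift k e))) -
    g h (e k) (Num.sqrt (a2 (tshift k e) / vinf v (tshift k e)))| <=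
  2 * (incr_const * (delta + 1) `^ (s / 2)) * envelope (tshift k e).
Proof.
move=> uU vU uv.
have d0 : 0 <= delta by apply: le_trans (uv ord0); exact: normr_ge0.
have step u' v' delta' : U u' -> U v' -> par_close delta' u' v' -> delta' <= delta ->
    `|g h (e k) (Num.sqrt (a2 (tshift k e) / wpart (obs2 e) k u' N.+1)) -
      g h (e k) (Num.sqrt (a2 (tshift k e) / vinf v' (tshift k e)))| <=
    incr_const * (delta + 1) `^ (s / 2) * envelope (tshift k e).
  move=> u'U v'U u'v' dd'; apply: g_incr.
  - exact: (wpart_ge q_gt0 p_gt0 ulo_gt0 rho0_lt1 k (obs2_ge0 e) N.+1 u'U).
  - exact: vinf_ge.
  - by rewrite addr_ge0.
  - rewrite vinf_tshift.
    apply: le_trans (path_variance_close (a := fun k => a2 (tshift k e)) q_gt0 p_gt0 ulo_gt0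
      ulohi thetaU rho0_ge0
      rho0_lt1 r_gt0 r_lt1 kap_gt kap_r gp (aS k) u'U v'U u'v' (ltn0Sn N)) _.
    rewrite ler_wpM2r ?powR_ge0// ler_wpM2l// lerD//.
    by rewrite exprn_ile1// ltW.
  - exact: (path_ratio_wpart (a := fun k => a2 (tshift k e)) q_gt0 p_gt0 ulo_gt0 ulo_lt1 ulohi thetaU
      rho0_lt1 gp u'U (ltnSn N) (ebig k)).
  - rewrite vinf_tshift.
    exact: (path_ratio_winf (a := fun k => a2 (tshift k e)) q_gt0 p_gt0 ulo_gt0 ulo_lt1 ulohi thetaU rho0_ge0
      rho0_lt1 r_gt0 r_lt1 kap_gt kap_r gp (aS k) v'U (ebig k)).
have uu : par_close 0 u u by move=> i; rewrite subrr normr0.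
have A1 := step _ _ _ uU uU uu d0; have A2 := step _ _ _ uU vU uv (lexx delta).
rewrite -(subrKA (g h (e k) (Num.sqrt (a2 (tshift k e) / wpart (obs2 e) k u N.+1)))).
apply: le_trans (ler_normD _ _) _.
rewrite -mulrA mulr2n mulrDl !mul1r; apply: lerD; last exact: A2.
by rewrite distrC; exact: A1.
Qed.

End Good.

Definition ratio u om : R := Num.sqrt (a2 om / vinf u om).

(** The limiting increment of the log-likelihood between [theta] and [u]. *)
Definition contrast u om : R := g h (om 0) (ratio u om) - g h (om 0) 1.

Lemma measurable_ratio u : U u -> measurable_fun setT (ratio u).
Proof.
move=> uU; apply: (measurableT_comp (f := @Num.sqrt R) (g := fun om => a2 om / vinf u om)).
  by apply: continuous_measurable_fun; exact: sqrt_continuous.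
apply: measurable_funM => //.
apply: measurable_inv_nneg; last exact: measurable_vinf.
by move=> om; apply: le_trans (ltW ulo_gt0) _; exact: vinf_ge.
Qed.

Lemma ratio_depends u : depends_on (fun k : int => k < 0) (ratio u).
Proof. by move=> om om' H; rewrite /ratio (vinf_depends u H) (sig2_depends theta H). Qed.

Lemma measurable_g : measurable_fun setT (fun x : R * R => g h x.1 x.2).
Proof.
apply: (measurableT_comp (@measurable_ln R)); apply: measurable_funM => //.
by apply: (measurableT_comp h_meas); exact: measurable_funM.
Qed.

Let gdiff (x : R * R) : R := g h x.1 x.2 - g h x.1 1.

Let mgdiff : measurable_fun setT gdiff.
Proof.
apply: measurable_funB; first exact: measurable_g.
apply: (measurableT_comp (f := fun x : R * R => g h x.1 x.2) measurable_g
  (g := fun x : R * R => (x.1, 1))).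
exact: measurable_fun_pair.
Qed.

Lemma measurable_contrast u : U u -> measurable_fun setT (contrast u).
Proof.
move=> uU; apply: (measurableT_comp (f := gdiff) mgdiff (g := fun om : seqspace R => (om 0, ratio u om))).
by apply: measurable_fun_pair; [exact: measurable_coord|exact: measurable_ratio].
Qed.

Let mmem : measurable_fun setT Q.
Proof. exact: (measurable_memory ulo_gt0 thetaU). Qed.

Lemma measurable_envelope : measurable_fun setT envelope.
Proof.
apply: measurable_funM.
  by apply: (measurableT_comp C1_meas); exact: measurable_coord.
apply: measurable_funD => //; apply: measurable_funD => //.
exact: measurable_recent_inverse.
Qed.

Lemma envelope_ge0 om : 0 <= envelope om.
Proof.
rewrite /envelope mulr_ge0 ?(g1_bound_ge0 g1_le)// !addr_ge0//.
- exact: recent_inverse_ge0.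
- exact: memory_ge0.
Qed.

(** The current innovation is independent of the past, on which the other factor
    depends. *)
Lemma envelope_moment : (\int[P]_w (envelope (path w))%:E < +oo)%E.
Proof.
pose F om : \bar R := (C1 (om 0))%:E.
pose Z om : \bar R := (1 + recent_inverse mu N om + Q om)%:E.
have mF : measurable_fun setT F.
  apply/measurable_EFinP; apply: (measurableT_comp C1_meas); exact: measurable_coord.
have mZ : measurable_fun setT Z.
  apply/measurable_EFinP; apply: measurable_funD => //; apply: measurable_funD => //.
  exact: measurable_recent_inverse.
have F0 om : (0 <= F om)%E by rewrite lee_fin (g1_bound_ge0 g1_le).
have Z0 om : (0 <= Z om)%E.
  by rewrite lee_fin !addr_ge0 ?memory_ge0 ?recent_inverse_ge0.
rewrite (eq_integral (fun w => F (path w) * Z (path w)))%E//.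
have IJ (k : int) : k == 0 -> k < 0 -> False by move=> /eqP ->.
have Fdep : depends_on (fun k : int => k == 0) F by move=> om om' H; rewrite /F H.
have Zdep : depends_on (fun k : int => k < 0) Z.
  move=> om om' H; rewrite /Z.
  have -> : Q om = Q om' by exact: memory_depends H.
  have -> : recent_inverse mu N om = recent_inverse mu N om'.
    by apply: recent_inverse_depends => k /andP[_ k0]; exact: H.
  by [].
rewrite (depends_on_integralM eps_iid IJ Fdep Zdep mF mZ F0 Z0).
apply: lte_mul_pinfty => //.
- exact: integral_ge0.
- by rewrite ge0_fin_numE//; exact: integral_ge0.
- rewrite (eq_integral (fun w => (1 + (recent_inverse mu N (path w))%:E) + (Q (path w))%:E))%E//.
  have mR : measurable_fun setT (fun w => (recent_inverse mu N (path w))%:E).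
    apply/measurable_EFinP; apply: (measurableT_comp (measurable_recent_inverse mu N)).
    exact: mpath.
  have mQ : measurable_fun setT (fun w => (Q (path w))%:E).
    by apply/measurable_EFinP; exact: (measurableT_comp mmem mpath).
  rewrite ge0_integralD//; last 3 first.
  + by move=> w _; rewrite adde_ge0// lee_fin recent_inverse_ge0.
  + exact: emeasurable_funD.
  + by move=> w _; rewrite lee_fin memory_ge0.
  rewrite ge0_integralD//; last by move=> w _; rewrite lee_fin recent_inverse_ge0.
  rewrite integral_cst//= mul1e probability_setT lte_add_pinfty//.
  by rewrite lte_add_pinfty// ltry.
Qed.

Lemma integrable_envelope : P.-integrable setT (EFin \o (envelope \o path)).
Proof.
apply/integrableP; split.
  by apply/measurable_EFinP; exact: (measurableT_comp measurable_envelope mpath).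
rewrite (eq_integral (fun w => (envelope (path w))%:E)); first exact: envelope_moment.
by move=> w _; rewrite /= ger0_norm ?envelope_ge0.
Qed.

Lemma good_ratio_true e k : good e -> ratio theta (tshift k e) = 1.
Proof.
move=> ge; rewrite /ratio vinf_tshift -good_sig2// divff ?sqrtr1// gt_eqF//.
by apply: lt_le_trans ulo_gt0 _; exact: good_sig2_ge.
Qed.

Let U_close u v : U u -> U v -> par_close (uhi - ulo) u v.
Proof.
move=> [_ uU] [_ vU] i; have /andP[u1 u2] := uU i; have /andP[v1 v2] := vU i.
by rewrite ler_norml; apply/andP; split; lra.
Qed.

Lemma good_contrast_le u e k : U u -> good e ->
  `|contrast u (tshift k e)| <=
    2 * (incr_const * (uhi - ulo + 1) `^ (s / 2)) * envelope (tshift k e).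
Proof.
move=> uU ge; have := good_contrast_increment ge k uU thetaU (U_close uU thetaU).
have E := good_ratio_true k ge; rewrite /ratio in E; rewrite E.
have -> // : contrast u (tshift k e) =
  g h (e k) (Num.sqrt (a2 (tshift k e) / vinf u (tshift k e))) - g h (e k) 1.
by rewrite /contrast /tshift /relabel add0r.
Qed.

Lemma integrable_contrast u : U u -> P.-integrable setT (EFin \o (contrast u \o path)).
Proof.
move=> uU; pose K := 2 * (incr_const * (uhi - ulo + 1) `^ (s / 2)).
have K0 : 0 <= K by rewrite mulr_ge0// mulr_ge0 ?incr_const_ge0 ?powR_ge0.
have mc : measurable_fun setT (EFin \o (contrast u \o path)).
  by apply/measurable_EFinP; exact: (measurableT_comp (measurable_contrast uU) mpath).
apply/integrableP; split=> //.
apply: (@le_lt_trans _ _ (\int[P]_w (K%:E * (envelope (path w))%:E))%E).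
  apply: ae_ge0_le_integral => //.
  - exact: measurableT_comp.
  - by move=> w _; rewrite mule_ge0// lee_fin envelope_ge0.
  - apply: measurable_funeM.
    by apply/measurable_EFinP; exact: (measurableT_comp measurable_envelope mpath).
  apply: filterS good_ae => w gw _; rewrite -EFinM lee_fin.
  by have := good_contrast_le 0 uU gw; rewrite tshift0.
rewrite ge0_integralZl//.
- apply: lte_mul_pinfty => //; exact: envelope_moment.
- by apply/measurable_EFinP; exact: (measurableT_comp measurable_envelope mpath).
- by move=> w _; rewrite lee_fin envelope_ge0.
Qed.

Lemma good_split u e n : U u -> good e ->
  vinf u e = ccoef u 0 + \sum_(0 <= j < n) ccoef u j.+1 * obs2 e (0 - j.+1%:Z)
    + rsum (fun j => ccoef u (n + j).+1 * obs2 e (0 - (n + j).+1%:Z)).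
Proof.
move=> uU ge; have zS := good_obs_sum ge 0.
rewrite /vinf /winf -addrA; congr (_ + _).
apply: (@rsum_split _ _ n (winf (obs2 e) 0 u - ccoef u 0)) => [i|m]; first exact: vterm_ge0.
have := wpart_le_winf q_gt0 p_gt0 ulo_gt0 ulohi rho0_ge0
  rho0_lt1 r_gt0 r_lt1 kap_gt kap_r (obs2_ge0 e) zS m.+1 uU.
by rewrite lerBrDl {1}/wpart big_add1.
Qed.

Hypothesis theta_coprime : coprimep (alpha_poly theta) (beta_poly theta).
Hypothesis eps_nondegenerate : nondegenerate_rv P (fun w => eps 0 w ^+ 2).

(** If the coefficients of [u] and [theta] differ, the first squared
    observation at which they do is determined by the earlier innovations,
    although its own innovation is independent of them. *)
Theorem vinf_identifiable u : U u ->
  {ae P, forall w, vinf u (path w) = vinf theta (path w)} -> u = theta.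
Proof.
move=> uU uth.
have cE i : ccoef u i.+1 = ccoef theta i.+1.
  apply: contrapT => neq; apply: eps_nondegenerate.
  have ex : exists i, ccoef u i.+1 != ccoef theta i.+1 by exists i; apply/eqP.
  have [n nn nmin] := ex_minnP ex.
  have {}nmin j : (j < n)%N -> ccoef u j.+1 = ccoef theta j.+1.
    move=> jn; apply/eqP; rewrite -[_ == _]negbK; apply/negP => /nmin.
    by rewrite leqNgt jn.
  pose tail v om := rsum (fun j => ccoef v (n.+1 + j).+1 * obs2 om (0 - (n.+1 + j).+1%:Z)).
  pose dc := ccoef u n.+1 - ccoef theta n.+1.
  have dc0 : dc != 0 by rewrite subr_eq0.
  pose Z om := (ccoef theta 0 - ccoef u 0 + (tail theta om - tail u om)) / dc
    * (a2 (tshift (- n.+1%:Z) om))^-1.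
  pose X om : R := om (- n.+1%:Z) ^+ 2.
  have mX : measurable_fun setT (X : seqspace R -> R).
    by apply: measurable_funX; exact: measurable_coord.
  have mtail v : U v -> measurable_fun setT (tail v).
    move=> vU; apply: (measurable_rsum (f := fun j om =>
      ccoef v (n.+1 + j).+1 * obs2 om (0 - (n.+1 + j).+1%:Z))).
      by move=> j om; exact: vterm_ge0.
    by move=> j; apply: measurable_funM => //; exact: measurable_obs2.
  have mZ : measurable_fun setT Z.
    apply: measurable_funM.
      apply: measurable_funM => //; apply: measurable_funD => //.
      by apply: measurable_funB; exact: mtail.
    apply: measurable_inv_nneg; first by move=> om; exact: (sig2_ge0 ulo_gt0 thetaU).
    by apply: (measurableT_comp msig2); exact: measurable_tshift.
  have Xdep : depends_on (fun k : int => k == - n.+1%:Z) X by move=> om om' H; rewrite /X H.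
  have tdep v om om' : (forall k : int, k < - n.+1%:Z -> om k = om' k) -> tail v om = tail v om'.
    move=> H; rewrite /tail.
    have -> : (fun j => ccoef v (n.+1 + j).+1 * obs2 om (0 - (n.+1 + j).+1%:Z)) =
        (fun j => ccoef v (n.+1 + j).+1 * obs2 om' (0 - (n.+1 + j).+1%:Z)).
      apply/funext => j; congr (_ * _); apply: obs2_depends => i' ij; apply: H.
      by clear -ij; lia.
    by [].
  have Zdep : depends_on (fun k : int => k < - n.+1%:Z) Z.
    move=> om om' H; rewrite /Z (tdep u _ _ H) (tdep theta _ _ H).
    have -> : a2 (tshift (- n.+1%:Z) om) = a2 (tshift (- n.+1%:Z) om').
      by apply: sig2_depends => k k0; apply: H; clear -k0; lia.
    by [].
  have IJ (k : int) : k == - n.+1%:Z -> k < - n.+1%:Z -> False.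
    by move=> /eqP ->; rewrite ltxx.
  have mXp : measurable_fun setT (X \o path) by exact: (measurableT_comp mX mpath).
  have mZp : measurable_fun setT (Z \o path) by exact: (measurableT_comp mZ mpath).
  have XZ : {ae P, forall w, (X \o path) w = (Z \o path) w}.
    apply: filterS2 uth good_ae => w E ge.
    have a0 : 0 < a2 (tshift (- n.+1%:Z) (path w)).
      by apply: lt_le_trans ulo_gt0 _; exact: good_sig2_ge.
    move: E; rewrite (good_split n.+1 uU ge) (good_split n.+1 thetaU ge).
    rewrite -!/(tail _ _) !big_nat_recr//=.
    have -> : \sum_(0 <= j < n) ccoef u j.+1 * obs2 (path w) (0 - j.+1%:Z) =
        \sum_(0 <= j < n) ccoef theta j.+1 * obs2 (path w) (0 - j.+1%:Z).
      by rewrite !big_mkord; apply: eq_bigr => j _; rewrite nmin.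
    have -> : obs2 (path w) (0 - n.+1%:Z) = a2 (tshift (- n.+1%:Z) (path w)) * X (path w).
      by rewrite /obs2 sub0r.
    rewrite /Z /=; move: (\sum_(_ <= _ < _) _) => Sm.
    move: (tail u _) (tail theta _) (X _) (a2 _) a0 => tu tt x a a0.
    move: dc0; rewrite /dc; move: (ccoef u n.+1) (ccoef theta n.+1) (ccoef u 0) (ccoef theta 0).
    move=> cu ct u0 t0 dcn E.
    apply: (mulIf (lt0r_neq0 a0)); rewrite divfK ?gt_eqF//.
    apply: (mulIf dcn); rewrite divfK//.
    by apply/eqP; rewrite -subr_eq0; apply/eqP; move/eqP: E; rewrite -subr_eq0 => /eqP <-; ring.
  have [c cP] := indep_eq_const mXp mZp (depends_on_indep eps_iid IJ Xdep Zdep mX mZ) XZ.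
  exists c; pose B := [set x : R | x ^+ 2 != c].
  have mB : measurable B.
    have -> : B = ~` ((fun x : R => x ^+ 2) @^-1` [set c]).
      by apply/seteqP; split=> x /= /eqP.
    apply: measurableC; rewrite -[X in measurable X]setTI.
    by apply: exprn_measurable => //; exact: measurable_set1.
  have PB k : measurable (eps k @^-1` B).
    by rewrite -[X in measurable X]setTI; exact: measurable_funP.
  have B0 : P (eps (- n.+1%:Z) @^-1` B) = 0%E.
    have [M [mM M0 sub]] := cP.
    apply/eqP; rewrite eq_le measure_ge0 andbT -M0; apply: le_measure; rewrite ?inE//.
    by move=> w /= /eqP nc; apply: sub.
  exists (eps 0 @^-1` B); split=> //.
  - by rewrite (proj2 eps_iid 0 (- n.+1%:Z) B mB).
  - by move=> w /= /eqP.
apply: (ccoef_inj p_gt0 ulo_gt0 rho0_lt1 uU thetaU theta_coprime) => -[|i]; last exact: cE.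
have [w] := ae_exists uth; rewrite /vinf /winf.
have -> : (fun i : nat => ccoef u i.+1 * obs2 (path w) (0 - i.+1%:Z)) =
    (fun i : nat => ccoef theta i.+1 * obs2 (path w) (0 - i.+1%:Z)).
  by apply/funext => i; rewrite cE.
by apply: addIr.
Qed.

Hypothesis g_int : forall t, 0 < t -> P.-integrable setT (fun w => (g h (eps 0 w) t)%:E).
Hypothesis g_max : forall t, 0 < t -> t != 1 ->
  (\int[P]_w (g h (eps 0%R w) t)%:E < \int[P]_w (g h (eps 0%R w) 1)%:E)%E.

Let gpos (x : R * R) : \bar R := maxe (gdiff x)%:E 0.
Let gneg (x : R * R) : \bar R := (maxe (- (gdiff x)%:E) 0)%E.

Let mgpos : measurable_fun setT gpos.
Proof. by apply: measurable_maxe => //; apply/measurable_EFinP. Qed.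
Let mgneg : measurable_fun setT gneg.
Proof. by apply: measurable_maxe => //; apply: measurableT_comp => //; apply/measurable_EFinP. Qed.

(** Given the past, the mean of the contrast is [E g (eps, t) - E g (eps, 1)] at
    [t = ratio u], which is negative unless the ratio is [1]. If the whole mean
    vanished, the ratio would be [1] almost surely, which identifies [u].
    Positive and negative parts are integrated separately, for Tonelli's
    theorem. *)
Theorem contrast_neg u : U u -> u != theta -> (\int[P]_w (contrast u (path w))%:E < 0)%E.
Proof.
move=> uU uth.
pose f w : R := eps 0 w; pose z w : R := ratio u (path w).
have mcoord0 : measurable_fun setT (fun om : seqspace R => om 0) by exact: measurable_coord.
have IJ (k : int) : k == 0 -> k < 0 -> False by move=> /eqP ->; rewrite ltxx.
have fdep : depends_on (fun k : int => k == 0) (fun om : seqspace R => om 0).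
  by move=> om om' H; exact: H.
have mz : measurable_fun setT z by exact: (measurableT_comp (measurable_ratio uU) mpath).
have mf : measurable_fun setT f by [].
have indep A B : measurable A -> measurable B ->
    (P (f @^-1` A `&` z @^-1` B) = P (f @^-1` A) * P (z @^-1` B))%E.
  exact: (depends_on_indep eps_iid IJ fdep (ratio_depends u) mcoord0 (measurable_ratio uU)).
have gp0 x : (0 <= gpos x)%E by rewrite /gpos le_max lexx orbT.
have gn0 x : (0 <= gneg x)%E by rewrite /gneg le_max lexx orbT.
have [mA EA] := joint_law_fubini mf mz indep mgpos gp0.
have [mB EB] := joint_law_fubini mf mz indep mgneg gn0.
pose A (v : T) := (\int[P]_w gpos (f w, z v))%E; pose B (v : T) := (\int[P]_w gneg (f w, z v))%E.
have A0 (v : T) : (0 <= A v)%E by exact: integral_ge0.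
have B0 (v : T) : (0 <= B v)%E by exact: integral_ge0.
have AB : {ae P, forall w, [/\ (A w <= B w)%E, A w \is a fin_num, B w \is a fin_num
    & (A w = B w -> z w = 1)]}.
  apply: filterS good_ae => v gv.
  have zv : 0 < z v.
    rewrite /z /ratio sqrtr_gt0 divr_gt0//; last by apply: lt_le_trans ulo_gt0 _; exact: vinf_ge.
    by apply: lt_le_trans ulo_gt0 _; have := good_sig2_ge gv 0; rewrite tshift0.
  have [z1|z1] := eqVneq (z v) 1.
    have D0 w : gdiff (f w, z v) = 0 by rewrite /gdiff /= z1 subrr.
    have -> : A v = 0%E.
      by rewrite /A (eq_integral (cst 0%E)) ?integral0// => w _; rewrite /gpos D0 maxxx.
    have -> : B v = 0%E.
      by rewrite /B (eq_integral (cst 0%E)) ?integral0// => w _; rewrite /gneg D0 oppe0 maxxx.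
    by split.
  have iD : P.-integrable setT (fun w => (gdiff (f w, z v))%:E).
    rewrite (_ : (fun w => _) = (fun w => (g h (eps 0 w) (z v))%:E) \- (fun w => (g h (eps 0 w) 1)%:E))%E//.
    by apply: integrableB => //; exact: g_int.
  have D0 : (\int[P]_w (gdiff (f w, z v))%:E < 0)%E.
    rewrite (eq_integral (fun w => (g h (eps 0%R w) (z v))%:E - (g h (eps 0%R w) 1)%:E)%E)//.
    rewrite integralB_EFin//; [|exact: g_int|exact: g_int].
    rewrite sube_lt0; first exact: g_max.
    by rewrite (integrable_fin_num _ (g_int _)).
  have [DE fA fB] := integral_posneg iD.
  have lt : (A v < B v)%E.
    rewrite DE in D0; rewrite -sube_lt0; first exact: D0.
    by apply/orP; left; exact: fA.
  split; [exact: ltW|exact: fA|exact: fB|].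
  by move=> AB; move: lt; rewrite AB ltxx.
have iC := integrable_contrast uU.
have [CE fp fn] := integral_posneg iC.
have IA : (\int[P]_v A v)%E \is a fin_num by rewrite -EA; exact: fp.
rewrite ltNge; apply/negP => C0.
have C0' : (\int[P]_v B v <= \int[P]_v A v)%E.
  rewrite -EA -EB -sube_ge0; last by apply/orP; right; exact: fp.
  by apply: le_trans C0 _; rewrite le_eqVlt; apply/orP; left; apply/eqP; exact: CE.
have AB' : {ae P, forall w, [/\ (A w <= B w)%E, A w \is a fin_num & B w \is a fin_num]}.
  by apply: filterS AB => w [le fA fB _]; split.
have AeqB := ae_eq_of_integral_le mA mB A0 B0 AB' IA C0'.
case/eqP: uth; apply: vinf_identifiable => //.
apply: filterS3 AeqB AB good_ae => w D1 [_ _ _ AB1] gw.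
have : z w = 1 by exact: AB1.
have a0 : 0 < a2 (path w).
  by apply: lt_le_trans ulo_gt0 _; have := good_sig2_ge gw 0; rewrite tshift0.
have v0 : 0 < vinf u (path w) by apply: lt_le_trans ulo_gt0 _; exact: vinf_ge.
have av := divr_ge0 (ltW a0) (ltW v0).
rewrite /z /ratio => z1; have := sqr_sqrtr av; rewrite z1 expr1n => /esym /divr1_eq E.
rewrite -E; have a2E := good_sig2 gw 0; rewrite tshift0 in a2E; exact: a2E.
Qed.

(** The contribution of the time [k] to the log-likelihood at [u] relative to
    [theta], when only the observations after time [0] are available. *)
Definition gain (e : seqspace R) u (k : nat) : R :=
  g h (e k%:Z) (Num.sqrt (a2 (tshift k%:Z e) / wpart (obs2 e) k%:Z u k))
  - g h (e k%:Z) (Num.sqrt (a2 (tshift k%:Z e) / wpart (obs2 e) k%:Z theta k)).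

Let gain_bounded e k : good e -> exists b : R, forall u, U u -> `|gain e u k| <= b.
Proof.
move=> ge; have zS := good_obs_sum ge k%:Z.
pose S := Q (tshift k%:Z e) `^ s^-1 / ulo.
have S0 : 0 <= S by rewrite divr_ge0 ?powR_ge0// ltW.
pose a := a2 (tshift k%:Z e).
have a0 : 0 < a by apply: lt_le_trans ulo_gt0 (good_sig2_ge ge k%:Z).
pose dist := (c0_lip q uhi rho0 + ccoef_lip p q uhi rho0 (r ^+ 2) kap * S) * (uhi - ulo).
exists (C1 (e k%:Z) * ((a / ulo) `^ (nu / 2) + 1) * (1^-1 * (dist / ulo) `^ 1)) => u uU.
have wge v : U v -> ulo <= wpart (obs2 e) k%:Z v k.
  by move=> vU; exact: (wpart_ge q_gt0 p_gt0 ulo_gt0 rho0_lt1 k%:Z (obs2_ge0 e) k vU).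
have aw v : U v -> a / wpart (obs2 e) k%:Z v k <= a / ulo.
  move=> vU; rewrite ler_wpM2l ?(ltW a0)// lef_pV2 ?posrE ?wge//.
  exact: lt_le_trans (wge _ vU).
apply: le_trans (g_sqrt_ratio h_diff nu_ge0 g1_le (e k%:Z) a0 ulo_gt0 (wge _ uU) (wge _ thetaU)
  (aw _ uU) (aw _ thetaU) ltr01 (lexx 1)) _.
rewrite ler_wpM2l ?mulr_ge0 ?addr_ge0 ?powR_ge0 ?(g1_bound_ge0 g1_le)//.
rewrite invr1 !mul1r; apply: ge0_ler_powR; rewrite ?nnegrE//.
- by rewrite divr_ge0// ltW.
- apply: divr_ge0 (ltW ulo_gt0); apply: mulr_ge0; last by rewrite subr_ge0 ltW.
  apply: addr_ge0; first exact: (c0_lip_ge0 q ulo_gt0 ulohi rho0_lt1).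
  apply: mulr_ge0; last exact: S0.
  by apply: (ccoef_lip_ge0 p q ulo_gt0 ulohi _ rho0_ge0 kap_gt); exact: exprn_gt0.
rewrite ler_wpM2r ?invr_ge0 ?(ltW ulo_gt0)//.
exact: (wpart_close q_gt0 p_gt0 ulo_gt0 ulohi rho0_ge0
  rho0_lt1 r_gt0 r_lt1 kap_gt kap_r (obs2_ge0 e) zS k uU thetaU (U_close uU thetaU)).
Qed.

Let gain_le e u u0 delta k : good e -> U u -> U u0 -> par_close delta u u0 ->
  (N < k)%N -> r ^+ k <= delta ->
  gain e u k <= contrast u0 (tshift k%:Z e)
    + 2 * (incr_const * (2 * delta) `^ (s / 2)) * envelope (tshift k%:Z e).
Proof.
move=> ge uU u0U uu0 Nk rk.
have d0 : 0 <= delta by apply: le_trans rk; rewrite exprn_ge0// ltW.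
have tt : par_close 0 theta theta by move=> i; rewrite subrr normr0.
have A1 := good_increment ge uU u0U uu0 Nk.
have A2 := good_increment ge thetaU thetaU tt Nk.
have rt := good_ratio_true k%:Z ge; rewrite /ratio in rt; rewrite rt in A2.
have cE : contrast u0 (tshift k%:Z e) =
    g h (e k%:Z) (Num.sqrt (a2 (tshift k%:Z e) / vinf u0 (tshift k%:Z e))) - g h (e k%:Z) 1.
  by rewrite /contrast /tshift /relabel add0r.
have s20 : 0 <= s / 2 by rewrite divr_ge0// ltW.
have mono x : 0 <= x -> x <= 2 * delta ->
    incr_const * x `^ (s / 2) * envelope (tshift k%:Z e) <=
    incr_const * (2 * delta) `^ (s / 2) * envelope (tshift k%:Z e).
  move=> x0 xd; rewrite ler_wpM2r ?envelope_ge0// ler_wpM2l ?incr_const_ge0//.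
  by apply: ge0_ler_powR; rewrite ?nnegrE//; exact: (mulr_ge0 (ler0n _ 2) d0).
have rk0 : 0 <= r ^+ k by rewrite exprn_ge0// ltW.
have M1 : delta + r ^+ k <= 2 * delta by rewrite mulr_natl mulr2n lerD2l.
have M2 : 0 + r ^+ k <= 2 * delta by rewrite add0r (le_trans rk)// ler_peMl// ler1n.
have B1 := le_trans A1 (mono _ (addr_ge0 d0 rk0) M1).
have B2 := le_trans A2 (mono _ (addr_ge0 (lexx 0) rk0) M2).
move: B1 B2; rewrite !ler_norml => /andP[_ B1] /andP[B2 _].
rewrite cE /gain -[2 * _ * envelope _]mulrA.
move: B1 B2; move: (incr_const * _ * envelope _) => X B1 B2; lra.
Qed.

(** Near [u0] the gains are dominated, uniformly in [u], by the contrast at [u0]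
    plus a small multiple of the envelope. This stationary functional has a mean
    so negative that its Birkhoff sums stay bounded even after a positive drift
    is added at each time; hence the sums of the gains tend to minus infinity. *)
Theorem local_gain_neg u0 : U u0 -> u0 != theta -> exists2 delta, 0 < delta &
  {ae P, forall w, exists n0, forall n u, (n0 <= n)%N -> U u -> par_close delta u u0 ->
    \sum_(2 <= k < n.+1) gain (path w) u k < 0}.
Proof.
move=> u0U u0th; have Cneg := contrast_neg u0U u0th.
have iC := integrable_contrast u0U; have iE := integrable_envelope.
pose drift := - fine (\int[P]_w (contrast u0 (path w))%:E)%E.
pose V := fine (\int[P]_w (envelope (path w))%:E)%E.
have IE : (\int[P]_w (contrast u0 (path w))%:E = (- drift)%R%:E)%E.
  rewrite /drift opprK fineK//; exact: (integrable_fin_num measurableT iC).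
have VE : (\int[P]_w (envelope (path w))%:E = V%:E)%E.
  rewrite /V fineK//; exact: (integrable_fin_num measurableT iE).
have drift0 : 0 < drift by move: Cneg; rewrite IE lte_fin oppr_lt0.
have V0 : 0 <= V.
  by rewrite -lee_fin -VE; apply: integral_ge0 => w _; rewrite lee_fin envelope_ge0.
have K0 := incr_const_ge0.
(* with this [delta] the envelope costs at most a quarter of the drift *)
pose x := drift / 4 / (2 * incr_const * V + 1).
have den0 : 0 < 2 * incr_const * V + 1 by rewrite ltr_wpDl//; exact: (mulr_ge0 (mulr_ge0 (ler0n _ 2) K0) V0).
have x0 : 0 < x by rewrite !divr_gt0.
pose delta := x `^ (s / 2)^-1 / 2.
have delta0 : 0 < delta by rewrite divr_gt0 ?powR_gt0.
have s20 : 0 < s / 2 by rewrite divr_gt0.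
have dx : (2 * delta) `^ (s / 2) = x.
  by rewrite /delta mulrC divfK// -powRrM mulVf ?gt_eqF// powRr1// ltW.
exists delta => //.
pose c := 2 * (incr_const * x).
have cV : c * V <= drift / 4.
  rewrite /c (_ : 2 * _ * V = 2 * incr_const * V * x); last by ring.
  rewrite /x mulrCA ler_piMr//; first by rewrite divr_ge0// ltW.
  by rewrite ler_pdivrMr// mul1r lerDl.
pose F om := contrast u0 om + (c * envelope om + drift / 4).
have mF : measurable_fun setT F.
  apply: measurable_funD; first exact: measurable_contrast.
  by apply: measurable_funD => //; apply: measurable_funM => //; exact: measurable_envelope.
have iEc : P.-integrable setT (fun w => (c * envelope (path w))%:E).
  rewrite (_ : (fun w => _) = (fun w => c%:E * (EFin \o (envelope \o path)) w)%E)//.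
  exact: integrableZl.
have iI : P.-integrable setT (EFin \o cst (drift / 4) : T -> \bar R).
  exact: finite_measure_integrable_cst.
have iG : P.-integrable setT (fun w => (c * envelope (path w) + drift / 4)%:E).
  rewrite (_ : (fun w => _) = (fun w => (c * envelope (path w))%R%:E) \+ (EFin \o cst (drift / 4)%R))%E//.
  exact: integrableD.
have iF : P.-integrable setT (EFin \o (F \o path)).
  rewrite (_ : _ \o _ = (EFin \o (contrast u0 \o path)) \+ (fun w => (c * envelope (path w) + drift / 4)%R%:E))%E//.
  exact: integrableD.
have F0 : (\int[P]_w (F (path w))%:E < 0)%E.
  have -> : (\int[P]_w (F (path w))%:E = \int[P]_w (contrast u0 (path w))%:E
      + (\int[P]_w (c * envelope (path w))%R%:E + \int[P]_w (drift / 4)%R%:E))%E.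
    rewrite -(integralD measurableT iEc iI).
    rewrite -(integralD measurableT iC iG).
    by [].
  have -> : (\int[P]_w (c * envelope (path w))%R%:E = (c * V)%R%:E)%E.
    rewrite (eq_integral (fun w => c%:E * (EFin \o (envelope \o path)) w)%E)//.
    rewrite (integralZl measurableT iE) [RHS]EFinM.
    by apply: (f_equal (fun z => c%:E * z)%E); exact: VE.
  rewrite IE integral_cst//= probability_setT mule1 -!EFinD lte_fin.
  by move: cV drift0; move: (c * V) => y; lra.
have B := iid_birkhoff eps_iid mF iF F0.
have rl : `|r| < 1 by rewrite ger0_norm// ltW.
have [n1 rn1] : exists n1, forall k, (n1 <= k)%N -> r ^+ k <= delta.
  have /cvgrPdist_le /(_ _ delta0) := cvg_expr rl.
  move=> [n1 _ H]; exists n1 => k nk; have := H k nk.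
  by rewrite /= sub0r normrN; apply: le_trans; exact: ler_norm.
pose k0 := (maxn 2 (maxn N.+1 n1)).
apply: filterS2 B good_ae => w [B HB] gw.
(* the bound on the gains only holds from [k0] on; the earlier gains are
   bounded uniformly in [u] *)
have [b Hb] : exists b : nat -> R, forall k u, U u -> `|gain (path w) u k| <= b k.
  have /choice[b Hb] : forall k, exists b, forall u, U u -> `|gain (path w) u k| <= b.
    by move=> k; exact: gain_bounded.
  by exists b => k u; exact: Hb.
pose X := \sum_(2 <= k < k0) b k - \sum_(k < k0) F (tshift k%:Z (path w)) + B.
pose n2 := Num.bound (X / (drift / 4)).
exists (k0 + n2)%N => n u nn uU uu0.
have I40 : 0 < drift / 4 by rewrite divr_gt0.
have k0n : (k0 <= n.+1)%N by apply: leq_trans (leqW nn); rewrite leq_addr.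
have k02 : (2 <= k0)%N by rewrite leq_maxl.
rewrite (big_cat_nat (n := k0))//=.
have S1 : \sum_(2 <= k < k0) gain (path w) u k <= \sum_(2 <= k < k0) b k.
  by apply: ler_sum => k _; apply: le_trans (ler_norm _) (Hb k u uU).
have S2 : \sum_(k0 <= k < n.+1) gain (path w) u k <=
    \sum_(k0 <= k < n.+1) (F (tshift k%:Z (path w)) - drift / 4).
  rewrite big_nat_cond [leRHS]big_nat_cond; apply: ler_sum => k.
  rewrite andbT => /andP[k0k _].
  have Nk : (N < k)%N by apply: leq_trans k0k; rewrite /k0 !leq_max leqnn orbT.
  have n1k : (n1 <= k)%N by apply: leq_trans k0k; rewrite /k0 !leq_max leqnn !orbT.
  have := gain_le gw uU u0U uu0 Nk (rn1 k n1k); rewrite dx -/c => H.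
  by apply: le_trans H _; rewrite /F addrA addrK.
rewrite [leRHS]sumrB sumr_const_nat in S2.
have S3 : \sum_(k0 <= k < n.+1) F (tshift k%:Z (path w)) =
    \sum_(k < n.+1) F (tshift k%:Z (path w)) - \sum_(k < k0) F (tshift k%:Z (path w)).
  rewrite -!(big_mkord xpredT (fun k => F (tshift k%:Z (path w)))).
  by rewrite (big_cat_nat (leq0n k0) k0n) /= [RHS]addrAC subrr add0r.
rewrite S3 in S2; have S4 := HB n.+1.
have X1 : X < (n.+1 - k0)%:R * (drift / 4).
  rewrite -ltr_pdivrMr//; apply: le_lt_trans (ler_norm _) _.
  apply: lt_le_trans (archi_boundP (normr_ge0 _)) _.
  rewrite ler_nat /Num.bound normr_id -/(Num.bound _).
  have : (n2 <= n.+1 - k0)%N by rewrite leq_subRL// leqW.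
  by rewrite /n2 /Num.bound.
rewrite -[_ *+ _]mulr_natl in S2; rewrite /X in X1.
lra.
Qed.

End Contrast.

(** * Compactness and consistency *)

Section BoxCovering.
Variables (R : realType) (n : nat) (lo hi : R).
Implicit Types (u v : 'rV[R]_n) (A : set 'rV[R]_n).

(** Compactness of a box as an induction principle. If the conclusion failed,
    the complements of the sets with the property would generate a proper filter
    on the box, and the property would fail near its cluster point. *)
Lemma box_property (B : set 'rV[R]_n -> Prop) :
  B set0 -> (forall A A', A `<=` A' -> B A' -> B A) ->
  (forall A A', B A -> B A' -> B (A `|` A')) ->
  (forall u, (forall k, lo <= u ord0 k <= hi) ->
     exists2 delta, 0 < delta & B [set v : 'rV[R]_n | forall k, `|v ord0 k - u ord0 k| <= delta]) ->
  B [set u : 'rV[R]_n | forall k, lo <= u ord0 k <= hi].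
Proof.
move=> B0 Bsub BU Bloc; pose K := [set u : 'rV[R]_n | forall k, lo <= u ord0 k <= hi]; rewrite -/K; apply: contrapT => nBK.
have cK : compact K.
  have -> : K = [set u : 'rV[R]_n | forall k, `[lo, hi]%classic (u ord0 k)].
    by apply/seteqP; split=> u H k; have := H k; rewrite /= in_itv.
  by apply: (@rV_compact R n (fun=> `[lo, hi]%classic)) => k; exact: segment_compact.
pose F : set_system 'rV[R]_n := [set A | B (K `\` A)].
have FF : ProperFilter F.
  apply: Build_ProperFilter.
    by move=> H; apply: nBK; move: H; rewrite /F /= setD0.
  split=> [|A A' FA FA'|A A' AA' FA].
  - by rewrite /F /= setDT.
  - by rewrite /F /= setDIr; exact: BU.
  - by apply: Bsub FA => u [Ku nA]; split=> // Au; apply: nA; exact: AA'.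
have FK : F K by rewrite /F /= setDv.
have [u [Ku cu]] := cK F FF FK.
have [delta d0 Bu] := Bloc u Ku.
have Fc : F (~` [set v : 'rV[R]_n | forall k, `|v ord0 k - u ord0 k| <= delta]).
  by apply: Bsub Bu => v [_ /contrapT].
have nu : nbhs u [set v : 'rV[R]_n | forall k, `|v ord0 k - u ord0 k| <= delta].
  apply/nbhs_ballP; exists delta => //= v uv k.
  by have [_ /(_ ord0 k)] := uv; rewrite /ball /= distrC => /ltW.
by have [v []] := cu _ _ Fc nu.
Qed.

End BoxCovering.

(** The root of order [2 * q]; the square leaves room for two factors [r ^+ i]
    in the decay of the coefficients. *)
Lemma exists_rate (R : realType) (kap : R) (q : nat) : (0 < q)%N -> 0 < kap -> kap < 1 ->
  exists r, [/\ 0 < r, r < 1 & kap <= (r ^+ 2) ^+ q].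
Proof.
move=> q0 k0 k1; pose r := kap `^ (2 * q)%:R^-1.
have r0 : 0 < r by rewrite powR_gt0.
have rE : (r ^+ 2) ^+ q = kap.
  rewrite -exprM -powR_mulrn ?ltW// -powRrM mulVf ?powRr1 ?ltW//.
  by rewrite pnatr_eq0 muln_eq0 negb_or/= -lt0n.
exists r; split=> //; last by rewrite rE.
rewrite ltNge; apply/negP => r1.
by have := exprn_ege1 q (exprn_ege1 2 r1); rewrite rE leNgt k1.
Qed.

Section UniformComparison.
Context (R : realType) (p q : nat) (ulo uhi rho0 : R).
Local Notation U := (@param_set R p q ulo uhi rho0).
Implicit Types u v : 'rV[R]_(1 + p + q).

(** The constraint on the sum of the [t_j] is closed. *)
Lemma box_notin_param_set u : (forall k, ulo <= u ord0 k <= uhi) -> ~ U u ->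
  exists2 delta, 0 < delta & forall v, par_close delta v u -> ~ U v.
Proof.
move=> bu nU; pose S v := \sum_(1 <= j < q.+1) par_t v j.
have gap : rho0 < S u by rewrite ltNge; apply/negP => le; apply: nU.
exists ((S u - rho0) / q.+1%:R); first by rewrite divr_gt0// subr_gt0.
move=> v vu [Sv _]; have : S u - S v <= q%:R * ((S u - rho0) / q.+1%:R).
  rewrite /S -sumrB mulr_natl -[X in _ *+ X]subn0 -(subSS 0 q) -sumr_const_nat.
  rewrite big_nat_cond [leRHS]big_nat_cond; apply: ler_sum => j.
  rewrite andbT => jq; have [c cE] := @par_t_coord R p q j jq; rewrite !cE.
  by apply: le_trans (ler_norm _) _; rewrite distrC; exact: vu.
have : q%:R * ((S u - rho0) / q.+1%:R) < S u - rho0.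
  by rewrite mulrCA gtr_pMr ?subr_gt0// ltr_pdivrMr// mul1r ltr_nat.
move: Sv gap; rewrite -/(S v); move: (S u) (S v) (_ * _) => x y z; lra.
Qed.

Context d (T : measurableType d) (P : probability T R).
Variables (theta : 'rV[R]_(1 + p + q)) (gain : T -> 'rV[R]_(1 + p + q) -> nat -> R).

(** Finitely many of the local comparisons cover the parameters that are not
    close to [theta], so that their exceptional sets and initial times can be
    merged. *)
Lemma uniform_comparison :
  (forall u0, U u0 -> u0 != theta -> exists2 delta, 0 < delta &
     {ae P, forall w, exists n0, forall n u, (n0 <= n)%N -> U u -> par_close delta u u0 ->
       \sum_(2 <= k < n.+1) gain w u k < 0}) ->
  {ae P, forall w, forall j : nat, exists n0, forall n u, (n0 <= n)%N -> U u ->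
    ~ par_close j.+1%:R^-1 u theta -> \sum_(2 <= k < n.+1) gain w u k < 0}.
Proof.
move=> local; apply: ae_foralln => j.
pose B (A : set 'rV[R]_(1 + p + q)) : Prop := {ae P, forall w, exists n0, forall n u,
  (n0 <= n)%N -> A u -> U u -> ~ par_close j.+1%:R^-1 u theta ->
  \sum_(2 <= k < n.+1) gain w u k < 0}.
have : B [set u : 'rV[R]_(1 + p + q) | forall k, ulo <= u ord0 k <= uhi].
  apply: box_property => [|A A' AA'|A A'|u bu].
  - by apply/nearW => w; exists 0%N.
  - by rewrite /B; apply: filterS => w [n0 H]; exists n0 => n u nn /AA'; exact: H.
  - rewrite /B; apply: filterS2 => w [n0 H] [n1 H']; exists (maxn n0 n1) => n u.
    by rewrite geq_max => /andP[nn nn'] []; [exact: H|exact: H'].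
  - have [Uu|nU] := pselect (U u); last first.
      have [delta d0 H] := box_notin_param_set bu nU; exists delta => //.
      by apply/nearW => w; exists 0%N => n v _ /H.
    have [->|/local[//|delta d0 H]] := eqVneq u theta.
      by exists j.+1%:R^-1; rewrite ?invr_gt0//; apply/nearW => w; exists 0%N.
    exists delta => //; apply: filterS H => w [n0 H]; exists n0 => n v nn vu Uv _.
    exact: H.
by rewrite /B; apply: filterS => w [n0 H]; exists n0 => n u nn uU; apply: H => //; case: uU.
Qed.

End UniformComparison.

Section Gains.
Context (R : realType) (p q : nat) (theta : 'rV[R]_(1 + p + q)).
Variables (ulo uhi rho0 : R) (q_gt0 : (0 < q)%N) (p_gt0 : (0 < p)%N).
Variables (ulo_gt0 : 0 < ulo) (rho0_lt1 : rho0 < 1).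
Local Notation U := (param_set ulo uhi rho0).
Hypothesis thetaU : U theta.
Variable h : R -> R.
Hypothesis h_pos : forall x, 0 < h x.
Variables (e : seqspace R) (y sg : int -> R).
Hypothesis sg_gt0 : forall k, 0 < sg k.
Hypothesis y_def : forall k, y k = sg k * e k.
Hypothesis sg_def : forall k, sg k ^+ 2 = sig2 theta (tshift k e).
Implicit Type u : 'rV[R]_(1 + p + q).

Let obs2E : obs2 theta e = fun j => y j ^+ 2.
Proof. by apply/funext => j; rewrite /obs2 -sg_def y_def exprMn. Qed.

Let w_hatE k u : w_hat y k u = wpart (obs2 theta e) k u k.
Proof. by rewrite obs2E. Qed.

Let ln_term k (W : R) : 0 < W ->
  ln ((Num.sqrt W)^-1 * h (y k / Num.sqrt W)) =
  g h (e k) (Num.sqrt (sig2 theta (tshift k e) / W)) - ln (sg k).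
Proof.
move=> W0; have s0 : 0 < Num.sqrt W by rewrite sqrtr_gt0.
rewrite -sg_def sqrtrM ?sqr_ge0// sqrtr_sqr gtr0_norm// sqrtrV ?ltW// /g.
rewrite y_def [e k * _]mulrA [e k * sg k]mulrC -[sg k / _ * _]mulrA.
by rewrite [ln (sg k * _)]lnM ?posrE// ?mulr_gt0 ?invr_gt0// addrC addKr.
Qed.

(** As [y k = sg k * e k], each term of the likelihood is [g h (e k) (sg k /
    sqrt w) - ln (sg k)] with [w] the conditional variance, and the last
    logarithm does not depend on the parameter. *)
Lemma L_hat_gain n u : U u ->
  L_hat h y n u - L_hat h y n theta = n%:R^-1 * \sum_(2 <= k < n.+1) gain theta h e u k.
Proof.
move=> uU; rewrite /L_hat -mulrBr -sumrB; congr (_ * _); apply: eq_bigr => k _.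
have W0 (v : 'rV[R]_(1 + p + q)) : U v -> 0 < wpart (obs2 theta e) k v k.
  move=> vU; apply: lt_le_trans ulo_gt0 _.
  exact: (wpart_ge q_gt0 p_gt0 ulo_gt0 rho0_lt1 k (obs2_ge0 ulo_gt0 thetaU e) k vU).
rewrite !w_hatE (ln_term k (W0 _ uU)) (ln_term k (W0 _ thetaU)) /gain.
by rewrite opprB addrA subrK.
Qed.

End Gains.

(** A maximizer does at least as well as [theta], and parameters away from
    [theta] do worse. *)
Lemma argmax_close (R : realType) (p q : nat) (ulo uhi rho0 : R) (theta : 'rV[R]_(1 + p + q))
    (L : nat -> 'rV[R]_(1 + p + q) -> R) (gain : 'rV[R]_(1 + p + q) -> nat -> R)
    (theta_hat : nat -> 'rV[R]_(1 + p + q)) :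
  param_set ulo uhi rho0 theta ->
  (forall n, (1 <= n)%N -> is_argmax (param_set ulo uhi rho0) (L n) (theta_hat n)) ->
  (forall n u, param_set ulo uhi rho0 u ->
     L n u - L n theta = n%:R^-1 * \sum_(2 <= k < n.+1) gain u k) ->
  (forall j : nat, exists n0, forall n u, (n0 <= n)%N -> param_set ulo uhi rho0 u ->
     ~ par_close j.+1%:R^-1 u theta -> \sum_(2 <= k < n.+1) gain u k < 0) ->
  theta_hat n @[n --> \oo] --> theta.
Proof.
move=> thetaU amax Lgain cmp; apply/cvg_ballP => r r0.
pose j := Num.bound r^-1.
have jr : j.+1%:R^-1 < r.
  rewrite invf_plt ?posrE//; apply: lt_le_trans (archi_boundP _) _; first by rewrite invr_ge0 ltW.
  by rewrite ler_nat leqnSn.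
have [n0 H] := cmp j; exists (maxn n0 1) => // n /=; rewrite geq_max => /andP[nn n1].
have [hU hmax] := amax n n1.
have cl : par_close j.+1%:R^-1 (theta_hat n) theta.
  apply: contrapT => ncl; have := H n _ nn hU ncl.
  have n0' : 0 < n%:R^-1 :> R by rewrite invr_gt0 ltr0n.
  rewrite -(pmulr_rlt0 _ n0') -(Lgain _ _ hU) subr_lt0 ltNge.
  by rewrite hmax.
split=> // i k; rewrite /ball /= distrC; apply: le_lt_trans jr.
by rewrite !ord1; exact: cl.
Qed.

Lemma garch_solution_path (R : realType) d (T : measurableType d) (P : probability T R)
    (p q : nat) (theta : 'rV[R]_(1 + p + q)) (eps y sigma : int -> {RV P >-> R}) :
  garch_solution theta eps y sigma ->
  {ae P, forall w, garch_path theta (seqpath eps w) (fun k => sigma k w ^+ 2)}.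
Proof.
apply: filterS => w H k; have [_ _ ->] := H k; split.
  by have [_ _ <-] := H k; exact: sqr_ge0.
congr (_ + _ + _); apply: eq_bigr => i _; congr (_ * _).
by have [_ -> _] := H (k - i%:Z); rewrite exprMn.
Qed.

Lemma garch_stationary_tight (R : realType) d (T : measurableType d) (P : probability T R)
    (p q : nat) (theta : 'rV[R]_(1 + p + q)) (eps y sigma : int -> {RV P >-> R}) :
  garch_stationary theta eps y sigma ->
  forall k K, P [set w | K < sigma k w ^+ 2] = P [set w | K < sigma 0 w ^+ 2].
Proof.
move=> [_ st] k K; pose D : set (R * R) := [set x | K < x.2 ^+ 2].
have mD : measurable D.
  rewrite -[X in measurable X]setTI; apply: measurable_gt => //.
  by apply: measurable_funX; exact: measurable_snd.
have := st [:: 0] k (fun=> D) (fun=> mD).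
by rewrite set_cons1 !bigcap_set1 add0r.
Qed.

Lemma log_lik_integrable (R : realType) d (T : measurableType d) (P : probability T R)
    (X : {RV P >-> R}) (h : R -> R) (t b : R) :
  (forall x, 0 < h x) -> measurable_fun setT h -> 0 < t ->
  ('E_P[fun w => `|ln (h (X w * t))|%R] <= b%:E)%E ->
  P.-integrable setT (fun w => (g h (X w) t)%:E).
Proof.
rewrite expectation.unlock => h_pos mh t0 Eb.
have mX : measurable_fun setT X by exact: measurable_funP.
have mlh : measurable_fun setT (fun w => ln (h (X w * t))).
  apply: (measurableT_comp (@measurable_ln R)); apply: (measurableT_comp mh).
  by apply: measurable_funM.
have ilh : P.-integrable setT (EFin \o (fun w => ln (h (X w * t)))).
  apply/integrableP; split; first exact/measurable_EFinP.
  by apply: le_lt_trans Eb _; rewrite ltry.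
have ic : P.-integrable setT (EFin \o cst (ln t) : T -> \bar R).
  exact: finite_measure_integrable_cst.
have := integrableD measurableT ic ilh; apply: eq_integrable => // w _.
by rewrite /= /g -EFinD lnM ?posrE.
Qed.

Theorem theorem1p1 (R : realType) (d : measure_display) (T : measurableType d)
  (P : probability T R) (p q : nat) (hp : (1 <= p)%N) (hq : (1 <= q)%N)
  (eps y sigma : int -> {RV P >-> R}) (theta : 'rV[R]_(1 + p + q))
  (h_iid : iid eps)
  (h_omega : 0 < par_x theta)
  (h_alpha : forall i, (1 <= i <= p)%N -> 0 <= par_s theta i)
  (h_beta : forall j, (1 <= j <= q)%N -> 0 <= par_t theta j)
  (h_garch : garch_stationary theta eps y sigma)
  (ulo uhi rho0 : R)
  (h_ulo : 0 < ulo) (h_uhi : ulo < uhi) (h_rho0 : 0 < rho0 < 1)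
  (h_qulo : q%:R * ulo < rho0)
  (h : R -> R) (h_pos : forall x : R, 0 < h x) (h_meas : measurable_fun setT h)
  (h_g1 : forall y0 t : R, 0 < t -> derivable (g h y0) t 1)
  (theta_hat : nat -> T -> 'rV[R]_(1 + p + q))
  (h_theta_hat : forall n w, (1 <= n)%N ->
     is_argmax (param_set ulo uhi rho0)
       (L_hat h (fun k => y k w) n) (theta_hat n w))
  (kappa : R)
  (* (a) *)
  (h_a1 : (Elog_norm theta eps 0 < +oo)%E)
  (h_a2 : (lyapunov theta eps < 0)%E)
  (* (b) *)
  (h_b : interior (param_set ulo uhi rho0) theta)
  (* (c) *)
  (h_c : coprimep (alpha_poly theta) (beta_poly theta))
  (* (d) *)
  (h_d : nondegenerate_rv P (fun w => eps 0 w ^+ 2))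
  (* (e) *)
  (h_e : exists mu : R, 0 < mu /\
     t `^ (- mu) * fine (P [set w | eps 0 w ^+ 2 <= t]) @[t --> 0^'+] --> 0)
  (* (f) *)
  (h_kappa : 0 < kappa)
  (h_f : ('E_P[fun w => (`|eps 0 w ^+ 2| `^ kappa)%R] < +oo)%E)
  (* (g) *)
  (h_g : exists C0 nu0 : R, [/\ 0 < C0, 0 <= nu0 < 2 * kappa &
     forall t : R, 0 < t ->
       ('E_P[fun w => `|ln (h (eps 0 w * t))|%R]
          <= (C0 * (t `^ nu0 + 1))%:E)%E])
  (* (h) *)
  (h_h : exists (C1 : R -> R) (nu1 : R),
     [/\ measurable_fun setT C1, 0 <= nu1 < 2 * kappa,
         forall y0 t : R, 0 < t -> `|g1 h y0 t| <= C1 y0 * (t `^ nu1 + 1) / t &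
         ('E_P[fun w => C1 (eps 0%R w)] < +oo)%E])
  (* (i) *)
  (h_i : forall t : R, 0 < t -> t != 1 ->
     ('E_P[fun w => g h (eps 0%R w) t] < 'E_P[fun w => g h (eps 0%R w) 1%R])%E) :
  {ae P, forall w, theta_hat n w @[n --> \oo] --> theta}.
Proof.
have [r0 r1] := andP h_rho0.
have ulo1 : ulo < 1.
  apply: le_lt_trans (lt_trans h_qulo r1).
  by apply: ler_peMl; [exact: ltW|rewrite ler1n].
have thetaU : param_set ulo uhi rho0 theta := interior_subset h_b.
have [r [rr0 rr1 kr]] : exists r, [/\ 0 < r, r < 1 & (1 + rho0) / 2 <= (r ^+ 2) ^+ q].
  by apply: exists_rate => //; lra.
have rk : rho0 < (1 + rho0) / 2 by lra.
have [mu [mu0 small]] := h_e.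
have [C1 [nu [mC1 /andP[nu0 _] g1b C1i]]] := h_h.
have em : (\int[P]_w (`|eps 0 w ^+ 2| `^ kappa)%:E < +oo)%E.
  by move: h_f; rewrite expectation.unlock.
have [s [s0 s1 _ ssum]] :=
  past_moment_small hq hp h_ulo h_uhi thetaU h_iid h_kappa em h_a2.
have [sol _] := h_garch; have gpath := garch_solution_path sol.
have ma k : measurable_fun setT (fun w => sigma k w ^+ 2).
  by apply: measurable_funX; exact: measurable_funP.
have vol := volatility_sig2 hq hp h_ulo ulo1 h_uhi thetaU h_iid s0 ssum
  (a := fun k w => sigma k w ^+ 2) ma gpath (garch_stationary_tight h_garch).
have mem := memory_ge hq hp h_ulo h_uhi thetaU h_iid s0 s1 ssum rr0 rr1.
have good_ae : {ae P, forall w, good theta r s (seqpath eps w)}.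
  have eps0 : {ae P, forall w, forall k, eps k w != 0}.
    by apply: ae_forallZ => k; exact: (eps_neq0 h_iid mu0 small).
  apply: filterS3 (filterI gpath vol) mem eps0 => w [gw vw] mw ew; split=> //.
  by rewrite -(funext vw).
pose N := (Num.bound (nu / (mu / 2))).+1.
have nuN : nu <= mu / 2 * N%:R.
  rewrite mulrC -ler_pdivrMr ?divr_gt0//; apply: le_trans (ler_norm _) _.
  by apply: le_trans (ltW (archi_boundP (normr_ge0 _))) _; rewrite ler_nat /Num.bound normr_id.
have C1f : (\int[P]_w (C1 (eps 0 w))%:E < +oo)%E.
  by move: C1i; rewrite expectation.unlock.
have g_int t : 0 < t -> P.-integrable setT (fun w => (g h (eps 0 w) t)%:E).
  have [C0 [nu0' [_ _ E]]] := h_g.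
  by move=> t0; exact: (log_lik_integrable h_pos h_meas t0 (E t t0)).
have g_max t : 0 < t -> t != 1 ->
    (\int[P]_w (g h (eps 0 w) t)%:E < \int[P]_w (g h (eps 0 w) 1)%:E)%E.
  by move=> t0 t1; have := h_i t t0 t1; rewrite expectation.unlock.
have local u0 : param_set ulo uhi rho0 u0 -> u0 != theta -> exists2 delta, 0 < delta &
    {ae P, forall w, exists n0, forall n u, (n0 <= n)%N ->
      param_set ulo uhi rho0 u -> par_close delta u u0 ->
      \sum_(2 <= k < n.+1) gain theta h (seqpath eps w) u k < 0}.
  exact: (local_gain_neg hq hp h_ulo ulo1 h_uhi (ltW r0) r1 thetaU rr0 rr1 rk kr h_iid
    s0 s1 h_meas h_g1 nu0 mC1 g1b C1f mu0 nuN (ltn0Sn _)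
    (recent_inverse_moment h_iid mu0 small N)
    (memory_moment hq hp h_ulo h_uhi thetaU h_iid s0 s1 ssum rr0 rr1)
    good_ae h_c h_d g_int g_max).
have cmp := uniform_comparison local.
apply: filterS3 (filterI gpath vol) sol cmp => w [gw vw] sw cw.
have sg0 k : 0 < sigma k w.
  have [sk _ _] := sw k; rewrite lt_neqAle sk andbT eq_sym; apply/eqP => z.
  have := garch_path_ge h_ulo thetaU gw k.
  by rewrite z expr0n/= leNgt h_ulo.
apply: (argmax_close thetaU (h_theta_hat ^~ w)) cw => n u uU.
apply: (L_hat_gain hq hp h_ulo r1 thetaU h_pos (sg := fun k => sigma k w)) => //.
by move=> k; have [] := sw k.
Qed.
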